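(* The cobar differential in $\mathcal Gerst_\infty=\mathcal D(\mathcal Gerst^!)$ is given on the generators $\ell_n$ ($n\ge2$) and $m_{p;q}$ ($p\ge2$, $q\ge0$) by $$d\,\ell_n=\sum_{\substack{I_1\sqcup I_2=\{1,\dots,n\}\\ \#I_1\ge2,\ \#I_2\ge1}}\ell(\ell(I_1),I_2)$$ and, for $n=p+q$, with planar inputs labelled $1,\dots,p$ and space inputs labelled $p+1,\dots,n$, $$\begin{aligned}d\,m_{p;q}=\;&\sum_{\#I_1\ge2,\ \#I_2\ge0}m(1,\dots,p\,;\,\ell(I_1),I_2)\;-\sum_{\#I_1\ge0,\ \#I_2\ge1}\ell\bigl(m(1,\dots,p\,;I_1),I_2\bigr)\\&+\sum_{\#I_1\ge1,\ \#I_2\ge0}\ \sum_{s=1}^{p}m\bigl(1,\dots,s-1,\ell(s,I_1),s+1,\dots,p\,;I_2\bigr)\\&+\sum_{\#I_1\ge0,\ \#I_2\ge0}\ \sum_{\substack{l+r=p+1\\ l,r\ge2}}\ \sum_{s=0}^{r-1}(-1)^{l+s(l+1)}\,m\bigl(1,\dots,s,m(s+1,\dots,s+l\,;I_1),s+l+1,\dots,p\,;I_2\bigr),\end{aligned}$$ where in every sum of the second formula $I_1\sqcup I_2=\{p+1,\dots,n\}$.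
   Context: $k$ is a field of characteristic $0$; $V[p]^i=V^{i+p}$; differentials have degree $+1$; operads are non-unital with partial compositions $\circ_i$, and differentials of dg operads satisfy $d(f\circ_ig)=(df)\circ_ig+(-1)^{|f|}f\circ_i(dg)$ and are equivariant. $\mathcal Gerst$ is the operad of (non-commutative) Gerstenhaber algebras: graded vector spaces with a degree $0$ associative product $\circ$ (not assumed commutative) and a degree $-1$ Lie bracket $[\,\bullet\,]:\odot^2V\to V$ (a graded Lie bracket on the space with degrees shifted by one) such that $[a\bullet(b\circ c)]=[a\bullet b]\circ c+(-1)^{(|a|+1)|b|}b\circ[a\bullet c]$. It is quadratic. $\mathcal Gerst^!$ is its quadratic (Koszul) dual operad and $\mathcal D$ is the Ginzburg–Kapranov cobar construction. As an operad, $\mathcal Gerst_\infty$ is freely generated by symmetric elements $\ell_n$ of arity $n\ge2$ and degree $3-2n$ (corollas with all $n$ inputs ''space''), and by elements $m_{p;q}$ of arity $n=p+q$, $p\ge2$, $q\ge0$, and degree $2-p-2q$ (corollas with $p$ linearly ordered ''planar'' inputs without symmetry and $q$ symmetric ''space'' inputs), together with their relabellings. Elements of the operad are linear combinations of trees built from these corollas, and composition is grafting of the root of one tree into an input of another. In the formulas, $\ell(\dots)$ and $m(\dots;\dots)$ denote the generating corollas with the indicated number of inputs; for a finite set $I$ of labels, writing $I$ as arguments means inserting its elements in symmetric inputs. A nested expression $f(\dots,g(\dots),\dots)$ denotes the tree in which the root of the corolla $g$ is grafted into the indicated input of the corolla $f$, with inputs labelled as displayed.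
   Formalization: Signs in d m_{p;q} are corrected: it equals (-1)^{p+1} times the displayed four sums, the second taken with -(-1)^p instead of -1; as printed, d² m_{2;2} has coefficient -2 at ℓ(ℓ(m(1,2),3),4), so d² ≠ 0. *)

(* Defs.v *)
From HB Require Import structures.
From mathcomp Require Import all_boot all_order all_algebra.
From mathcomp Require Import finmap boolp monalg.

Set Implicit Arguments.
Unset Strict Implicit.
Unset Printing Implicit Defensive.

Import GRing.Theory.
Local Open Scope ring_scope.

(* Operads are handled by labelled inputs: for a duplicate-free list S of
   natural numbers, F(S) is spanned by the trees whose leaves are labelled
   bijectively by S, and arity n is S = [1, ..., n].  A tree with vertices
   read in prefix order (a vertex before its children, children from left to
   right) stands for the corresponding iterated partial composition; all
   Koszul signs below come from this reading, so that
     f o_x g  puts the vertices of g at the position of the leaf x of f. *)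
Inductive tree (X : Type) := Leaf of nat | Node of X & seq (tree X).
Arguments Leaf {X} _.

HB.instance Definition _ (X : Type) := gen_eqMixin (tree X).
HB.instance Definition _ (X : Type) := gen_choiceMixin (tree X).

Definition lin (k : fieldType) (X : Type) := {malg k[tree X]}.

Section Trees.
Variables (X : Type) (dg : X -> int).

Fixpoint leaves (t : tree X) : seq nat :=
  match t with
  | Leaf a => [:: a]
  | Node _ ts => flatten [seq leaves u | u <- ts]
  end.

Fixpoint tbind (h : nat -> tree X) (t : tree X) : tree X :=
  match t with
  | Leaf a => h a
  | Node g ts => Node g [seq tbind h u | u <- ts]
  end.

Definition trelabel (h : nat -> nat) := tbind (fun a => Leaf (h a)).

(* The prefix word of a tree: leaves by label, vertices by degree. *)
Fixpoint pword (t : tree X) : seq (nat + int) :=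
  match t with
  | Leaf a => [:: inl a]
  | Node g ts => inr (dg g) :: flatten [seq pword u | u <- ts]
  end.

Definition wdeg (w : seq (nat + int)) : int :=
  \sum_(e <- w) (if e is inr d then d else 0).

Definition tdeg (t : tree X) : int := wdeg (pword t).

Definition deg_after (x : nat) (t : tree X) : int :=
  wdeg (drop (index (inl x) (pword t)) (pword t)).

End Trees.

Section Linear.
Variables (k : fieldType) (X : Type).

Definition linext (V : lmodType k) (F : tree X -> V) (f : lin k X) : V :=
  \sum_(t <- msupp f) f@_t *: F t.

Definition relabel (h : nat -> nat) : lin k X -> lin k X :=
  linext (fun t => << trelabel h t >> : lin k X).

(* f o_x g *)
Definition graft (dg : X -> int) (x : nat) (f g : lin k X) : lin k X :=
  linext (fun t => linext (fun u =>
    << (-1) ^ (tdeg dg u * deg_after dg x t) *g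
       tbind (fun a => if a == x then u else Leaf a) t >> : lin k X) g) f.

End Linear.

(* A graded operad given by generators (each spanning a free S_n-module in
   arity n = arity g) and relations; the relations in [rel n] live in
   arity n, on the labels 1, ..., n. *)
Record presentation (k : fieldType) := Presentation {
  gen : Type;
  arity : gen -> nat;
  gdeg : gen -> int;
  rel : nat -> lin k gen -> Prop }.

Section Presented.
Variables (k : fieldType) (P : presentation k).

Fixpoint wf (t : tree (gen P)) : bool :=
  match t with
  | Leaf _ => true
  | Node g ts => (size ts == arity g) && all wf ts
  end.

(* Operads are non-unital: a bare leaf is not an element. *)
Definition monomial (S : seq nat) (t : tree (gen P)) : bool :=
  [&& (if t is Leaf _ then false else true), wf t & perm_eq (leaves t) S].

Definition in_free (S : seq nat) (f : lin k (gen P)) : Prop :=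
  forall t, t \in msupp f -> monomial S t.

(* The operadic ideal generated by the relations. *)
Inductive ideal : seq nat -> lin k (gen P) -> Prop :=
| ideal_rel n r : rel n r -> in_free (iota 1 n) r -> ideal (iota 1 n) r
| ideal_0 S : ideal S 0
| ideal_lin S a f g : ideal S f -> ideal S g -> ideal S (a *: f + g)
| ideal_perm S S' f : perm_eq S S' -> ideal S f -> ideal S' f
| ideal_relabel S h f : uniq (map h S) -> ideal S f ->
    ideal (map h S) (relabel h f)
| ideal_graftl x S S' f g : uniq (x :: S) -> uniq (S ++ S') ->
    ideal (x :: S) f -> in_free S' g ->
    ideal (S ++ S') (graft (@gdeg k P) x f g)
| ideal_graftr x S S' f g : uniq (x :: S) -> uniq (S ++ S') ->
    in_free (x :: S) f -> ideal S' g ->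
    ideal (S ++ S') (graft (@gdeg k P) x f g).

(* Equality of f, g \in F(S) in the presented operad. *)
Definition eqop (S : seq nat) (f g : lin k (gen P)) : Prop := ideal S (f - g).

(* A homogeneous element, of degree [cdeg], of the graded dual of P(n): a
   functional on the free operad in arity n which vanishes on the ideal and
   on all degrees but - cdeg. *)
Record cogen := Cogen {
  carity : nat;
  cdeg : int;
  cfun :> tree (gen P) -> k;
  cfun_supp : forall t, cfun t != 0 ->
    monomial (iota 1 carity) t /\ tdeg (@gdeg k P) t = - cdeg;
  cfun_ideal : forall f, ideal (iota 1 carity) f ->
    linext (cfun : tree (gen P) -> k^o) f = 0 }.

End Presented.

Arguments gen {k} p.
Arguments gdeg {k} p _.
Arguments eqop {k} P S f g.
Arguments cogen {k} P.

(* The order-preserving relabelling of the list s by 1, ..., size s. *)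
Definition std (s : seq nat) (a : nat) : nat := (index a s).+1.

Fixpoint inversions (s : seq nat) : nat :=
  if s is a :: s' then (count (fun b => (b < a)%N) s' + inversions s')%N
  else 0%N.

Definition lf (X : Type) (s : seq nat) : seq (tree X) := [seq Leaf a | a <- s].
Arguments lf {X} s.

(* The labels p + 1, ..., p + n selected by I, in increasing order. *)
Definition lab (p n : nat) (I : {set 'I_n}) : seq nat :=
  [seq (p + val i).+1 | i <- enum I].
Arguments lab p {n} I.

(* The cobar construction D(P): the free operad on
     E(n) = P(n)^* (x) sgn_n [n - 2],
   i.e. an element of P(n)^* of degree d has degree d + 2 - n in E(n), with
   the differential dual to the partial compositions of P.  The corolla
   [Node phi [s_1, ..., s_n]] is the functional phi on P(n) transported to
   the labels s_1, ..., s_n. *)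
Section Cobar.
Variables (k : fieldType) (P : presentation k).

Inductive cobar_rel : nat -> lin k (cogen P) -> Prop :=
| cobar_linear n (a : k) (phi psi chi : cogen P) :
    [/\ carity phi = n, carity psi = n & carity chi = n] ->
    cdeg phi = cdeg chi -> cdeg psi = cdeg chi ->
    (forall t, chi t = a * phi t + psi t) ->
    cobar_rel n (<< Node chi (lf (iota 1 n)) >>
      - a *: << Node phi (lf (iota 1 n)) >> - << Node psi (lf (iota 1 n)) >>)
| cobar_equivariant n (phi psi : cogen P) (s : seq nat) :
    carity phi = n -> carity psi = n -> cdeg phi = cdeg psi ->
    perm_eq s (iota 1 n) ->
    (forall t, psi t = phi (trelabel (std s) t)) ->
    cobar_rel n (<< Node phi (lf s) >>
      - (-1) ^+ inversions s *: << Node psi (lf (iota 1 n)) >>).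

Definition cobar : presentation k :=
  @Presentation k (cogen P) (@carity k P)
    (fun phi => cdeg phi + 2 - (carity phi)%:Z) cobar_rel.

(* [s] is a list of pairs (u, v) with
     phi (x o_0 y) = \sum (u (x) v) (x (x) y)
   for x \in P({0} u I^c), y \in P(I), where
   (u (x) v) (x (x) y) = (-1)^(|v| |x|) u(x) v(y) and |x| = - |u|. *)
Definition is_decomposition (phi : cogen P) (I : {set 'I_(carity phi)})
    (s : seq (cogen P * cogen P)) : Prop :=
  all (fun uv : cogen P * cogen P =>
    [&& carity uv.1 == #|~: I|.+1, carity uv.2 == #|I| &
        cdeg uv.1 + cdeg uv.2 == cdeg phi]) s /\
  forall x y,
    monomial (0%N :: lab 0 (~: I)) x -> monomial (lab 0 I) y ->
    linext (phi : tree (gen P) -> k^o) (graft (gdeg P) 0 << x >> << y >>) =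
    \sum_(uv <- s) (-1) ^ (cdeg uv.1 * cdeg uv.2) *
       uv.1 (trelabel (std (0%N :: lab 0 (~: I))) x) *
       uv.2 (trelabel (std (lab 0 I)) y).

(* Exists as soon as the P(n) are finite-dimensional; any two choices yield
   the same [d_gen] below in D(P), by [cobar_linear]. *)
Definition decomposition (phi : cogen P) (I : {set 'I_(carity phi)}) :
    seq (cogen P * cogen P) :=
  if pselect (exists s, is_decomposition I s) is left h
  then sval (cid h) else [::].

(* The sign is the one of F(s (P (x) L)^* ), where s has degree 1, the
   degree 1 differential on s Q^* is dual to the composition of Q, and L is
   the endomorphism operad of a line in degree -1, so L(n) = sgn_n[1-n]:
   the shuffle sign is the action on L; (-1)^(#I (|u| + #I^c)) collects the
   Koszul signs of s and of the composition of P (x) L. *)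
Definition d_gen (phi : cogen P) : lin k (cogen P) :=
  \sum_(I : {set 'I_(carity phi)} | (2 <= #|I|)%N && (1 <= #|~: I|)%N)
  \sum_(uv <- decomposition I)
     ((-1) ^+ inversions (lab 0 I ++ lab 0 (~: I)) *
      (-1) ^ ((#|I|)%:Z * (cdeg uv.1 + (#|~: I|)%:Z))) *:
     << Node uv.1 (Node uv.2 (lf (lab 0 I)) :: lf (lab 0 (~: I))) >>.

(* The Koszul exponent for moving t_1, ..., t_n, initially placed in this
   order after the vertices of w, to the leaves 1, ..., n of w. *)
Definition subst_exponent (ts : seq (tree (cogen P))) (w : tree (cogen P)) :
    int :=
  let d i := tdeg (gdeg cobar) (nth (Leaf 0) ts i) in
  \sum_(i < size ts) d i * deg_after (gdeg cobar) i.+1 w +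
  \sum_(i < size ts) \sum_(j < size ts |
     (i < j)%N && (index j.+1 (leaves w) < index i.+1 (leaves w))%N)
     d i * d j.

Definition subst (ts : seq (tree (cogen P))) : lin k (cogen P) ->
    lin k (cogen P) :=
  linext (fun w => << (-1) ^ subst_exponent ts w *g
    tbind (fun a => nth (Leaf a) ts a.-1) w >> : lin k (cogen P)).

Fixpoint d_tree (t : tree (cogen P)) : lin k (cogen P) :=
  match t with
  | Leaf _ => 0
  | Node phi ts =>
      subst ts (d_gen phi) +
      \sum_(i < size ts)
        (-1) ^ (gdeg cobar phi +
                \sum_(j < i) tdeg (gdeg cobar) (nth (Leaf 0) ts j)) *:
        linext (fun u => << Node phi (set_nth (Leaf 0) ts i u) >> :
                  lin k (cogen P))
          (nth 0 [seq d_tree u | u <- ts] i)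
  end.

(* The derivation d (f o_x g) = (d f) o_x g + (-1)^|f| f o_x (d g)
   extending d_gen. *)
Definition cobar_d : lin k (cogen P) -> lin k (cogen P) := linext d_tree.

End Cobar.

(* Binary quadratic data: E is the graded S_2-module with basis [qgen] and
   x . (1 2) = (-1)^(qsgn x) qop x; the subspace R of F(E)(3) is the
   S_3-submodule generated by [qrel]. *)
Record quadratic_data (k : fieldType) := QuadraticData {
  qgen : finType;
  qdeg : qgen -> int;
  qop : qgen -> qgen;
  qsgn : qgen -> bool;
  qopK : involutive qop;
  qdeg_op : forall x, qdeg (qop x) = qdeg x;
  qsgn_op : forall x, qsgn (qop x) = qsgn x;
  qrel : lin k qgen -> Prop }.

Section Quadratic.
Variables (k : fieldType) (Q : quadratic_data k).

Inductive quadratic_rel : nat -> lin k (qgen Q) -> Prop :=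
| quadratic_sym x : quadratic_rel 2
    (<< Node x (lf [:: 2; 1]%N) >>
     - (-1) ^+ qsgn x *: << Node (qop x) (lf [:: 1; 2]%N) >>)
| quadratic_R r : qrel r -> quadratic_rel 3 r.

(* F(E)/(R) *)
Definition quadratic_operad : presentation k :=
  @Presentation k (qgen Q) (fun _ => 2) (@qdeg k Q) quadratic_rel.

(* F(E)(3) has the basis x(y(a,b),c), with (a,b,c) a cyclic permutation of
   (1,2,3), recorded as (x, y, c); [normal3 sg t] writes t as a signed basis
   element, for the S_2-action x . (1 2) = (-1)^(sg x) qop x. *)
Definition normal3 (sg : qgen Q -> bool) (t : tree (qgen Q)) :
    option (bool * (qgen Q * qgen Q * nat)) :=
  let rot s x y a b c := if b == (a %% 3).+1 then (s, (x, y, c))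
                         else (s (+) sg y, (x, qop y, c)) in
  match t with
  | Node x [:: Node y [:: Leaf a; Leaf b]; Leaf c] =>
      Some (rot false x y a b c)
  | Node x [:: Leaf c; Node y [:: Leaf a; Leaf b]] =>
      Some (rot (sg x) (qop x) y a b c)
  | _ => None
  end.

(* The pairing of F(E^v)(3) with F(E)(3), for E^v = E^* (x) sgn_2 with the
   dual basis; cyclic permutations being even, it pairs the two bases above
   dually, with the Koszul sign of (x^* (x) y^* )(x (x) y). *)
Definition pairing3 (r' r : lin k (qgen Q)) : k :=
  linext (fun t' => linext (fun t =>
    match normal3 (fun x => ~~ qsgn x) t', normal3 (@qsgn k Q) t with
    | Some (s', m'), Some (s, m) =>
        if m' == m
        then (-1) ^+ (s' (+) s) * (-1) ^ (qdeg m.1.1 * qdeg m.1.2) else 0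
    | _, _ => 0
    end : k^o) r) r'.

Definition dual_rel (r' : lin k (qgen Q)) : Prop :=
  @in_free k quadratic_operad (iota 1 3) r' /\
  forall r s, qrel r -> perm_eq s (iota 1 3) ->
    pairing3 r' (relabel (std s) r) = 0.

Lemma quadratic_dual_deg (x : qgen Q) : - qdeg (qop x) = - qdeg x.
Proof. by rewrite qdeg_op. Qed.

Lemma quadratic_dual_sgn (x : qgen Q) : ~~ qsgn (qop x) = ~~ qsgn x.
Proof. by rewrite qsgn_op. Qed.

(* (E^v, R^perp) *)
Definition quadratic_dual : quadratic_data k :=
  @QuadraticData k (qgen Q) (fun x => - qdeg x) (@qop k Q)
    (fun x => ~~ qsgn x) (@qopK k Q) quadratic_dual_deg quadratic_dual_sgn
    dual_rel.

End Quadratic.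

(* inl false is the product, inl true the opposite product, inr tt the
   bracket. *)
Definition gerst_gen : finType := (bool + unit)%type.

Definition g_prod : gerst_gen := inl false.
Definition g_opp : gerst_gen := inl true.
Definition g_brac : gerst_gen := inr tt.

Definition gerst_deg (x : gerst_gen) : int := if x is inr _ then -1 else 0.

Definition gerst_op (x : gerst_gen) : gerst_gen :=
  if x is inl b then inl (~~ b) else x.

Lemma gerst_opK : involutive gerst_op.
Proof. by case=> [[]|[]]. Qed.

Lemma gerst_deg_op x : gerst_deg (gerst_op x) = gerst_deg x.
Proof. by case: x => [[]|[]]. Qed.

Definition mu (a b : tree gerst_gen) := Node g_prod [:: a; b].
Definition br (a b : tree gerst_gen) := Node g_brac [:: a; b].

(* As an operation the bracket is a symmetric element of degree -1; the sign
   (-1)^((|a|+1)|b|) of the Leibniz rule is the Koszul sign of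
   (a, b, c) |-> b o [a, c]. *)
Inductive gerst_rel (k : fieldType) : lin k gerst_gen -> Prop :=
| gerst_assoc : gerst_rel
    (<< mu (mu (Leaf 1) (Leaf 2)) (Leaf 3) >>
     - << mu (Leaf 1) (mu (Leaf 2) (Leaf 3)) >>)
| gerst_jacobi : gerst_rel
    (<< br (br (Leaf 1) (Leaf 2)) (Leaf 3) >>
     + << br (br (Leaf 2) (Leaf 3)) (Leaf 1) >>
     + << br (br (Leaf 3) (Leaf 1)) (Leaf 2) >>)
| gerst_leibniz : gerst_rel
    (<< br (Leaf 1) (mu (Leaf 2) (Leaf 3)) >>
     - << mu (br (Leaf 1) (Leaf 2)) (Leaf 3) >>
     - << mu (Leaf 2) (br (Leaf 1) (Leaf 3)) >>).

Definition Gerst (k : fieldType) : quadratic_data k :=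
  @QuadraticData k gerst_gen gerst_deg gerst_op (fun _ => false)
    gerst_opK gerst_deg_op (fun _ => erefl) (@gerst_rel k).

Definition Gerst_dual (k : fieldType) : presentation k :=
  quadratic_operad (quadratic_dual (Gerst k)).

Definition Gerst_infty (k : fieldType) : presentation k :=
  cobar (Gerst_dual k).

Section Generators.
Variables (k : fieldType).
Variables (L : nat -> cogen (Gerst_dual k)).
Variables (M : nat -> nat -> cogen (Gerst_dual k)).

Definition ell (ts : seq (tree (cogen (Gerst_dual k)))) :=
  Node (L (size ts)) ts.

Definition em (ps qs : seq (tree (cogen (Gerst_dual k)))) :=
  Node (M (size ps) (size qs)) (ps ++ qs).

(* The combination of the corollas of arity n whose coefficients are c0 on
   ell(1,...,n) and c a on the corolla m_{p;n-p} with planar inputs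
   a_1, ..., a_p. *)
Definition corolla_combination (n : nat) (c0 : k) (c : seq nat -> k) :
    lin k (cogen (Gerst_dual k)) :=
  c0 *: << ell (lf (iota 1 n)) >> +
  \sum_(p < n.+1 | (2 <= p)%N) \sum_(a : p.-tuple 'I_n | uniq a)
    let a' := [seq (val i).+1 | i <- a] in
    c a' *: << em (lf a') (lf [seq x <- iota 1 n | x \notin a']) >>.

(* Gerst_infty being by construction free on an S-module E, it is freely
   generated by the ell_n and m_{p;q} when these have the stated symmetry
   and their relabellings form a basis of E(n) for every n.  In arity 2 the
   generators are normalized to be the bracket and the product. *)
Definition standard_generators : Prop :=
  [/\ forall n, (2 <= n)%N -> carity (L n) = n /\
        gdeg (Gerst_infty k) (L n) = 3 - (2 * n)%:Z,
      forall p q, (2 <= p)%N -> carity (M p q) = (p + q)%N /\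
        gdeg (Gerst_infty k) (M p q) = 2 - p%:Z - (2 * q)%:Z,
      forall n s, (2 <= n)%N -> perm_eq s (iota 1 n) ->
        eqop (Gerst_infty k) (iota 1 n)
          << ell (lf s) >> << ell (lf (iota 1 n)) >>,
      forall p q s, (2 <= p)%N -> perm_eq s (iota p.+1 q) ->
        eqop (Gerst_infty k) (iota 1 (p + q))
          << em (lf (iota 1 p)) (lf s) >>
          << em (lf (iota 1 p)) (lf (iota p.+1 q)) >> &
      [/\ forall n (phi : cogen (Gerst_dual k)),
            (2 <= n)%N -> carity phi = n ->
            exists c0 c, eqop (Gerst_infty k) (iota 1 n)
              << Node phi (lf (iota 1 n)) >> (corolla_combination n c0 c),
          forall n c0 c, (2 <= n)%N ->
            eqop (Gerst_infty k) (iota 1 n) (corolla_combination n c0 c) 0 ->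
            c0 = 0 /\
            forall p (a : p.-tuple 'I_n), (2 <= p)%N -> uniq a ->
              c [seq (val i).+1 | i <- a] = 0,
          L 2 (br (Leaf 1) (Leaf 2)) = 1,
          M 2 0 (mu (Leaf 1) (Leaf 2)) = 1 &
          M 2 0 (Node g_opp (lf [:: 1; 2]%N)) = 0]].

End Generators.

(* Main.v *)
Require Import Defs.
From HB Require Import structures.
From mathcomp Require Import all_boot all_order all_algebra.
From mathcomp Require Import finmap boolp monalg zify ring.

Set Implicit Arguments.
Unset Strict Implicit.
Unset Printing Implicit Defensive.

Import GRing.Theory.
Local Open Scope ring_scope.

(** The differential of the cobar construction is dual to the composition of the
    dual operad, so the proof makes that operad explicit.

    Modulo its relations, every tree with labels 1, ..., n is a combination of
    normal trees: a product of labels a_1, ..., a_p, associated to the right,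
    on which the remaining labels, in increasing order, act by iterated
    brackets ([red_is_normal]). The one relation that is not quadratic is the
    vanishing of a bracket of two products; it is a consequence in arity four,
    and its proof divides by 2 ([bracket_of_products]).

    Conversely each word a = a_1 ... a_p of labels defines a functional [chi]
    on trees, for which the labels in a are planar and the others are space
    labels. It is a sign if the products of the tree arrange the planar labels
    in the order a, every product having planar labels in both arguments and
    every bracket in at most one, and 0 otherwise; the sign sorts the odd
    letters of the tree, which are its brackets and its space labels. These
    functionals vanish on the ideal ([Chi_ideal]): in arity three they are pairings with the relations
    of the Gerstenhaber operad, and on a composite they are products of such
    functionals. So the words of length different from 1 index a basis of the
    dual ([cogen_expand]), and the corollas of this basis, normalised by
    suitable signs, are the standard generators: the empty word gives the space
    corolla, and the word 1 ... p gives the planar corolla with p planar inputs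
    ([gen_standard]).

    On a composite x o_0 y the functional of a is nonzero only in two cases.
    Either y has no planar label, and the value is, up to sign, the product of
    the functionals of a at x and of the empty word at y ([chi_plug_space]); or
    a = l b r with b the planar labels of y, and the value is, up to sign, the
    product of the functionals of l 0 r at x and of b at y
    ([chi_plug_planar]). Thus every cut of the inputs contributes at most one
    tree with two vertices. A word of length one has the same functional as the empty word, up to sign
    ([chin_one]). Hence the cut with b empty gives m(1, ..., p; l(I1), I2), with b
    of length one m(..., l(s, I1), ...; I2), with b the whole word
    l(m(1, ..., p; I1), I2), and the remaining ones m(..., m(...; I1), ...; I2).
    The coefficients are products of the shuffle sign of the cut, Koszul signs
    and normalisations of generators, and are compared by parity. *)

(** * Linear combinations of trees *)

Section LinearExtension.
Variables (k : fieldType) (X : Type).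

Lemma tree_induction (P : tree X -> Prop) :
  (forall a, P (Leaf a)) ->
  (forall g ts, (forall t, t \in ts -> P t) -> P (Node g ts)) ->
  forall t, P t.
Proof.
move=> HL HN; fix IH 1; case=> [a|g ts]; first exact: HL.
apply: HN; elim: ts => [|u ts IHts] t tin.
  by clear IH; rewrite in_nil in tin.
move: tin; rewrite in_cons => /orP[/eqP->|]; [exact: IH | exact: IHts].
Qed.

Section Ext.
Variables (V : lmodType k) (F : tree X -> V).

Lemma linextEw (d : {fset tree X}) (f : lin k X) : (msupp f `<=` d)%fset ->
  linext F f = \sum_(t <- d) f@_t *: F t.
Proof.
move=> sfd; rewrite /linext (big_fset_incl _ sfd) // => t _ tf.
by rewrite mcoeff_outdom // scale0r.
Qed.

Lemma linext_is_linear : linear (linext F).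
Proof.
move=> a f g.
pose d := (msupp f `|` msupp g)%fset.
rewrite (@linextEw d (a *: f + g)); last first.
  apply: (fsubset_trans (msuppD_le _ _)); rewrite fsetSU //; exact: msuppZ_le.
rewrite (@linextEw d f) ?fsubsetUl // (@linextEw d g) ?fsubsetUr //.
rewrite scaler_sumr -big_split /=; apply: eq_bigr => t _.
by rewrite mcoeffD mcoeffZ scalerDl scalerA.
Qed.

HB.instance Definition _ :=
  GRing.isLinear.Build k (lin k X) V *:%R (linext F) linext_is_linear.

Lemma linextU c t : linext F << c *g t >> = c *: F t.
Proof.
rewrite (@linextEw [fset t]%fset) ?msuppU_le // big_seq_fset1.
by rewrite mcoeffUU.
Qed.

Lemma linextU1 t : linext F << t >> = F t.
Proof. by rewrite linextU scale1r. Qed.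

End Ext.

Lemma lin_expand (f : lin k X) : f = \sum_(t <- msupp f) f@_t *: << t >>.
Proof.
rewrite {1}[f]monalgE; apply: eq_bigr => t _.
by apply/malgP => u; rewrite mcoeffZ !mcoeffU mulrnAr mulr1.
Qed.

Lemma scale_mono (c : k) (t : tree X) : c *: << t >> = << c *g t >> :> lin k X.
Proof. by apply/malgP => u; rewrite mcoeffZ !mcoeffU mulrnAr mulr1. Qed.

Lemma eq_linext_supp (V : lmodType k) (F G : tree X -> V) (f : lin k X) :
  (forall t, t \in msupp f -> F t = G t) -> linext F f = linext G f.
Proof. by move=> FG; apply: eq_big_seq => t tf; rewrite FG. Qed.

Lemma linext_comp (V W : lmodType k) (A : {linear V -> W}) (F : tree X -> V) f :
  A (linext F f) = linext (fun t => A (F t)) f.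
Proof. by rewrite /linext linear_sum; apply: eq_bigr => t _; rewrite linearZ. Qed.

Lemma linext_mono (f : lin k X) : linext (fun t => << t >>) f = f.
Proof. by rewrite {2}[f]lin_expand. Qed.

Section Graft.
Variable dg : X -> int.

Definition plug (x : nat) (t u : tree X) : tree X :=
  tbind (fun a => if a == x then u else Leaf a) t.

Lemma graftE x (f g : lin k X) : graft dg x f g =
  \sum_(t <- msupp f) \sum_(u <- msupp g)
     (f@_t * g@_u * (-1) ^ (tdeg dg u * deg_after dg x t)) *: << plug x t u >>.
Proof.
rewrite /graft /linext; apply: eq_bigr => t _; rewrite scaler_sumr.
apply: eq_bigr => u _; rewrite -scale_mono !scalerA; congr (_ *: _).
Qed.

Lemma graftUU x t u : graft dg x << t >> << u >> =
  (-1) ^ (tdeg dg u * deg_after dg x t) *: << plug x t u >> :> lin k X.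
Proof. by rewrite /graft linextU1 linextU1 scale_mono. Qed.

Lemma graft_linear_l x (g : lin k X) : linear (fun f => graft dg x f g).
Proof. move=> a f f'; exact: linext_is_linear. Qed.

Lemma graft_linear_r x (f : lin k X) : linear (graft dg x f).
Proof.
move=> a g g'; rewrite /graft /linext scaler_sumr -big_split.
apply: eq_bigr => t _ /=.
by rewrite -!/(linext _ _) linearP scalerDr !scalerA mulrC.
Qed.

End Graft.

Lemma relabelU h (t : tree X) : relabel h << t >> = << trelabel h t >> :> lin k X.
Proof. exact: linextU1. Qed.

Lemma tbindA (h h' : nat -> tree X) t :
  tbind h (tbind h' t) = tbind (fun a => tbind h (h' a)) t.
Proof.
elim/tree_induction: t => //= g ts IH; congr Node; rewrite -map_comp.
by apply/eq_in_map => t /IH.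
Qed.

Lemma eq_tbind (h h' : nat -> tree X) t :
  {in leaves t, h =1 h'} -> tbind h t = tbind h' t.
Proof.
elim/tree_induction: t => /= [a|g ts IH] H; first by apply: H; rewrite inE.
congr Node; apply/eq_in_map => t tts; apply: IH => // a at_; apply: H.
by apply/flattenP; exists (leaves t) => //; apply: map_f.
Qed.

Lemma tbind_id t : @tbind X Leaf t = t.
Proof.
elim/tree_induction: t => //= g ts IH; congr Node.
by rewrite -[RHS]map_id; apply/eq_in_map => t /IH.
Qed.

Lemma leaves_tbind (h : nat -> tree X) t :
  leaves (tbind h t) = flatten [seq leaves (h a) | a <- leaves t].
Proof.
elim/tree_induction: t => /= [a|g ts IH]; first by rewrite cats0.
rewrite -map_comp; elim: ts IH => //= u ts IHts IH.
rewrite map_cat flatten_cat IH ?mem_head // IHts // => t tts.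
by apply: IH; rewrite in_cons tts orbT.
Qed.

Lemma leaves_trelabel h (t : tree X) : leaves (trelabel h t) = map h (leaves t).
Proof.
by rewrite leaves_tbind; elim: (leaves t) => //= a s ->.
Qed.

Lemma trelabel_comp h h' (t : tree X) :
  trelabel h (trelabel h' t) = trelabel (h \o h') t.
Proof. by rewrite /trelabel tbindA. Qed.

Lemma eq_trelabel h h' (t : tree X) :
  {in leaves t, h =1 h'} -> trelabel h t = trelabel h' t.
Proof. by move=> H; apply: eq_tbind => a /H ->. Qed.

Lemma trelabel_id (t : tree X) h : {in leaves t, h =1 id} -> trelabel h t = t.
Proof. by move=> H; rewrite -[RHS]tbind_id; apply: eq_tbind => a /H /= ->. Qed.

End LinearExtension.

HB.instance Definition _ (k : fieldType) (X : Type) (h : nat -> nat) :=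
  GRing.isLinear.Build k (lin k X) (lin k X) *:%R (relabel h)
    (linext_is_linear _).

HB.instance Definition _ (k : fieldType) (X : Type) dg x f :=
  GRing.isLinear.Build k (lin k X) (lin k X) *:%R (graft dg x f)
    (graft_linear_r dg x f).

(** * Signs *)

Section Signs.
Variable R : unitRingType.

Lemma expN1z (z : int) : (-1 : R) ^ z = (-1) ^+ `|z|%N.
Proof. by case: z => n; rewrite ?NegzE // -exprnN -exprVn invrN1 abszN. Qed.

Lemma sign_eq (m n : nat) : odd m = odd n -> (-1 : R) ^+ m = (-1) ^+ n.
Proof. by move=> e; rewrite -(signr_odd R m) e signr_odd. Qed.

Lemma signMsign (n : nat) : (-1 : R) ^+ n * (-1) ^+ n = 1.
Proof. by rewrite -exprD addnn -mul2n exprM sqrrN !expr1n. Qed.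

End Signs.

(** Sums over the pairs of positions. Inversions are the case of the summand
    b < a; a symmetric summand makes the sum independent of the order. *)
Fixpoint pairsum (D : nat -> nat -> nat) (s : seq nat) : nat :=
  if s is a :: s' then (\sum_(b <- s') D a b + pairsum D s')%N else 0%N.

Lemma pairsum_cat D s s' : pairsum D (s ++ s') =
  (pairsum D s + pairsum D s' + \sum_(a <- s) \sum_(b <- s') D a b)%N.
Proof.
elim: s => [|a s IH] /=; first by rewrite big_nil addn0.
by rewrite big_cat big_cons IH /=; lia.
Qed.

Lemma pairsum_perm D s s' : {in s &, forall a b, D a b = D b a} ->
  perm_eq s s' -> pairsum D s = pairsum D s'.
Proof.
elim: s s' => [|a s IH] s' sym; first by rewrite perm_sym => /perm_nilP->.
move=> pss'; have a_s' : a \in s' by rewrite -(perm_mem pss') mem_head.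
case/splitPr: a_s' pss' => s1 s2; rewrite perm_sym -cat1s perm_catCA /= => pss'.
have pss : perm_eq s (s1 ++ s2) by rewrite -(perm_cons a) perm_sym.
rewrite (IH (s1 ++ s2)) //; last by move=> b c bs cs; apply: sym; rewrite in_cons ?bs ?cs orbT.
rewrite (perm_big _ pss) big_cat !pairsum_cat /=.
have -> : (\sum_(i <- s1) D a i = \sum_(i <- s1) \sum_(j <- [:: a]) D i j)%N.
  rewrite [LHS]big_seq [RHS]big_seq; apply: eq_bigr => b bs1.
  rewrite big_seq1; apply: sym; rewrite ?mem_head // in_cons (perm_mem pss) mem_cat bs1 orbT //.
have -> : (\sum_(b <- s1) \sum_(c <- a :: s2) D b c =
   \sum_(b <- s1) \sum_(c <- [:: a]) D b c + \sum_(b <- s1) \sum_(c <- s2) D b c)%N.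
  by rewrite -big_split; apply: eq_bigr => b _; rewrite big_cons big_seq1.
set A := (\sum_(i <- s1) \sum_(j <- [:: a]) D i j)%N.
set B := (\sum_(i <- s2) D a i)%N.
set C := (\sum_(i <- s1) \sum_(j <- s2) D i j)%N.
lia.
Qed.

Lemma inversionsE s : inversions s = pairsum (fun a b => (b < a)%N) s.
Proof. by elim: s => //= a s ->; rewrite -sum1_count big_mkcond. Qed.

Lemma odd_pairsum D D' s :
  odd (pairsum D s) (+) odd (pairsum D' s) =
  odd (pairsum (fun a b => odd (D a b) (+) odd (D' a b)) s).
Proof.
elim: s => //= a s IH; rewrite !oddD -IH.
have -> : odd (\sum_(b <- s) (odd (D a b) (+) odd (D' a b)))%N =
  odd (\sum_(b <- s) D a b)%N (+) odd (\sum_(b <- s) D' a b)%N.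
  elim: s {IH} => [|b s IHs]; first by rewrite !big_nil.
  by rewrite !big_cons !oddD IHs oddb addbACA.
by rewrite addbACA.
Qed.

Lemma pairsum_map D f s :
  pairsum D (map f s) = pairsum (fun a b => D (f a) (f b)) s.
Proof. by elim: s => //= a s ->; rewrite big_map. Qed.

(** The sign by which an injective relabelling changes the number of
    inversions depends only on the underlying set: it counts the unordered
    pairs whose order is reversed. *)
Lemma odd_inversions_map f s s' : perm_eq s s' -> {in s &, injective f} ->
  odd (inversions (map f s)) (+) odd (inversions s) =
  odd (inversions (map f s')) (+) odd (inversions s').
Proof.
move=> pss' injf; rewrite !inversionsE !pairsum_map !odd_pairsum.
congr odd; apply: pairsum_perm => // a b as_ bs.
rewrite !oddb; case: (ltngtP a b) => [ab|ab|->//].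
  have : f a <> f b by move/(injf _ _ as_ bs); lia.
  by case: (ltngtP (f a) (f b)).
have : f a <> f b by move/(injf _ _ as_ bs); lia.
by case: (ltngtP (f a) (f b)).
Qed.

Lemma inversions_mono f s : {in s &, {mono f : a b / (a < b)%N}} ->
  inversions (map f s) = inversions s.
Proof.
elim: s => //= a s IH mf; rewrite IH; last first.
  by move=> b c bs cs; apply: mf; rewrite in_cons ?bs ?cs orbT.
congr (_ + _)%N; rewrite count_map; apply: eq_in_count => b bs /=.
by apply: mf; rewrite in_cons ?bs ?eqxx ?orbT.
Qed.

Lemma inversions_sorted s : sorted ltn s -> inversions s = 0%N.
Proof.
elim: s => //= a s IH pas; rewrite IH ?(path_sorted pas) // addn0.
apply/eqP; rewrite -leqn0 leqNgt -has_count; apply/hasP => -[b bs] /=.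
by have /allP/(_ b bs) /= := order_path_min ltn_trans pas; lia.
Qed.

Lemma inversions_cat s s' : inversions (s ++ s') =
  (inversions s + inversions s' + \sum_(a <- s) count (fun b => (b < a)%N) s')%N.
Proof.
rewrite !inversionsE pairsum_cat; congr (_ + _)%N; apply: eq_bigr => a _.
by rewrite -sum1_count [RHS]big_mkcond.
Qed.

(** * The ideal of a presented operad *)

Section Presented.
Variables (k : fieldType) (P : presentation k).
Local Notation T := (tree (gen P)).
Local Notation lin := (lin k (gen P)).
Local Notation dg := (@gdeg k P).

Lemma in_free0 S : in_free S (0 : lin).
Proof. by move=> t; rewrite msupp0 in_fset0. Qed.

Lemma in_freeU S (t : T) : monomial S t -> in_free S (<< t >> : lin).
Proof. by move=> mt u /(fsubsetP (@msuppU_le _ _ _ _)); rewrite in_fset1 => /eqP->. Qed.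

Lemma in_freeD S (f g : lin) : in_free S f -> in_free S g -> in_free S (f + g).
Proof.
move=> Sf Sg t /(fsubsetP (msuppD_le f g)).
by rewrite in_fsetU => /orP[/Sf|/Sg].
Qed.

Lemma in_freeZ S a (f : lin) : in_free S f -> in_free S (a *: f).
Proof. by move=> Sf t /(fsubsetP (msuppZ_le a f)) /Sf. Qed.

Lemma in_free_sum S I (r : seq I) (Q : pred I) (F : I -> lin) :
  (forall i, Q i -> in_free S (F i)) -> in_free S (\sum_(i <- r | Q i) F i).
Proof.
move=> SF; elim/big_rec: _ => [|i f Qi Sf]; first exact: in_free0.
by apply: in_freeD => //; apply: SF.
Qed.

Lemma in_free_sum_seq S (I : eqType) (r : seq I) (F : I -> lin) :
  (forall i, i \in r -> in_free S (F i)) -> in_free S (\sum_(i <- r) F i).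
Proof. by move=> SF; rewrite big_seq; apply: in_free_sum. Qed.

Lemma wf_tbind h t : wf t -> (forall a, a \in leaves t -> wf (h a)) ->
  wf (tbind h t : T).
Proof.
elim/tree_induction: t => /= [a _ H|g ts IH /andP[szts /allP wts] H].
  by apply: H; rewrite inE.
rewrite size_map szts /=; apply/allP => u /mapP[t tts ->]; apply: IH => //.
  exact: wts.
by move=> a at_; apply: H; apply/flattenP; exists (leaves t) => //; apply: map_f.
Qed.

Lemma leaves_plug x (t u : T) l1 l2 : leaves t = l1 ++ x :: l2 ->
  x \notin l1 ++ l2 -> leaves (plug x t u) = l1 ++ leaves u ++ l2.
Proof.
move=> lt; rewrite mem_cat negb_or => /andP[xl1 xl2].
have id_ l : x \notin l ->
    flatten [seq leaves (if a == x then u else Leaf a) | a <- l] = l.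
  elim: l => //= a l IH; rewrite in_cons negb_or eq_sym => /andP[/negPf-> /IH->].
  by [].
by rewrite leaves_tbind lt map_cat flatten_cat /= eqxx !id_.
Qed.

Lemma monomial_leaves S (t : T) : monomial S t -> perm_eq (leaves t) S.
Proof. by case/and3P. Qed.

Lemma monomial_wf S (t : T) : monomial S t -> wf t.
Proof. by case/and3P. Qed.

Lemma monomial_split x S (t : T) : uniq (x :: S) -> monomial (x :: S) t ->
  exists l1 l2, [/\ leaves t = l1 ++ x :: l2, x \notin l1 ++ l2 &
    perm_eq (l1 ++ l2) S].
Proof.
move=> uxS /monomial_leaves lt.
have xt : x \in leaves t by rewrite (perm_mem lt) mem_head.
case/splitPr: xt lt => l1 l2 lt.
have plS : perm_eq (l1 ++ l2) S.
  by rewrite -(perm_cons x) -(permPr lt) perm_sym -cat1s perm_catCA.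
exists l1, l2; split=> //; rewrite (perm_mem plS).
by case/andP: uxS.
Qed.

Lemma monomial_perm S S' (t : T) : perm_eq S S' -> monomial S t = monomial S' t.
Proof. by move=> SS'; rewrite /monomial (permPr SS'). Qed.

Lemma monomial_plug x S S' (t u : T) : uniq (x :: S) ->
  monomial (x :: S) t -> monomial S' u -> monomial (S ++ S') (plug x t u).
Proof.
move=> uxS mt mu; have [l1 [l2 [lt xl plS]]] := monomial_split uxS mt.
apply/and3P; split.
- by case: t mt {lt} => //= a /and3P[].
- apply: wf_tbind => [|a _]; first exact: monomial_wf mt.
  by case: ifP => // _; exact: monomial_wf mu.
- rewrite (leaves_plug _ lt xl) perm_sym.
  apply: (perm_trans (y := (l1 ++ l2) ++ leaves u)).
    by apply: perm_cat; rewrite perm_sym //; exact: monomial_leaves.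
  by rewrite -catA perm_cat2l perm_catC.
Qed.

Lemma monomial_relabel S h (t : T) : monomial S t ->
  monomial (map h S) (trelabel h t).
Proof.
case/and3P=> nt wt lt; apply/and3P; split; first by case: t nt {wt lt}.
  by apply: wf_tbind.
by rewrite leaves_trelabel perm_map.
Qed.

Lemma in_free_relabel S h (f : lin) : in_free S f ->
  in_free (map h S) (relabel h f).
Proof.
move=> Sf; rewrite {1}[f]lin_expand linear_sum; apply: in_free_sum_seq => t tf.
rewrite linearZ /= relabelU; apply: in_freeZ; apply: in_freeU.
by apply: monomial_relabel; apply: Sf.
Qed.

Lemma in_free_graft x S S' (f g : lin) : uniq (x :: S) ->
  in_free (x :: S) f -> in_free S' g -> in_free (S ++ S') (graft dg x f g).
Proof.
move=> uxS Sf Sg; rewrite graftE.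
apply: in_free_sum_seq => t tf; apply: in_free_sum_seq => u ug.
by apply/in_freeZ/in_freeU/monomial_plug => //; [apply: Sf | apply: Sg].
Qed.

Lemma ideal_in_free S (f : lin) : ideal S f -> in_free S f.
Proof.
elim=> {S f} [n r _ //|S|S a f g _ IHf _ IHg|S S' f SS' _ IH|S h f _ _ IH||].
- exact: in_free0.
- by apply: in_freeD => //; apply: in_freeZ.
- by move=> t /IH; rewrite (monomial_perm _ SS').
- exact: in_free_relabel.
- by move=> x S S' f g uxS uSS' _ IH Sg; apply: in_free_graft.
- by move=> x S S' f g uxS uSS' Sf _ IH; apply: in_free_graft.
Qed.

Lemma idealZ S a (f : lin) : ideal S f -> ideal S (a *: f).
Proof. by move=> Sf; rewrite -[_ *: _]addr0; apply: ideal_lin => //; apply: ideal_0. Qed.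

Lemma idealD S (f g : lin) : ideal S f -> ideal S g -> ideal S (f + g).
Proof. by move=> Sf Sg; rewrite -[f]scale1r; apply: ideal_lin. Qed.

Lemma idealN S (f : lin) : ideal S f -> ideal S (- f).
Proof. by move=> Sf; rewrite -scaleN1r; apply: idealZ. Qed.

Lemma idealB S (f g : lin) : ideal S f -> ideal S g -> ideal S (f - g).
Proof. by move=> Sf Sg; apply: idealD => //; apply: idealN. Qed.

Lemma ideal_sum S I (r : seq I) (Q : pred I) (F : I -> lin) :
  (forall i, Q i -> ideal S (F i)) -> ideal S (\sum_(i <- r | Q i) F i).
Proof.
move=> SF; elim/big_rec: _ => [|i f Qi Sf]; first exact: ideal_0.
by apply: idealD => //; apply: SF.
Qed.

Lemma eqop_refl S (f : lin) : eqop P S f f.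
Proof. by rewrite /eqop subrr; apply: ideal_0. Qed.

Lemma eqop_sym S (f g : lin) : eqop P S f g -> eqop P S g f.
Proof. by rewrite /eqop -opprB => /idealN; rewrite opprK. Qed.

Lemma eqop_trans S (g f h : lin) : eqop P S f g -> eqop P S g h -> eqop P S f h.
Proof. by move=> /idealD fg /fg; rewrite /eqop addrA subrK. Qed.

Lemma eqopZ S a (f g : lin) : eqop P S f g -> eqop P S (a *: f) (a *: g).
Proof. by move=> /(idealZ a); rewrite /eqop scalerBr. Qed.

Lemma eqopD S (f g f' g' : lin) : eqop P S f g -> eqop P S f' g' ->
  eqop P S (f + f') (g + g').
Proof. by move=> /idealD fg /fg; rewrite /eqop opprD addrACA. Qed.

Lemma eqop_sum S I (r : seq I) (Q : pred I) (F G : I -> lin) :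
  (forall i, Q i -> eqop P S (F i) (G i)) ->
  eqop P S (\sum_(i <- r | Q i) F i) (\sum_(i <- r | Q i) G i).
Proof. by move=> FG; rewrite /eqop -sumrB; apply: ideal_sum. Qed.

Lemma eqop_sum_seq S (I : eqType) (r : seq I) (F G : I -> lin) :
  (forall i, i \in r -> eqop P S (F i) (G i)) ->
  eqop P S (\sum_(i <- r) F i) (\sum_(i <- r) G i).
Proof. by move=> FG; rewrite big_seq [X in eqop _ _ _ X]big_seq; apply: eqop_sum. Qed.

Lemma eqop_perm S S' (f g : lin) : perm_eq S S' -> eqop P S f g -> eqop P S' f g.
Proof. exact: ideal_perm. Qed.

Lemma eqop_relabel S h (f g : lin) : uniq (map h S) -> eqop P S f g ->
  eqop P (map h S) (relabel h f) (relabel h g).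
Proof. by rewrite /eqop => uS /(ideal_relabel uS); rewrite linearB. Qed.

End Presented.

Arguments in_freeU {k P S t}.

(** * Planar words *)

Notation gtree := (tree gerst_gen).

Definition ddeg (g : gerst_gen) : int := - gerst_deg g.

(** What becomes of planar words under the operations of the dual operad: a
    product concatenates two nonempty words, while a bracket attaches a tree
    without planar labels to another tree. The value None marks the trees on
    which the functionals below vanish. *)
Definition join (g : gerst_gen) (v w : seq nat) : option (seq nat) :=
  match g with
  | inl b => if nilp v || nilp w then None else Some (if b then w ++ v else v ++ w)
  | inr _ => if nilp v || nilp w then Some (v ++ w) else None
  end.

(** The labels in A are the planar ones; the others are space labels. *)
Fixpoint planar_word (A : pred nat) (t : gtree) : option (seq nat) :=
  match t with
  | Leaf x => Some (if A x then [:: x] else [::])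
  | Node g [:: t1; t2] =>
      if planar_word A t1 is Some v then if planar_word A t2 is Some w then join g v w else None
      else None
  | _ => None
  end.

(** The opposite product is minus the product with exchanged arguments. A
    bracket is antisymmetric in the dual operad, and is normalised by having
    the tree without planar labels on the left. *)
Definition local_sign (g : gerst_gen) (v : option (seq nat)) : nat :=
  match g with inl b => b | inr _ => v != Some [::] end.

Fixpoint local_signs (A : pred nat) (t : gtree) : nat :=
  match t with
  | Node g [:: t1; t2] => (local_sign g (planar_word A t1) + local_signs A t1 + local_signs A t2)%N
  | _ => 0%N
  end.

(** Brackets have degree one in the dual operad, and space labels are odd
    because the corresponding inputs of the dual are antisymmetric. The odd
    letters of a tree are spelt 0 for a bracket and x + 1 for the space label x;
    products and planar labels are even and are not spelt. *)
Definition letter (A : pred nat) (e : nat + int) : seq nat :=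
  match e with
  | inl x => if A x then [::] else [:: x.+1]
  | inr d => if d == 0 then [::] else [:: 0%N]
  end.

Definition spell A (w : seq (nat + int)) := flatten (map (letter A) w).

Definition spelling (A : pred nat) (t : gtree) : seq nat := spell A (pword ddeg t).

Definition num_zeros (w : seq nat) := count (pred1 0%N) w.
Definition num_pos (w : seq nat) := count (fun v => 0 < v)%N w.

Lemma gtree_ind (P : gtree -> Prop) :
  (forall a, P (Leaf a)) ->
  (forall g t1 t2, P t1 -> P t2 -> P (Node g [:: t1; t2])) ->
  (forall g ts, size ts != 2 -> P (Node g ts)) ->
  forall t, P t.
Proof.
move=> HL H2 HN; elim/tree_induction => // g [|t1 [|t2 [|t3 ts]]] IH;
  try exact: HN.
by apply: H2; apply: IH; rewrite !inE eqxx ?orbT.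
Qed.

Lemma eq_planar_word A B t : {in leaves t, A =1 B} -> planar_word A t = planar_word B t.
Proof.
elim/gtree_ind: t => [a|g t1 t2 IH1 IH2|g ts] /= H.
- by rewrite H ?inE.
- by rewrite IH1 ?IH2 // => a ai; apply: H; rewrite !mem_cat ai ?orbT.
- by case: ts H => [|t1 [|t2 [|]]].
Qed.

Lemma eq_local_signs A B t : {in leaves t, A =1 B} -> local_signs A t = local_signs B t.
Proof.
elim/gtree_ind: t => [a|g t1 t2 IH1 IH2|g ts] //= H.
- rewrite (@eq_planar_word A B) ?IH1 ?IH2 // => a ai; apply: H; rewrite !mem_cat ai ?orbT //.
- by case: ts H => [|t1 [|t2 [|]]].
Qed.

Definition lbls (w : seq (nat + int)) : seq nat :=
  pmap (fun e => if e is inl x then Some x else None) w.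

Lemma lbls_cat w w' : lbls (w ++ w') = lbls w ++ lbls w'.
Proof. exact: pmap_cat. Qed.

Lemma lbls_pword t : lbls (pword ddeg t) = leaves t.
Proof.
elim/tree_induction: t => //= g ts IH; elim: ts IH => //= u ts IHts IH.
rewrite lbls_cat IH ?mem_head // IHts // => t tts.
by apply: IH; rewrite in_cons tts orbT.
Qed.

Lemma spell_cat A w w' : spell A (w ++ w') = spell A w ++ spell A w'.
Proof. by rewrite /spell map_cat flatten_cat. Qed.

Lemma eq_spell A B w : {in lbls w, A =1 B} -> spell A w = spell B w.
Proof.
elim: w => //= -[x|d] w IH H; rewrite /spell /= -!/(spell _ _).
  rewrite IH ?H ?inE ?eqxx // => a ai; apply: H; by rewrite in_cons ai orbT.
by rewrite IH.
Qed.

Lemma eq_spelling A B t : {in leaves t, A =1 B} -> spelling A t = spelling B t.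
Proof. by move=> H; apply: eq_spell; rewrite lbls_pword. Qed.

Lemma num_zeros_cat w w' : num_zeros (w ++ w') = (num_zeros w + num_zeros w')%N.
Proof. exact: count_cat. Qed.

Lemma num_pos_cat w w' : num_pos (w ++ w') = (num_pos w + num_pos w')%N.
Proof. exact: count_cat. Qed.

Lemma positive_spell A w :
  [seq v <- spell A w | (0 < v)%N] = [seq x.+1 | x <- lbls w & ~~ A x].
Proof.
elim: w => //= -[x|d] w IH; rewrite /spell /= -/(spell A w) filter_cat IH.
  by case: (A x).
by case: eqP.
Qed.

Lemma num_zeros_spell A t : (num_zeros (spelling A t))%:Z = tdeg ddeg t.
Proof.
rewrite /spelling /tdeg /wdeg; have : all (fun e => if e is inr d then (d == 0) || (d == 1) else true) (pword ddeg t).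
  elim/tree_induction: t => //= g ts IH; apply/andP; split; first by case: g {IH}.
  elim: ts IH => //= u ts IHts IH; rewrite all_cat IH ?mem_head // IHts // => t tts.
  by apply: IH; rewrite in_cons tts orbT.
elim: (pword ddeg t) => [|e w IH] /=; first by rewrite big_nil.
case/andP=> de /IH {}IH; rewrite /spell /= -/(spell A w) num_zeros_cat big_cons -IH.
by case: e de => [x|d] /=; [case: (A x) | case/orP => /eqP->].
Qed.

Lemma wdeg_num_zeros A w1 w2 t : pword ddeg t = w1 ++ w2 ->
  wdeg w2 = (num_zeros (spell A w2))%:Z.
Proof.
rewrite /wdeg => tw.
have : all (fun e => if e is inr d then (d == 0) || (d == 1) else true) (pword ddeg t).
  elim/tree_induction: t {tw} => //= g ts IH; apply/andP; split; first by case: g {IH}.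
  elim: ts IH => //= u ts IHts IH; rewrite all_cat IH ?mem_head // IHts // => t tts.
  by apply: IH; rewrite in_cons tts orbT.
rewrite tw all_cat => /andP[_]; elim: w2 {tw} => [|e w IH] /=; first by rewrite big_nil.
case/andP=> de /IH {}IH; rewrite /spell /= -/(spell A w) num_zeros_cat big_cons IH.
by case: e de => [x|d] /=; [case: (A x) | case/orP => /eqP->].
Qed.

Lemma spelling_node2 A g t1 t2 : spelling A (Node g [:: t1; t2]) =
  letter A (inr (ddeg g)) ++ spelling A t1 ++ spelling A t2.
Proof. by rewrite /spelling /= cats0 /spell /= -/(spell _ _) -spell_cat. Qed.

(** Every bracket absorbs one space label; a tree without planar labels keeps
    one label over. *)
Lemma planar_word_count A t w : planar_word A t = Some w ->
  (num_zeros (spelling A t) + nilp w)%N = num_pos (spelling A t).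
Proof.
elim/gtree_ind: t w => [a|g t1 t2 IH1 IH2|g ts nts] w; last by case: ts nts => [|t1 [|t2 [|]]].
- by move=> /= [<-]; rewrite /spelling /spell /=; case: (A a).
- rewrite spelling_node2 !num_zeros_cat !num_pos_cat /=.
  case E1: (planar_word A t1) => [v1|//]; case E2: (planar_word A t2) => [v2|//].
  have := IH1 _ E1; have := IH2 _ E2; case: g => [b|u] /=.
    case: v1 {E1} => //= a v1; case: v2 {E2} => //= c v2 + + [<-].
    by case: b => /=; lia.
  case: v1 {E1} => [|a v1]; case: v2 {E2} => [|c v2] //= + + [<-] /=; lia.
Qed.

Lemma planar_word_perm A t w : planar_word A t = Some w -> perm_eq w [seq x <- leaves t | A x].
Proof.
elim/gtree_ind: t w => [a|g t1 t2 IH1 IH2|g ts nts] w /=; last by case: ts nts => [|t1 [|t2 [|]]].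
- by move=> [<-]; case: (A a).
- case E1: (planar_word A t1) => [v1|//]; case E2: (planar_word A t2) => [v2|//].
  rewrite cats0 filter_cat => jw.
  have p12 : perm_eq (v1 ++ v2) ([seq x <- leaves t1 | A x] ++ [seq x <- leaves t2 | A x]).
    by apply: perm_cat; [apply: IH1 | apply: IH2].
  move: jw; case: g => [b|u] /=; case: ifP => // _ [<-] //.
  by case: b => //; rewrite perm_catC.
Qed.

Lemma flatten_nilp (f : nat -> seq nat) w :
  all (fun y => ~~ nilp (f y)) w -> nilp (flatten (map f w)) = nilp w.
Proof. by case: w => //= a w /andP[fa _]; case: (f a) fa. Qed.

Lemma planar_word_all A t w : planar_word A t = Some w -> all A w.
Proof. by move/planar_word_perm/perm_all->; apply: filter_all. Qed.

(** The reason why the functionals respect compositions: substituting trees for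
    the leaves substitutes their planar words, a leaf being planar as soon as
    its tree has a planar label. *)
Lemma planar_word_tbind A h (f : nat -> seq nat) t :
  (forall y, y \in leaves t -> planar_word A (h y) = Some (f y)) ->
  planar_word A (tbind h t) =
    omap (fun w => flatten (map f w)) (planar_word (fun y => ~~ nilp (f y)) t).
Proof.
elim/gtree_ind: t => [a|g t1 t2 IH1 IH2|g ts] /= H.
- by rewrite H ?inE //=; case E: (f a) => [|b v] //=; rewrite E cats0.
- rewrite IH1 ?IH2; first last.
  + by move=> y yt; apply: H; rewrite !mem_cat yt ?orbT.
  + by move=> y yt; apply: H; rewrite !mem_cat yt ?orbT.
  case E1: (planar_word _ t1) => [v1|//=]; case E2: (planar_word _ t2) => [v2|//=] /=.
  have /flatten_nilp n1 := planar_word_all E1; have /flatten_nilp n2 := planar_word_all E2.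
  rewrite /join; case: g => [b|u]; rewrite n1 n2; case: ifP => // _ /=;
    by [case: b; rewrite map_cat flatten_cat | rewrite map_cat flatten_cat].
- by case: ts H => [|t1 [|t2 [|]]].
Qed.

Lemma planar_word_tbind_none A h t x : x \in leaves t -> planar_word A (h x) = None ->
  planar_word A (tbind h t) = None.
Proof.
move=> xt hx; elim/gtree_ind: t xt => [a|g t1 t2 IH1 IH2|g ts] /=.
- by rewrite inE => /eqP <-.
- rewrite cats0 mem_cat => /orP[/IH1->//|/IH2->]; by case: (planar_word _ _).
- by case: ts => [|t1 [|t2 [|]]].
Qed.

Lemma local_signs_tbind A h (f : nat -> seq nat) t :
  (forall y, y \in leaves t -> planar_word A (h y) = Some (f y)) ->
  planar_word (fun y => ~~ nilp (f y)) t != None ->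
  local_signs A (tbind h t) =
    (local_signs (fun y => ~~ nilp (f y)) t + \sum_(y <- leaves t) local_signs A (h y))%N.
Proof.
elim/gtree_ind: t => [a|g t1 t2 IH1 IH2|g ts] /= H.
- by rewrite big_seq1.
- have H1 y : y \in leaves t1 -> planar_word A (h y) = Some (f y).
    by move=> yt; apply: H; rewrite !mem_cat yt.
  have H2 y : y \in leaves t2 -> planar_word A (h y) = Some (f y).
    by move=> yt; apply: H; rewrite !mem_cat yt ?orbT.
  rewrite (planar_word_tbind H1) cats0 big_cat /=.
  case E1: (planar_word _ t1) => [v1|//=]; case E2: (planar_word _ t2) => [v2|//=] /= _.
  rewrite IH1 ?IH2 ?E1 ?E2 //.
  have /flatten_nilp n1 := planar_word_all E1.
  have -> : local_sign g (Some (flatten [seq f i | i <- v1])) = local_sign g (Some v1).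
    case: g => //= _; congr (nat_of_bool (~~ _)); move: n1.
    by case: v1 {E1} => //= a v1; case: (_ ++ _).
  move: (\sum_(y <- leaves t1) _)%N (\sum_(y <- leaves t2) _)%N (local_sign _ _) => s1 s2 ls; lia.
- by case: ts H => [|t1 [|t2 [|]]].
Qed.

(** Reduces a parity to a linear identity, the even difference being given. *)
Lemma odd_eq_double m n a b : (m + a.*2 = n + b.*2)%N -> odd m = odd n.
Proof. by move=> /(congr1 odd); rewrite !oddD !odd_double !addbF. Qed.

Definition pos (w : seq nat) := [seq v <- w | (0 < v)%N].

Definition pos_cross (w w' : seq nat) : nat :=
  \sum_(a <- pos w) count (fun b => (b < a)%N) (pos w').

Lemma pos_cross_catr w w1 w2 : pos_cross w (w1 ++ w2) = (pos_cross w w1 + pos_cross w w2)%N.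
Proof.
by rewrite -big_split; apply: eq_bigr => a _; rewrite /pos filter_cat count_cat.
Qed.

(** Inversions with brackets and inversions between space labels are separated,
    since the former depend on the numbers of letters only. *)
Lemma count_pairsE w w' : \sum_(a <- w) count (fun b => (b < a)%N) w' =
  (num_pos w * num_zeros w' + pos_cross w w')%N.
Proof.
rewrite /pos_cross /num_pos -sum1_count big_distrl /= big_filter.
rewrite [X in _ = (X + _)%N]big_mkcond [X in _ = (_ + X)%N]big_mkcond -big_split /=.
apply: eq_bigr => a _; case: ifP => a0; last first.
  by rewrite add0n; elim: w' => //= b w' ->; lia.
rewrite mul1n; elim: w' => //= b w' ->; rewrite /num_zeros /pos.
by case: b => [|b] /=; lia.
Qed.

Lemma pos_cross_sym w w' : (forall v, (0 < v)%N -> v \in w -> v \notin w') ->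
  (pos_cross w w' + pos_cross w' w)%N = (num_pos w * num_pos w')%N.
Proof.
move=> dis; rewrite /pos_cross.
have -> : (\sum_(a <- pos w') count (fun b => (b < a)%N) (pos w) =
   \sum_(b <- pos w) count (fun a => (b < a)%N) (pos w'))%N.
  under eq_bigr do rewrite -sum1_count big_mkcond.
  by rewrite exchange_big; apply: eq_bigr => b _; rewrite -sum1_count [RHS]big_mkcond.
have ps v : num_pos v = size (pos v) by rewrite size_filter.
rewrite -big_split /= !ps {ps}.
have dis' : forall v, v \in pos w -> v \notin pos w'.
  move=> v; rewrite !mem_filter => /andP[v0 vw]; rewrite v0 /=; exact: dis.
elim: (pos w) dis' => [|a s IH] dis'; first by rewrite big_nil.
rewrite big_cons IH => [|v vs]; last by apply: dis'; rewrite in_cons vs orbT.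
rewrite mulSn; congr (_ + _)%N; have := dis' a (mem_head _ _).
elim: (pos w') => //= b s' IHs; rewrite in_cons negb_or => /andP[ab /IHs].
by move: ab; case: (ltngtP a b) => //= ab _; lia.
Qed.

(** A block with as many brackets as space labels is an even element. So its
    crossings with w1 may be traded for crossings in the other direction, which
    count it against all of w1 ++ w2, and only the Koszul term of its brackets
    with those of w2 remains. *)
Lemma odd_inversions_insert w1 wu w2 : num_zeros wu = num_pos wu ->
  (forall v, (0 < v)%N -> v \in w1 -> v \notin wu) ->
  odd (inversions (w1 ++ wu ++ w2)) =
  odd (inversions (w1 ++ w2) + inversions wu + num_zeros wu * num_zeros w2 +
       pos_cross wu (w1 ++ w2)).
Proof.
move=> bal dis; have := pos_cross_sym dis.
rewrite !inversions_cat !count_pairsE pos_cross_catr pos_cross_catr num_zeros_cat.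
move=> E; rewrite -bal in E *.
apply: (@odd_eq_double _ _ (pos_cross wu w1) (num_pos w1 * num_zeros wu)); nia.
Qed.

(** The same for a block with one space label in excess, which is odd and takes
    the place of the odd letter z. *)
Lemma odd_inversions_replace w1 z wu w2 : (num_zeros wu).+1 = num_pos wu -> (0 < z)%N ->
  z \notin w1 -> (forall v, (0 < v)%N -> v \in w1 -> v \notin wu) ->
  odd (inversions (w1 ++ wu ++ w2)) =
  odd (inversions (w1 ++ z :: w2) + inversions wu + num_zeros wu * num_zeros w2 +
       pos_cross wu (w1 ++ w2) + pos_cross [:: z] (w1 ++ w2)).
Proof.
move=> bal z0 zw dis; have := pos_cross_sym dis.
have : (pos_cross w1 [:: z] + pos_cross [:: z] w1)%N = num_pos w1.
  rewrite pos_cross_sym /= ?z0 ?muln1 // => v _ vw; rewrite inE.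
  by apply: contraNneq zw => <-.
rewrite -(cat1s z w2) !inversions_cat !count_pairsE !pos_cross_catr !num_zeros_cat /=.
have -> : (z == 0%N) = false by lia.
rewrite z0 => E1 E2; rewrite -bal in E2 *.
apply: (@odd_eq_double _ _ (pos_cross wu w1 + pos_cross [:: z] w2)
  (num_pos w1 * num_zeros wu)); nia.
Qed.

(** * The signed functionals *)

Section Functionals.
Variable k : fieldType.

(** The functional of a word a of planar labels. It is dual to the normal tree of
    a, and its sign is the one of sorting the odd letters of t. *)
Definition chi (a : seq nat) (t : gtree) : k :=
  if planar_word (mem a) t == Some a
  then (-1) ^+ (inversions (spelling (mem a) t) + local_signs (mem a) t) else 0.

Lemma chiE a t : chi a t = if planar_word (mem a) t == Some a
  then (-1) ^+ (inversions (spelling (mem a) t) + local_signs (mem a) t) else 0.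
Proof. by []. Qed.

(** The shuffle sign of (S', S) restricted to space labels: this is
    the part of the sign of a composite that compares labels of both factors. *)
Definition space_cross (a S' S : seq nat) : nat :=
  \sum_(v <- S' | v \notin a) count (fun s => (s < v)%N && (s \notin a)) S.

Lemma pos_spelling A t : pos (spelling A t) = [seq x.+1 | x <- leaves t & ~~ A x].
Proof. by rewrite /pos positive_spell lbls_pword. Qed.

Lemma pos_cross_space_cross (a l l' S S' wu w : seq nat) :
  pos wu = [seq x.+1 | x <- l' & x \notin a] ->
  pos w = [seq x.+1 | x <- l & x \notin a] ->
  perm_eq l S -> perm_eq l' S' ->
  pos_cross wu w = space_cross a S' S.
Proof.
move=> pu planar_word_ lS lS'; rewrite /pos_cross pu planar_word_ big_map big_filter.
rewrite (perm_big _ lS') /space_cross; apply: eq_bigr => v _.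
rewrite count_map count_filter -(permP lS); apply: eq_count => s /=.
by rewrite ltnS.
Qed.

Lemma pword_plug x t u p1 p2 : pword ddeg t = p1 ++ inl x :: p2 ->
  x \notin lbls p1 ++ lbls p2 ->
  pword ddeg (plug x t u) = p1 ++ pword ddeg u ++ p2.
Proof.
have gen : pword ddeg (plug x t u) = flatten [seq
    (if e is inl y then pword ddeg (if y == x then u else Leaf y) else [:: e]) |
    e <- pword ddeg t].
  elim/tree_induction: t => /= [a|g ts IH]; first by rewrite cats0.
  congr cons; elim: ts IH => //= t ts IHts IH.
  rewrite map_cat flatten_cat IH ?mem_head // IHts // => t' ts'.
  by apply: IH; rewrite in_cons ts' orbT.
rewrite {}gen => ->; rewrite mem_cat negb_or => /andP[x1 x2].
have id_ p : x \notin lbls p -> flatten [seq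
    (if e is inl y then pword ddeg (if y == x then u else Leaf y) else [:: e]) |
    e <- p] = p.
  elim: p => //= -[y|d] p IH /=; last by move/IH->.
  by rewrite in_cons negb_or eq_sym => /andP[/negPf-> /IH->].
by rewrite map_cat flatten_cat /= eqxx !id_.
Qed.

Lemma deg_after_split x t p1 p2 : pword ddeg t = p1 ++ inl x :: p2 ->
  x \notin lbls p1 -> deg_after ddeg x t = wdeg p2.
Proof.
move=> tp xp; rewrite /deg_after tp index_cat.
have -> : (inl x \in p1) = false.
  apply/negP => xin; move: xp; rewrite /lbls mem_pmap.
  by move/negP; apply; apply/mapP; exists (inl x).
by rewrite /= eqxx addn0 drop_size_cat // /wdeg big_cons add0r.
Qed.

Lemma pword_split x t : x \in leaves t -> uniq (leaves t) ->
  exists p1 p2, [/\ pword ddeg t = p1 ++ inl x :: p2,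
    x \notin lbls p1 ++ lbls p2 & leaves t = lbls p1 ++ x :: lbls p2].
Proof.
rewrite -lbls_pword => xt ut.
have {}xt : inl x \in pword ddeg t.
  by move: xt; rewrite mem_pmap => /mapP[[y|d] // yt [->]].
case/splitPr: xt ut => p1 p2; rewrite lbls_cat /= => ut.
exists p1, p2; split=> //; move: ut; rewrite cat_uniq /= negb_or.
by case/and3P=> _ /andP[x1 _] /andP[x2 _]; rewrite mem_cat negb_or x1.
Qed.

End Functionals.

Section PlugSigns.
Variable k : fieldType.
Local Notation chi := (@chi k).

Lemma app_mem (s : seq nat) y : mem s y = (y \in s).
Proof. by []. Qed.

Lemma mem_spell A w v : (0 < v)%N -> v \in spell A w -> v.-1 \in lbls w.
Proof.
move=> v0 vw; have : v \in [seq y <- spell A w | (0 < y)%N] by rewrite mem_filter v0.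
by rewrite positive_spell => /mapP[y]; rewrite mem_filter => /andP[_ yw] ->.
Qed.

Lemma spell_node A x : spell A [:: inl x] = if A x then [::] else [:: x.+1].
Proof. by rewrite /spell /= cats0. Qed.

(** The data on prefix words from which the sign of a composite is computed; the
    Koszul sign of the composition counts brackets. *)
Lemma plug_words x (S S' : seq nat) t u : uniq (x :: S) -> uniq (S ++ S') ->
  perm_eq (leaves t) (x :: S) -> perm_eq (leaves u) S' ->
  exists p1 p2,
    [/\ pword ddeg t = p1 ++ inl x :: p2,
        pword ddeg (plug x t u) = p1 ++ pword ddeg u ++ p2,
        (forall A, (-1) ^ (tdeg ddeg u * deg_after ddeg x t) =
           (-1) ^+ (num_zeros (spelling A u) * num_zeros (spell A p2)) :> k),
        perm_eq (lbls p1 ++ lbls p2) S &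
        forall A, (forall v, (0 < v)%N -> v \in spell A p1 -> v \notin spelling A u)].
Proof.
move=> uxS uSS' lt lu.
have ut : uniq (leaves t) by rewrite (perm_uniq lt).
have xt : x \in leaves t by rewrite (perm_mem lt) mem_head.
have [p1 [p2 [tp xp ltp]]] := pword_split xt ut.
have pS : perm_eq (lbls p1 ++ lbls p2) S.
  by rewrite -(perm_cons x) -(permPr lt) ltp perm_sym -cat1s perm_catCA.
exists p1, p2; split=> // [|A|A v v0 vp].
- exact: pword_plug.
- move: xp; rewrite mem_cat negb_or => /andP[xp _].
  rewrite (deg_after_split tp xp) -(num_zeros_spell A).
  have tp' : pword ddeg t = (p1 ++ [:: inl x]) ++ p2 by rewrite tp -catA.
  by rewrite (wdeg_num_zeros A tp') -PoszM -exprnP.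
- apply/negP => /(mem_spell v0); rewrite lbls_pword (perm_mem lu).
  have := mem_spell v0 vp => v1 v2.
  have vS : v.-1 \in S by rewrite -(perm_mem pS) mem_cat v1.
  by move: uSS'; rewrite cat_uniq => /and3P[_ /hasP[]]; exists v.-1.
Qed.

Lemma sum_local_signs_leaves A (x : nat) (s : seq nat) u : uniq s -> x \in s ->
  (\sum_(y <- s) local_signs A (if y == x then u else Leaf y) = local_signs A u)%N.
Proof.
move=> us xs; rewrite (bigD1_seq x) //= eqxx big1 ?addn0 // => y /negPf->.
by [].
Qed.

(** If all planar labels lie outside u, then u is made of brackets and acts on t
    as the single space label x; its own value is that of the empty word. *)
Lemma chi_plug_space (a : seq nat) x S S' t u : uniq (x :: S) -> uniq (S ++ S') ->
  perm_eq (leaves t) (x :: S) -> perm_eq (leaves u) S' -> {subset a <= S} ->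
  chi a (plug x t u) =
  (-1) ^+ (space_cross a S' S + count (fun s => (s < x)%N && (s \notin a)) S) *
  (-1) ^ (tdeg ddeg u * deg_after ddeg x t) * chi a t * chi [::] u.
Proof.
move=> uxS uSS' lt lu aS.
have xa : x \notin a by apply: contraL uxS => /aS /= ->.
have au : {in leaves u, mem a =1 mem [::]}.
  move=> y; rewrite (perm_mem lu) /= => yS'; apply/negP => /aS yS.
  by move: uSS'; rewrite cat_uniq => /and3P[_ /hasP[]]; exists y.
have xt : x \in leaves t by rewrite (perm_mem lt) mem_head.
have ut : uniq (leaves t) by rewrite (perm_uniq lt).
have [p1 [p2 [tp pp sg pS dis]]] := plug_words uxS uSS' lt lu.
rewrite /chi -(eq_planar_word au) -(eq_spelling au) -(eq_local_signs au).
case E: (planar_word (mem a) u) => [w|]; last first.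
  by rewrite (@planar_word_tbind_none _ _ _ x) ?eqxx //= mulr0.
have w0 : w = [::].
  have := planar_word_all E; have := planar_word_perm E; case: w {E} => // b w planar_word_ /andP[/= ba _].
  have : b \in b :: w by rewrite mem_head.
  by rewrite (perm_mem planar_word_) mem_filter => /andP[_ /au]; rewrite /= ba.
subst w; rewrite eqxx.
pose f y := if y == x then [::] else if y \in a then [:: y] else [::].
have Hf y : y \in leaves t -> planar_word (mem a) (if y == x then u else Leaf y) = Some (f y).
  by move=> _; rewrite /f; case: ifP.
have Af : {in leaves t, (fun y => ~~ nilp (f y)) =1 mem a}.
  by move=> y _; rewrite /f /=; case: eqP => [->|_]; [rewrite (negPf xa) | case: (y \in a)].
have pwE : planar_word (mem a) (plug x t u) = planar_word (mem a) t.
  rewrite (planar_word_tbind Hf) (eq_planar_word Af); case F: planar_word => [w|//] /=; congr Some.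
  have := planar_word_all F; elim: w {F} => //= y w IH /andP[ya /IH->].
  by rewrite /f ya; case: eqP ya => // ->; rewrite (negPf xa).
rewrite pwE; case: eqP => [F|_]; last by rewrite mulr0 mul0r.
have -> : local_signs (mem a) (plug x t u) = (local_signs (mem a) t + local_signs (mem a) u)%N.
  rewrite (local_signs_tbind Hf); last by rewrite (eq_planar_word Af) F.
  by rewrite (eq_local_signs Af) sum_local_signs_leaves.
rewrite (sg (mem a)) -!exprD; apply: sign_eq.
have bal : (num_zeros (spelling (mem a) u)).+1 = num_pos (spelling (mem a) u) by rewrite -(planar_word_count E) addn1.
have xp : x.+1 \notin spell (mem a) p1.
  apply/negP => /mem_spell => /(_ isT) /= xp1.
  have : x \in S by rewrite -(perm_mem pS) mem_cat xp1.
  by apply/negP; case/andP: uxS.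
have := @odd_inversions_replace _ x.+1 _ (spell (mem a) p2) bal isT xp (dis _).
have -> : spell (mem a) p1 ++ spelling (mem a) u ++ spell (mem a) p2 = spelling (mem a) (plug x t u).
  by rewrite /spelling pp !spell_cat.
have -> : spell (mem a) p1 ++ x.+1 :: spell (mem a) p2 = spelling (mem a) t.
  by rewrite /spelling tp -[inl x :: p2]cat1s !spell_cat spell_node /= (negPf xa).
have ps12 : pos (spell (mem a) p1 ++ spell (mem a) p2) =
    [seq y.+1 | y <- lbls p1 ++ lbls p2 & y \notin a].
  by rewrite -spell_cat /pos positive_spell lbls_cat.
have psu : pos (spelling (mem a) u) = [seq y.+1 | y <- leaves u & y \notin a].
  by rewrite pos_spelling.
rewrite (pos_cross_space_cross psu ps12 pS lu).
have -> : pos_cross [:: x.+1] (spell (mem a) p1 ++ spell (mem a) p2) =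
   count (fun s => (s < x)%N && (s \notin a)) S.
  rewrite /pos_cross big_seq1 ps12 count_map count_filter -(permP pS).
  by apply: eq_count.
by move=> E1; rewrite [LHS]oddD E1 -oddD; congr odd; lia.
Qed.

(** If the labels of u contain a nonempty factor b of the word, then u acts on t
    as the single planar label x. *)
Lemma chi_plug_planar (l r b : seq nat) x S S' t u : uniq (x :: S) -> uniq (S ++ S') ->
  perm_eq (leaves t) (x :: S) -> perm_eq (leaves u) S' ->
  {subset l <= S} -> {subset r <= S} -> {subset b <= S'} -> b != [::] ->
  chi (l ++ b ++ r) (plug x t u) =
  (-1) ^+ space_cross (l ++ b ++ r) S' S *
  (-1) ^ (tdeg ddeg u * deg_after ddeg x t) * chi (l ++ x :: r) t * chi b u.
Proof.
move=> uxS uSS' lt lu lS rS bS' b0; set a := l ++ b ++ r.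
have xS : x \notin S by case/andP: uxS.
have dSS' y : y \in S -> y \notin S'.
  move=> yS; apply/negP => yS'.
  by move: uSS'; rewrite cat_uniq => /and3P[_ /hasP[]]; exists y.
have au : {in leaves u, mem a =1 mem b}.
  move=> y; rewrite (perm_mem lu) /= => yS'; rewrite !mem_cat.
  case yl: (y \in l); first by have := dSS' _ (lS _ yl); rewrite yS'.
  case yr: (y \in r); first by have := dSS' _ (rS _ yr); rewrite yS'.
  by rewrite orbF.
have xt : x \in leaves t by rewrite (perm_mem lt) mem_head.
have ut : uniq (leaves t) by rewrite (perm_uniq lt).
have [p1 [p2 [tp pp sg pS dis]]] := plug_words uxS uSS' lt lu.
rewrite /chi -(eq_planar_word au) -(eq_spelling au) -(eq_local_signs au).
case E: (planar_word (mem a) u) => [w|]; last first.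
  by rewrite (@planar_word_tbind_none _ _ _ x) ?eqxx //= mulr0.
pose f y := if y == x then w else if y \in a then [:: y] else [::].
have Hf y : y \in leaves t -> planar_word (mem a) (if y == x then u else Leaf y) = Some (f y).
  by move=> _; rewrite /f; case: ifP.
have wS' : {subset w <= S'}.
  by move=> y; rewrite (perm_mem (planar_word_perm E)) mem_filter (perm_mem lu) => /andP[].
have st y : y \in leaves t -> y != x -> y \in S.
  by rewrite (perm_mem lt) inE => /orP[->|].
have aS y : y \in S -> (y \in a) = (y \in l ++ x :: r).
  move=> yS; rewrite !mem_cat inE; case: eqP yS => [->|_ yS]; first by rewrite (negPf xS).
  by have := dSS' _ yS; case yb: (y \in b); rewrite ?(bS' _ yb).
case: (altP (w =P [::])) => [w0|w0].
  (* the planar word of u is empty although b is not: both sides vanish *)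
  subst w; have -> : (Some [::] == Some b) = false.
    by apply/eqP => -[]; move/eqP: b0; case: (b).
  rewrite mulr0; rewrite (planar_word_tbind Hf); case F: planar_word => [w|//] /=.
  case: eqP => // -[wa].
  have [y yb] : exists y, y \in b.
    by move: b0; case: (b) => // y b' _; exists y; rewrite mem_head.
  have : y \in a by rewrite /a !mem_cat yb orbT.
  rewrite -wa => /flattenP[s /mapP[z zw ->]].
  rewrite /f; case: eqP => // zx; case: ifP => // za; rewrite inE => /eqP yz.
  have : z \in leaves t by move: zw; rewrite (perm_mem (planar_word_perm F)) mem_filter => /andP[].
  by move/st; move/eqP: zx => zx /(_ zx) /dSS'; rewrite -yz (bS' y).
have Af : {in leaves t, (fun y => ~~ nilp (f y)) =1 mem (l ++ x :: r)}.
  move=> y yt; rewrite /f /=; case: eqP => [->|/eqP yx].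
    by rewrite mem_cat mem_head orbT; move: w0; case: (w).
  by rewrite -aS ?st //; case: (y \in a).
have swt : spelling (mem (l ++ x :: r)) t = spell (mem a) p1 ++ spell (mem a) p2.
  rewrite /spelling tp -[inl x :: p2]cat1s !spell_cat spell_node.
  have -> : mem (l ++ x :: r) x = true by rewrite /= mem_cat mem_head orbT.
  congr (_ ++ _); apply: eq_spell => y yp /=; rewrite aS // -(perm_mem pS) mem_cat yp ?orbT //.
case F: (planar_word (mem (l ++ x :: r)) t) => [v|]; last first.
  by rewrite /= (planar_word_tbind Hf) (eq_planar_word Af) F /= mulr0 mul0r.
have -> : (planar_word (mem a) (plug x t u) == Some a) = (Some v == Some (l ++ x :: r)) && (Some w == Some b).
  rewrite (planar_word_tbind Hf) (eq_planar_word Af) F /=.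
  have vp := planar_word_perm F; have uv : uniq v by rewrite (perm_uniq vp) filter_uniq.
  have xv : x \in v by rewrite (perm_mem vp) mem_filter xt app_mem mem_cat mem_head orbT.
  case/splitPr: xv F uv vp => l' r' F uv vp.
  have idf s : {subset s <= l' ++ x :: r'} -> x \notin s ->
      flatten (map f s) = s /\ {subset s <= S}.
    move=> sv xs; split; last first.
      move=> y ys; have yx : y != x by apply: contraNneq xs => <-.
      by have := sv _ ys; rewrite (perm_mem vp) mem_filter => /andP[_ /st]; apply.
    elim: s sv xs => //= y s IH sv; rewrite inE negb_or => /andP[xy xs].
    rewrite IH //; last by move=> z zs; apply: sv; rewrite inE zs orbT.
    have yx : y != x by rewrite eq_sym.
    have := sv y (mem_head _ _); rewrite (perm_mem vp) mem_filter => /andP[ya /st yS].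
    by rewrite /f (negPf yx) aS ?yS // -app_mem ya.
  have [xl xr] : x \notin l' /\ x \notin r'.
    by move: uv; rewrite cat_uniq /= negb_or => /and4P[_ /andP[-> _] -> _].
  have [fl lS'] : flatten (map f l') = l' /\ {subset l' <= S}.
    by apply: idf => // y yl; rewrite mem_cat yl.
  have [fr rS'] : flatten (map f r') = r' /\ {subset r' <= S}.
    by apply: idf => // y yl; rewrite mem_cat inE yl !orbT.
  rewrite map_cat flatten_cat /= fl fr {1}/f eqxx.
  apply/eqP/andP => [[e]|[/eqP[e] /eqP[->]]]; last first.
    have ee : l' = l /\ r' = r.
      have xl0 : x \notin l by apply: contra xS => /lS.
      have := congr1 (index x) e; rewrite !index_cat (negPf xl) (negPf xl0) /= eqxx !addn0 => sz.
      by move/eqP: e; rewrite eqseq_cat // => /andP[/eqP-> /eqP[->]].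
    by case: ee => -> ->.
  have findS s z : {subset s <= S} -> z != [::] -> {subset z <= S'} -> forall s',
      find (mem S') (s ++ z ++ s') = size s.
    move=> sS z0 zS' s'; rewrite find_cat; have -> : has (mem S') s = false.
      by apply/hasP => -[y /sS /dSS' /negPf /= ->].
    by case: z z0 zS' => //= y z _ zS'; rewrite zS' ?mem_head // addn0.
  have := congr1 (find (mem S')) e; rewrite findS // findS // => sz.
  move/eqP: e; rewrite eqseq_cat // => /andP[/eqP-> /eqP e].
  have nfS s : {subset s <= S} -> find (mem S') s = size s.
    by move=> sS; apply: hasNfind; apply/hasP => -[y /sS /dSS' /negPf /= ->].
  have findr s z : {subset s <= S} -> {subset z <= S'} ->
      find (predC (mem S')) (z ++ s) = size z.
    move=> sS zS'; rewrite find_cat; have -> : has (predC (mem S')) z = false.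
      by apply/hasP => -[y /zS' /= ->].
    case: s sS => [|y s] sS /=; first by rewrite addn0.
    by rewrite dSS' ?sS ?mem_head //= addn0.
  have := congr1 (find (predC (mem S'))) e; rewrite !findr // => sz'.
  by move/eqP: e; rewrite eqseq_cat // => /andP[/eqP-> /eqP->].
case: eqP => [[vE]|_]; last by rewrite mulr0 mul0r.
case: eqP => [[wE]|_]; last by rewrite mulr0.
subst v w => /=.
have -> : local_signs (mem a) (plug x t u) = (local_signs (mem (l ++ x :: r)) t + local_signs (mem a) u)%N.
  rewrite (local_signs_tbind Hf); last by rewrite (eq_planar_word Af) F.
  by rewrite (eq_local_signs Af) sum_local_signs_leaves.
rewrite (sg (mem a)) -!exprD; apply: sign_eq.
have bal : num_zeros (spelling (mem a) u) = num_pos (spelling (mem a) u).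
  by rewrite -(planar_word_count E) /nilp size_eq0 (negPf b0) addn0.
have := @odd_inversions_insert (spell (mem a) p1) _ (spell (mem a) p2) bal (dis (mem a)).
have -> : spell (mem a) p1 ++ spelling (mem a) u ++ spell (mem a) p2 = spelling (mem a) (plug x t u).
  by rewrite /spelling pp !spell_cat.
have ps12 : pos (spell (mem a) p1 ++ spell (mem a) p2) =
    [seq y.+1 | y <- lbls p1 ++ lbls p2 & y \notin a].
  by rewrite -spell_cat /pos positive_spell lbls_cat.
have psu : pos (spelling (mem a) u) = [seq y.+1 | y <- leaves u & y \notin a].
  by rewrite pos_spelling.
rewrite (pos_cross_space_cross psu ps12 pS lu) -swt.
move=> E1; rewrite [LHS]oddD E1 -oddD; congr odd.
move: (space_cross _ _ _) (_ * _)%N (inversions (spelling (mem a) u)) (inversions _) (local_signs (mem a) u) (local_signs _ _) => *; lia.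
Qed.

(** The planar labels of u remain contiguous in a composite, so words of no other
    form occur. *)
Lemma chi_plug_split (a : seq nat) x S S' t u : uniq (x :: S) -> uniq (S ++ S') ->
  perm_eq (leaves t) (x :: S) -> perm_eq (leaves u) S' ->
  chi a (plug x t u) != 0 ->
  {subset a <= S} \/ exists l b r, [/\ a = l ++ b ++ r, b != [::],
    {subset l <= S}, {subset r <= S} & {subset b <= S'}].
Proof.
move=> uxS uSS' lt lu; rewrite /chi.
have xt : x \in leaves t by rewrite (perm_mem lt) mem_head.
case: ifP => [/eqP pa _|_]; last by rewrite eqxx.
have ut : uniq (leaves t) by rewrite (perm_uniq lt).
case E: (planar_word (mem a) u) => [w|]; last first.
  by move: pa; rewrite /plug (@planar_word_tbind_none _ _ _ x) //= eqxx.
pose f y := if y == x then w else if y \in a then [:: y] else [::].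
have Hf y : y \in leaves t -> planar_word (mem a) (if y == x then u else Leaf y) = Some (f y).
  by move=> _; rewrite /f; case: ifP.
have st y : y \in leaves t -> y != x -> y \in S.
  by rewrite (perm_mem lt) inE => /orP[->|].
have wS' : {subset w <= S'}.
  by move=> y; rewrite (perm_mem (planar_word_perm E)) mem_filter (perm_mem lu) => /andP[].
move: pa; rewrite (planar_word_tbind Hf); case F: planar_word => [v|//] /= [va].
have vt : {subset v <= leaves t}.
  by move=> y; rewrite (perm_mem (planar_word_perm F)) mem_filter => /andP[].
have fS s : {subset s <= leaves t} -> x \notin s -> {subset flatten (map f s) <= S}.
  move=> stt xs y /flattenP[z /mapP[b bs ->]].
  have bx : b != x by apply: contraNneq xs => <-.
  rewrite /f (negPf bx); case: ifP => // _; rewrite inE => /eqP->; apply: st => //; exact: stt.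
case: (boolP (x \in v)) => [xv|xv]; last by left; rewrite -va; apply: fS.
have uv : uniq v by rewrite (perm_uniq (planar_word_perm F)) filter_uniq.
case/splitPr: xv va vt uv {F} => l r va vt; rewrite cat_uniq /= negb_or.
case/and4P=> _ /andP[xl _] xr _; move: va; rewrite map_cat flatten_cat /=.
have lS : {subset flatten (map f l) <= S}.
  by apply: fS => // y yl; apply: vt; rewrite mem_cat yl.
have rS : {subset flatten (map f r) <= S}.
  by apply: fS => // y yl; apply: vt; rewrite mem_cat inE yl !orbT.
rewrite {2}/f eqxx => va; case: (altP (w =P [::])) => w0.
  by left; rewrite -va w0 /= => y; rewrite mem_cat => /orP[/lS|/rS].
right; exists (flatten (map f l)), w, (flatten (map f r)); split=> //.
Qed.

End PlugSigns.

(** * The functionals vanish on the relations *)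

Section IntegerModel.

(** Integer models of the functionals and of the pairing of quadratic data, in
    which the statements about arity three are decided by computation. *)
Definition chiZ (a : seq nat) (t : gtree) : int :=
  if planar_word (mem a) t == Some a
  then (-1) ^+ (inversions (spelling (mem a) t) + local_signs (mem a) t) else 0.

Definition normal3Z (sg : bool) (t : gtree) :
    option (bool * (gerst_gen * gerst_gen * nat)) :=
  let rot s x y a b c := if b == (a %% 3).+1 then (s, (x, y, c))
                         else (s (+) sg, (x, gerst_op y, c)) in
  match t with
  | Node x [:: Node y [:: Leaf a; Leaf b]; Leaf c] =>
      Some (rot false x y a b c)
  | Node x [:: Leaf c; Node y [:: Leaf a; Leaf b]] =>
      Some (rot sg (gerst_op x) y a b c)
  | _ => None
  end.

Definition pairZ (t' t : gtree) : int :=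
  match normal3Z true t', normal3Z false t with
  | Some (s', m'), Some (s, m) =>
      if m' == m then (-1) ^+ (s' (+) s) * (-1) ^+ (absz (gerst_deg m.1.1 * gerst_deg m.1.2))
      else 0
  | _, _ => 0
  end.

Definition assocZ : seq (int * gtree) :=
  [:: (1, mu (mu (Leaf 1) (Leaf 2)) (Leaf 3)); (-1, mu (Leaf 1) (mu (Leaf 2) (Leaf 3)))].
Definition jacobiZ : seq (int * gtree) :=
  [:: (1, br (br (Leaf 1) (Leaf 2)) (Leaf 3)); (1, br (br (Leaf 2) (Leaf 3)) (Leaf 1));
      (1, br (br (Leaf 3) (Leaf 1)) (Leaf 2))].
Definition leibnizZ : seq (int * gtree) :=
  [:: (1, br (Leaf 1) (mu (Leaf 2) (Leaf 3))); (-1, mu (br (Leaf 1) (Leaf 2)) (Leaf 3));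
      (-1, mu (Leaf 2) (br (Leaf 1) (Leaf 3)))].

Definition pairsZ (t' : gtree) (r : seq (int * gtree)) (s : seq nat) : int :=
  foldr (fun ct z => ct.1 * pairZ t' (trelabel (std s) ct.2) + z) 0 r.

Definition gens : seq gerst_gen := [:: g_prod; g_opp; g_brac].

Definition perms3 : seq (seq nat) :=
  [:: [:: 1; 2; 3]; [:: 1; 3; 2]; [:: 2; 1; 3]; [:: 2; 3; 1]; [:: 3; 1; 2]; [:: 3; 2; 1]]%N.

Definition shape3 (b : bool) (x y : gerst_gen) (s : seq nat) : gtree :=
  let l i := Leaf (nth 0%N s i) in
  if b then Node x [:: Node y [:: l 0%N; l 1%N]; l 2%N]
  else Node x [:: l 0%N; Node y [:: l 1%N; l 2%N]].

Definition trees3 : seq gtree :=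
  [seq shape3 bs.1 xy.1 xy.2 bs.2 | bs <- [seq (b, s) | b <- [:: true; false], s <- perms3],
     xy <- [seq (x, y) | x <- gens, y <- gens]].

Definition words3 : seq (seq nat) :=
  [:: [::]; [:: 1]; [:: 2]; [:: 3]; [:: 1; 2]; [:: 1; 3]; [:: 2; 1]; [:: 2; 3];
      [:: 3; 1]; [:: 3; 2]]%N ++ perms3.

(** Each functional of arity three is, up to sign, the pairing with a
    relabelled relation; it is a finite computation over the 108 trees with
    three leaves. *)
Lemma chiZ_pairsZ a : a \in words3 -> exists e r s,
  [/\ r \in [:: assocZ; jacobiZ; leibnizZ], s \in perms3 &
    forall t, t \in trees3 -> chiZ a t = e * pairsZ t r s].
Proof.
have : all (fun a => has (fun e : int => has (fun r => has (fun s =>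
    all (fun t => chiZ a t == e * pairsZ t r s) trees3) perms3)
    [:: assocZ; jacobiZ; leibnizZ]) [:: 1; -1]) words3 by vm_compute.
move/allP => H /H /hasP[e _ /hasP[r rin /hasP[s sin /allP te]]].
by exists e, r, s; split=> // t /te /eqP.
Qed.

End IntegerModel.

Section Relations.
Variable k : fieldType.
Local Notation chi := (@chi k).
Local Notation P := (Gerst_dual k).

Lemma chi_chiZ a t : chi a t = (chiZ a t)%:~R.
Proof. by rewrite /chi /chiZ; case: ifP => // _; rewrite rmorphXn rmorphN1. Qed.

Definition relZ (r : seq (int * gtree)) : lin k gerst_gen :=
  \sum_(ct <- r) ct.1%:~R *: << ct.2 >>.

Lemma gerst_relZ r : r \in [:: assocZ; jacobiZ; leibnizZ] ->
  gerst_rel (relZ r).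
Proof.
have mono (z : k) (t : gtree) : z *: << t >> = << z *g t >> :> lin k gerst_gen.
  exact: scale_mono.
rewrite !inE => /or3P[] /eqP->; rewrite /relZ !big_cons big_nil /=
  ?rmorphN1 ?rmorph1 ?scale1r ?scaleN1r addr0 ?addrA.
- exact: gerst_assoc.
- exact: gerst_jacobi.
- exact: gerst_leibniz.
Qed.

Lemma pairing3_relZ (f : lin k gerst_gen) r s :
  @pairing3 k (Gerst k) f (relabel (std s) (relZ r)) =
  linext (fun t => (pairsZ t r s)%:~R : k^o) f.
Proof.
rewrite /pairing3; apply: (@eq_linext_supp k _ k^o) => t _.
elim: r => [|[c u] r IH].
  by rewrite /relZ big_nil !linear0.
rewrite /relZ big_cons /= -/(relZ r) [relabel _ _]linearD linearZ /= relabelU.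
rewrite linearD linearZ /= IH linextU1 rmorphD rmorphM /=; congr (_ + _).
congr (_ * _); rewrite /pairZ -/(normal3Z true t) -/(normal3Z false _).
have E b u' : @normal3 k (Gerst k) (fun => b) u' = normal3Z b u' by [].
rewrite (E true t) (E false (trelabel (std s) u)).
case: (normal3Z true t) => [[s' m']|] //; case: (normal3Z false _) => [[s0 m]|] //.
case: ifP => // _; rewrite rmorphM !rmorphXn rmorphN1; congr (_ * _).
exact: expN1z.
Qed.

Definition nleaves (t : gtree) : nat := size (leaves t).

Lemma nleaves2 g t1 t2 :
  nleaves (Node g [:: t1; t2]) = (nleaves t1 + nleaves t2)%N.
Proof. by rewrite /nleaves /= cats0 size_cat. Qed.

Lemma nleaves_gt0 (t : gtree) : wf (P := P) t -> (0 < nleaves t)%N.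
Proof.
elim/gtree_ind: t => //= [g t1 t2 IH1 IH2 /and3P[/IH1 s1 _ _]|g ts nts].
  by rewrite nleaves2; lia.
by rewrite (negPf nts).
Qed.

Lemma wf_node (g : gerst_gen) ts : wf (P := P) (Node g ts) ->
  exists t1 t2, [/\ ts = [:: t1; t2], wf (P := P) t1 & wf (P := P) t2].
Proof.
by case: ts => [|t1 [|t2 [|t3 ts]]] //= /and3P[w1 w2 _]; exists t1, t2.
Qed.

Lemma wf_leaf (t : gtree) : wf (P := P) t -> (nleaves t <= 1)%N ->
  exists a, t = Leaf a.
Proof.
case: t => [a|g ts]; first by exists a.
case/wf_node=> t1 [t2 [-> /nleaves_gt0 p1 /nleaves_gt0 p2]].
by rewrite nleaves2; lia.
Qed.

Lemma perm_perms3 s : perm_eq s (iota 1 3) -> s \in perms3.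
Proof.
have /allP H : all (fun s => s \in perms3) (permutations (iota 1 3)) by vm_compute.
by rewrite -mem_permutations => /H.
Qed.

Lemma mem_shape3 b x y s : s \in perms3 -> shape3 b x y s \in trees3.
Proof.
have mem_gens g : g \in gens by case: g => [[]|[]].
move=> sin; apply/allpairsP; exists ((b, s), (x, y)); split; last by [].
  apply/allpairsP; exists (b, s); split; [by case: b | exact: sin | by []].
by apply/allpairsP; exists (x, y); split; [exact: mem_gens | exact: mem_gens |].
Qed.

Lemma monomial3 (t : gtree) : monomial (P := P) (iota 1 3) t -> t \in trees3.
Proof.
case/and3P; case: t => [//|x ts] _ /wf_node[t1 [t2 [-> w1 w2]]] lt.
have : nleaves (Node x [:: t1; t2]) = 3 by rewrite /nleaves (perm_size lt).
have := nleaves_gt0 w1; have := nleaves_gt0 w2; rewrite nleaves2 => p2 p1 sz.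
case: (leqP (nleaves t1) 1) => n1.
  have [a E1] := wf_leaf w1 n1; subst t1.
  case: t2 w2 lt p2 sz => [b|y us]; first by rewrite /nleaves /=; lia.
  case/wf_node=> u1 [u2 [-> v1 v2]] lt; have := nleaves_gt0 v1; have := nleaves_gt0 v2.
  rewrite nleaves2 => q2 q1 _ sz.
  have [c E1] : exists a, u1 = Leaf a by apply: wf_leaf => //; lia.
  have [d E2] : exists a, u2 = Leaf a by apply: wf_leaf => //; lia.
  by subst; apply: (mem_shape3 false x y (perm_perms3 lt)).
have [c E2] : exists a, t2 = Leaf a by apply: wf_leaf => //; lia.
subst t2; case: t1 w1 lt p1 n1 sz => [b|y us]; first by rewrite /nleaves /=; lia.
case/wf_node=> u1 [u2 [-> v1 v2]] lt; have := nleaves_gt0 v1; have := nleaves_gt0 v2.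
rewrite nleaves2 => q2 q1 _ _ sz.
have [a E1] : exists a, u1 = Leaf a by apply: wf_leaf => //; lia.
have [d E2'] : exists a, u2 = Leaf a by apply: wf_leaf => //; lia.
by subst; apply: (mem_shape3 true x y (perm_perms3 lt)).
Qed.

Lemma mem_words3 a : uniq a -> {subset a <= iota 1 3} -> a \in words3.
Proof.
move=> ua sa.
have c3 x : x \in a -> [\/ x = 1%N, x = 2%N | x = 3%N].
  by move/sa; rewrite !inE => /or3P[] /eqP->; [constructor 1|constructor 2|constructor 3].
have := uniq_leq_size ua sa; rewrite size_iota.
case: a ua sa c3 => [|x [|y [|z [|w a]]]] //= ua _ c3 _.
- by case: (c3 x); rewrite ?inE ?eqxx // => ->.
- by case: (c3 x) ua; rewrite ?inE ?eqxx // => ->; case: (c3 y); rewrite ?inE ?eqxx ?orbT // => ->.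
- by case: (c3 x) ua; rewrite ?inE ?eqxx // => ->; case: (c3 y); rewrite ?inE ?eqxx ?orbT // => ->;
  case: (c3 z); rewrite ?inE ?eqxx ?orbT // => ->.
Qed.

Lemma chi_word a t : chi a t != 0 -> planar_word (mem a) t = Some a.
Proof. by rewrite /chi; case: ifP => [/eqP|_]; rewrite ?eqxx. Qed.

Lemma chi_sub a t : chi a t != 0 -> {subset a <= leaves t}.
Proof.
move/chi_word/planar_word_perm => p x; rewrite (perm_mem p) mem_filter.
by case/andP.
Qed.

Lemma chi_uniq a t : uniq (leaves t) -> chi a t != 0 -> uniq a.
Proof. by move=> ut /chi_word/planar_word_perm/perm_uniq->; rewrite filter_uniq. Qed.

(** In arity two this is the antisymmetry built into the sign. In arity three the
    functional is a pairing with a relation of the Gerstenhaber operad, and the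
    relations of the dual operad are orthogonal to these. *)
Lemma chi_rel n (r : lin k gerst_gen) a :
  Defs.rel (p := P) n r -> in_free (P := P) (iota 1 n) r ->
  linext (chi a : _ -> k^o) r = 0.
Proof.
case=> {n r} [x _|r [fr rr] _].
  rewrite linearB linearZ /= !linextU1 expr1 scaleN1r opprK.
  rewrite /chi /=; case: x => [b|[]]; rewrite /spelling /spell /=;
  case: (1%N \in a); case: (2%N \in a) => //=; do ?case: b => //=;
  by do ?[case: ifP => //=]; rewrite ?expr1 ?expr0 ?addNr ?addrN ?addr0.
case: (boolP (a \in words3)) => [/chiZ_pairsZ[e [r' [s [r'in sin E]]]]|na].
  have -> : linext (chi a : _ -> k^o) r = e%:~R * linext (fun t => (pairsZ t r' s)%:~R : k^o) r.
    transitivity (linext (fun t => e%:~R *: ((pairsZ t r' s)%:~R : k^o)) r).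
      apply: eq_linext_supp => t tr.
      by rewrite chi_chiZ E ?rmorphM //; apply: monomial3; apply: fr.
    rewrite /linext mulr_sumr; apply: eq_bigr => t _.
    by rewrite /GRing.scale /= mulrCA.
  rewrite -pairing3_relZ rr ?mulr0 //; first exact: gerst_relZ.
  by move: sin; rewrite !inE; do 5?[case/predU1P => [-> //|]]; move/eqP->.
rewrite /linext big_seq big1 // => t tr; apply/eqP; rewrite scaler_eq0.
apply/orP; right; apply: contraR na => nz; apply: mem_words3.
  apply: chi_uniq nz; rewrite (perm_uniq (monomial_leaves (fr t tr))).
  exact: iota_uniq.
move=> x /(chi_sub nz); by rewrite (perm_mem (monomial_leaves (fr t tr))).
Qed.

End Relations.

Lemma uniq_map_inj (h : nat -> nat) (S : seq nat) : uniq (map h S) -> {in S &, injective h}.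
Proof.
move=> uhS x y xS yS hxy; move/(uniqP 0%N): uhS => inj.
have := inj (index x S) (index y S); rewrite !inE size_map !index_mem => /(_ xS yS).
rewrite !(nth_map 0%N) ?index_mem // !nth_index // => /(_ hxy) e.
by rewrite -(nth_index 0%N xS) e nth_index.
Qed.

Section ChiIdeal.
Variable k : fieldType.
Local Notation chi := (@chi k).
Local Notation P := (Gerst_dual k).
Local Notation lin := (lin k gerst_gen).
Local Notation Chi a := (linext (chi a : _ -> k^o)).

Lemma signz_sq (z : int) : (-1 : k) ^ z * (-1) ^ z = 1.
Proof. by rewrite expN1z signMsign. Qed.

Lemma linext_graft (F : gtree -> k^o) x (f g : lin) :
  linext F (graft (gdeg P) x f g) =
  \sum_(t <- msupp f) \sum_(u <- msupp g)
     (f@_t * g@_u * (-1) ^ (tdeg ddeg u * deg_after ddeg x t)) * F (plug x t u).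
Proof.
rewrite graftE linear_sum; apply: eq_bigr => t _; rewrite linear_sum.
by apply: eq_bigr => u _; rewrite linearZ /= linextU1.
Qed.

Lemma Chi_graft_mul a a' b C x (f g : lin) :
  (forall t u, t \in msupp f -> u \in msupp g ->
     chi a (plug x t u) =
     C * (-1) ^ (tdeg ddeg u * deg_after ddeg x t) * chi a' t * chi b u) ->
  Chi a (graft (gdeg P) x f g) = C * Chi a' f * Chi b g.
Proof.
move=> H; rewrite linext_graft /linext -mulrA mulr_suml mulr_sumr big_seq [RHS]big_seq.
apply: eq_bigr => t tf; rewrite mulr_sumr mulr_sumr big_seq [RHS]big_seq.
apply: eq_bigr => u ug; rewrite H // /GRing.scale /=.
have := signz_sq (tdeg ddeg u * deg_after ddeg x t); move: (_ ^ _) => e ee.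
by rewrite -[RHS]mulr1 -ee; ring.
Qed.

(** The product formula that carries the vanishing of the functionals through
    the two composition rules of the ideal. *)
Lemma Chi_graft a x (S S' : seq nat) (f g : lin) : uniq (x :: S) ->
  uniq (S ++ S') -> in_free (P := P) (x :: S) f -> in_free (P := P) S' g ->
  exists C a' b, Chi a (graft (gdeg P) x f g) = C * Chi a' f * Chi b g.
Proof.
move=> uxS uSS' Sf Sg.
have lt t : t \in msupp f -> perm_eq (leaves t) (x :: S).
  by move/Sf; apply: monomial_leaves.
have lu u : u \in msupp g -> perm_eq (leaves u) S'.
  by move/Sg; apply: monomial_leaves.
case: (pselect {subset a <= S}) => [aS|naS].
  eexists; exists a, [::]; apply: Chi_graft_mul => t u /lt tt /lu uu.
  exact: (chi_plug_space _ uxS uSS').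
case: (pselect (exists l b r, [/\ a = l ++ b ++ r, b != [::],
    {subset l <= S}, {subset r <= S} & {subset b <= S'}])) => [|no].
  case=> l [b [r [-> b0 lS rS bS']]].
  eexists; exists (l ++ x :: r), b; apply: Chi_graft_mul => t u /lt tt /lu uu.
  exact: (chi_plug_planar _ uxS uSS').
exists 0, [::], [::]; apply: Chi_graft_mul => t u /lt tt /lu uu.
rewrite !mul0r; apply/eqP; apply: contraT => /(chi_plug_split uxS uSS' tt uu).
by case.
Qed.

Lemma planar_word_trelabel A h t :
  planar_word A (trelabel h t) = omap (map h) (planar_word (A \o h) t).
Proof.
rewrite /trelabel (@planar_word_tbind _ _ (fun y => if A (h y) then [:: h y] else [::])) //.
rewrite (@eq_planar_word _ (A \o h)); last by move=> y _ /=; case: (A _).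
case E: planar_word => [w|//] /=; congr Some; have := planar_word_all E.
by elim: w {E} => //= y w IH /andP[-> /IH->].
Qed.

Lemma local_signs_trelabel A h t : local_signs A (trelabel h t) = local_signs (A \o h) t.
Proof.
elim/gtree_ind: t => [//|g t1 t2 IH1 IH2|g ts] /=.
- rewrite -/(trelabel h t1) -/(trelabel h t2) IH1 IH2 planar_word_trelabel.
  case: g => //= _; congr (nat_of_bool (~~ _) + _ + _)%N.
  by case: planar_word => [[|a v]|].
- by case: ts => [|t1 [|t2 [|]]].
Qed.

(** The action of a relabelling on letters. *)
Definition lift (h : nat -> nat) (v : nat) : nat := if v is v'.+1 then (h v').+1 else 0%N.

Lemma spelling_trelabel A h t : spelling A (trelabel h t) = map (lift h) (spelling (A \o h) t).
Proof.
rewrite /spelling; have -> : pword ddeg (trelabel h t) =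
   [seq (if e is inl y then inl (h y) else e) | e <- pword ddeg t].
  elim/tree_induction: t => //= g ts IH; congr cons.
  elim: ts IH => //= t ts IHts IH; rewrite map_cat -IH ?mem_head // IHts // => t' ts'.
  by apply: IH; rewrite in_cons ts' orbT.
elim: (pword ddeg t) => //= e w IH; rewrite /spell /= -!/(spell _ _) map_cat -IH.
by case: e => [y|d] /=; [case: (A _) | case: eqP].
Qed.

(** Up to order the letters of a tree depend only on its labels and its planar
    word; hence so does the sign of a relabelling. *)
Lemma spelling_perm a S t : perm_eq (leaves t) S -> planar_word (mem a) t = Some a ->
  perm_eq (spelling (mem a) t)
    (nseq (size [seq s <- S | s \notin a] - nilp a) 0%N ++
     [seq s.+1 | s <- S & s \notin a]).
Proof.
move=> lt wt.
have ps : perm_eq (pos (spelling (mem a) t)) [seq s.+1 | s <- S & s \notin a].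
  by rewrite pos_spelling; apply/perm_map/perm_filter.
have zs : [seq v <- spelling (mem a) t | ~~ (0 < v)%N] =
    nseq (size [seq s <- S | s \notin a] - nilp a) 0%N.
  have -> : (size [seq s <- S | s \notin a] - nilp a = num_zeros (spelling (mem a) t))%N.
    have <- : num_pos (spelling (mem a) t) = size [seq s <- S | s \notin a].
      by rewrite -(size_map succn) -(perm_size ps) size_filter.
    by rewrite -(planar_word_count wt) addnK.
  elim: (spelling _ _) => //= v w IH; rewrite {}IH /num_zeros /=.
  by case: v => [|v].
rewrite -zs perm_sym perm_catC; apply: perm_trans (permEl (perm_filterC (fun v => 0 < v)%N _)).
by apply: perm_cat => //; rewrite perm_sym.
Qed.

Lemma inversions_num_zeros z (l : seq nat) :
  inversions (nseq z 0%N ++ map succn l) = inversions l.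
Proof.
elim: z => [|z IH] /=; last first.
  by rewrite IH (eq_count (a2 := pred0)) ?count_pred0.
by apply: inversions_mono.
Qed.

Lemma chi_relabel (b : seq nat) h (S : seq nat) t : {in S &, injective h} ->
  {subset b <= S} -> perm_eq (leaves t) S ->
  chi (map h b) (trelabel h t) =
  (-1) ^+ (inversions (map h [seq s <- S | s \notin b]) +
           inversions [seq s <- S | s \notin b]) * chi b t.
Proof.
move=> injh bS tt.
have Ab : {in leaves t, (mem (map h b)) \o h =1 mem b}.
  move=> y; rewrite (perm_mem tt) /= => yS; apply/mapP/idP => [[z zb hz]|yb].
    by rewrite (injh _ _ yS (bS _ zb) hz).
  by exists y.
rewrite /chi planar_word_trelabel local_signs_trelabel spelling_trelabel (eq_planar_word Ab) (eq_local_signs Ab) (eq_spelling Ab).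
have -> : (omap (map h) (planar_word (mem b) t) == Some (map h b)) = (planar_word (mem b) t == Some b).
  apply/eqP/eqP => [|->] //; case E: planar_word => [v|] //= -[] hv; congr Some.
  have vS : {subset v <= S}.
    by move=> x; rewrite (perm_mem (planar_word_perm E)) mem_filter (perm_mem tt) => /andP[].
  elim: v b bS hv vS {E Ab} => [|x v IH] [|y b] // bS [hxy hv] vS.
  have -> : x = y by apply: injh => //; [apply: vS | apply: bS]; rewrite mem_head.
  rewrite (IH b) // => z zin.
    by apply: bS; rewrite in_cons zin orbT.
  by apply: vS; rewrite in_cons zin orbT.
case: eqP => [wt|_]; last by rewrite mulr0.
rewrite -exprD; apply: sign_eq.
have pr := spelling_perm tt wt.
have injl : {in spelling (mem b) t &, injective (lift h)}.
  have liS v : v.+1 \in spelling (mem b) t -> v \in S.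
    by move/(mem_spell (isT : (0 < v.+1)%N)); rewrite lbls_pword (perm_mem tt).
  by move=> [|v] [|v'] // /liS vS /liS vS' [] /injh ->.
have := odd_inversions_map pr injl; rewrite map_cat map_nseq -map_comp.
rewrite (_ : map (lift h \o succn) _ = map succn (map h [seq s <- S | s \notin b])); last first.
  by rewrite -map_comp.
by rewrite !inversions_num_zeros !oddD => <-; rewrite addbA addbK.
Qed.

Lemma Chi_relabel a h (S : seq nat) (f : lin) : uniq (map h S) ->
  in_free (P := P) S f -> exists C b, Chi a (relabel h f) = C * Chi b f.
Proof.
move=> uhS Sf.
have uS : uniq S by apply: map_uniq uhS.
have lt t : t \in msupp f -> perm_eq (leaves t) S.
  by move/Sf; apply: monomial_leaves.
have injh := uniq_map_inj uhS.
have red C b : (forall t, perm_eq (leaves t) S -> chi a (trelabel h t) = C * chi b t) ->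
    Chi a (relabel h f) = C * Chi b f.
  move=> H; rewrite /relabel (linext_comp (Chi a)).
  transitivity (\sum_(t <- msupp f) f@_t * (C * chi b t)).
    apply: eq_big_seq => t /lt tt; rewrite -H //; congr (_ *: _); exact: linextU1.
  rewrite /linext mulr_sumr; apply: eq_bigr => t _.
  by rewrite /GRing.scale /=; ring.
case: (pselect (exists2 b, a = map h b & {subset b <= S})) => [[b ab bS]|no]; last first.
  exists 0, [::]; apply: red => t tt; rewrite mul0r; apply/eqP; apply: contraT => nz.
  case: no; have := chi_sub nz; rewrite leaves_trelabel => sa.
  exists [seq nth 0%N S (index y (map h S)) | y <- a].
    rewrite -map_comp; rewrite -{1}[a]map_id; apply/eq_in_map => y /sa /=.
    rewrite (perm_mem (perm_map h tt)) => yS; rewrite -(nth_map _ 0%N).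
      by rewrite nth_index.
    by rewrite -(size_map h) index_mem.
  move=> x /mapP[y /sa].
  rewrite (perm_mem (perm_map h tt)) => yS ->; rewrite mem_nth //.
  by rewrite -(size_map h) index_mem.
subst a; exists ((-1) ^+ (inversions (map h [seq s <- S | s \notin b]) +
           inversions [seq s <- S | s \notin b])), b.
by apply: red => t tt; apply: chi_relabel.
Qed.

(** The functionals are defined on the dual operad. *)
Theorem Chi_ideal (S : seq nat) (f : lin) : ideal (P := P) S f -> uniq S ->
  forall a, Chi a f = 0.
Proof.
elim=> {S f} [n r rn fr|S|S c f g _ IHf _ IHg|S S' f SS' _ IH|S h f uhS Sf IH|
              x S S' f g uxS uSS' Sf IH Sg|x S S' f g uxS uSS' Sf Sg IH] uS a.
- exact: chi_rel fr.
- by rewrite linear0.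
- by rewrite linearP /= IHf // IHg // scaler0 addr0.
- by apply: IH; rewrite (perm_uniq SS').
- have [C [b ->]] := Chi_relabel a uhS (ideal_in_free Sf).
  by rewrite IH ?mulr0 //; apply: map_uniq uhS.
- have [C [a' [b ->]]] := Chi_graft a uxS uSS' (ideal_in_free Sf) Sg.
  by rewrite IH // mulr0 mul0r.
- have [C [a' [b ->]]] := Chi_graft a uxS uSS' Sf (ideal_in_free Sg).
  by rewrite IH ?mulr0 //; move: uSS'; rewrite cat_uniq => /and3P[].
Qed.

End ChiIdeal.

(** * Relations of the dual operad *)

Definition leafn (i : nat) : gtree := Leaf i.
Local Notation l := leafn.

(** Relations of the dual operad, each led by the tree that it is to rewrite:
    products associate to the right, brackets leave products on either side,
    two space inputs are exchanged, and brackets associate to the right. *)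
Definition dualsZ : seq (seq (int * gtree)) :=
  [:: [:: (1, mu (mu (l 1) (l 2)) (l 3)); (-1, mu (l 1) (mu (l 2) (l 3)))];
      [:: (1, mu (br (l 1) (l 2)) (l 3)); (-1, br (l 1) (mu (l 2) (l 3)));
          (1, br (l 2) (mu (l 1) (l 3)))];
      [:: (1, mu (l 3) (br (l 1) (l 2))); (-1, br (l 1) (mu (l 3) (l 2)));
          (1, br (l 2) (mu (l 3) (l 1)))];
      [:: (1, br (l 1) (br (l 2) (l 3))); (1, br (l 2) (br (l 1) (l 3)))];
      [:: (1, br (br (l 1) (l 2)) (l 3)); (1, br (l 1) (br (l 2) (l 3)))]].

Definition syms2 : seq (seq (int * gtree)) :=
  [:: [:: (1, Node g_opp [:: l 1; l 2]); (1, mu (l 2) (l 1))];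
      [:: (1, br (l 1) (l 2)); (1, br (l 2) (l 1))]].

Section Substitution.
Variable k : fieldType.
Local Notation P := (Gerst_dual k).
Local Notation lin := (lin k gerst_gen).
Local Notation wf := (wf (P := P)).

(** Orthogonality to all relabelled relations, by computation. *)
Lemma ideal_dualsZ r : r \in dualsZ -> ideal (P := P) (iota 1 3) (relZ k r).
Proof.
move=> rin.
have fr : in_free (P := P) (iota 1 3) (relZ k r).
  apply: in_free_sum_seq => ct ctr; apply/in_freeZ/in_freeU.
  have : all (fun r => all (fun ct : int * gtree => monomial (P := P) (iota 1 3) ct.2) r) dualsZ.
    by vm_compute.
  by move/allP/(_ r rin)/allP/(_ ct ctr).
apply: ideal_rel => //; apply: quadratic_R; split=> // r' s r'rel ps.
have {r'rel} [r0 r0in ->] : exists2 r0, r0 \in [:: assocZ; jacobiZ; leibnizZ] & r' = relZ k r0.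
  case: r'rel; [exists assocZ|exists jacobiZ|exists leibnizZ]; rewrite ?inE ?eqxx ?orbT //;
  by rewrite /relZ !big_cons big_nil /= ?rmorphN1 ?rmorph1 ?scale1r ?scaleN1r addr0 ?addrA.
rewrite pairing3_relZ.
have -> : linext (fun t => (pairsZ t r0 s)%:~R : k^o) (relZ k r) =
   (\sum_(ct <- r) ct.1 * pairsZ ct.2 r0 s)%:~R.
  rewrite /relZ linear_sum rmorph_sum /=; apply: eq_bigr => ct _.
  by rewrite linearZ rmorphM /=; congr (_ * _); apply: linextU1.
have : all (fun r => all (fun r0 => all (fun s =>
    foldr (fun ct z => ct.1 * pairsZ ct.2 r0 s + z) 0 r == 0) perms3)
    [:: assocZ; jacobiZ; leibnizZ]) dualsZ by vm_compute.
move/allP/(_ r rin)/allP/(_ r0 r0in)/allP/(_ s (perm_perms3 ps))/eqP.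
have -> : foldr (fun ct z => ct.1 * pairsZ ct.2 r0 s + z) 0 r =
    \sum_(ct <- r) ct.1 * pairsZ ct.2 r0 s 
  by elim: (r) => [|ct r1 IH]; rewrite ?big_nil // big_cons /= IH.
by move->.
Qed.

Lemma ideal_syms2 r : r \in syms2 -> ideal (P := P) (iota 1 2) (relZ k r).
Proof.
have mono (z : k) (t : gtree) : z *: << t >> = << z *g t >> :> lin.
  exact: scale_mono.
have sym x : ideal (P := P) (iota 1 2)
    (<< Node x (lf [:: 2; 1]%N) >> + << Node (gerst_op x) (lf [:: 1; 2]%N) >>).
  have := @quadratic_sym k (quadratic_dual (Gerst k)) x.
  rewrite expr1 scaleN1r opprK => H; apply: ideal_rel => //.
  by apply: in_freeD; apply: in_freeU.
rewrite !inE => /orP[] /eqP->; rewrite /relZ !big_cons big_nil /= ?rmorph1 ?scale1r addr0 addrC.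
  exact: (sym g_prod).
exact: (sym g_brac).
Qed.

Lemma plug_notin x (t u : gtree) : x \notin leaves t -> plug x t u = t.
Proof.
move=> xt; rewrite -[RHS]tbind_id; apply: eq_tbind => a at_ /=.
by case: eqP => // ax; rewrite -ax at_ in xt.
Qed.

(** The tree u may be a leaf, for which composition is a relabelling. *)
Lemma ideal_plug x (S : seq nat) (f : lin) (u : gtree) :
  wf u -> uniq (x :: S) -> uniq (S ++ leaves u) -> ideal (P := P) (x :: S) f ->
  ideal (P := P) (S ++ leaves u) (graft (gdeg P) x f << u >>).
Proof.
move=> wu uxS uSu If; case: u wu uSu => [a|g ts] wu uSu; last first.
  by apply: ideal_graftl => //; apply/in_freeU/and3P.
have -> : graft (gdeg P) x f << Leaf a >> = relabel (fun y => if y == x then a else y) f.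
  rewrite /graft; apply: eq_linext_supp => t _; rewrite linextU1.
  rewrite /tdeg /wdeg /= big_seq1 mul0r expr0z; congr mkmalgU.
  by apply: eq_tbind => y _; case: ifP.
set h := fun y => _; have hS : map h S = S.
  rewrite -[RHS]map_id; apply/eq_in_map => y yS; rewrite /h.
  by case: eqP => // yx; move: uxS; rewrite -yx /= yS.
apply: (@ideal_perm _ _ (map h (x :: S))).
  by rewrite /= hS /h eqxx -cat1s perm_catC.
apply: ideal_relabel => //; rewrite /= hS /h eqxx.
by move: uSu; rewrite /= cats1 rcons_uniq.
Qed.

Definition subst_tree (xs : seq nat) (us : seq gtree) (y : nat) : gtree :=
  if y \in xs then nth (Leaf y) us (index y xs) else Leaf y.

(** The trees are substituted one input at a time. This needs the inputs xs to
    be disjoint from the labels of the trees. *)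
Lemma ideal_subst_aux (I : Type) (r : seq I) (F : I -> gtree) (c : I -> k)
    us xs (D : seq nat) : size us = size xs -> all (fun u => wf u) us ->
  uniq (xs ++ D) -> uniq (flatten [seq leaves u | u <- us] ++ D) ->
  {in flatten [seq leaves u | u <- us], forall y, y \notin xs} ->
  ideal (P := P) (xs ++ D) (\sum_(i <- r) c i *: << F i >>) ->
  exists e : I -> k, [/\ forall i, e i != 0,
    all (fun u => tdeg ddeg u == 0) us -> forall i, e i = 1 &
    ideal (P := P) (flatten [seq leaves u | u <- us] ++ D)
      (\sum_(i <- r) (c i * e i) *: << tbind (subst_tree xs us) (F i) >>)].
Proof.
elim: us xs D F c => [|u us IH] [|x xs] // D F c.
  move=> _ _ _ _ _ H; exists (fun=> 1); split=> // [i|]; first exact: oner_neq0.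
  rewrite (eq_bigr (fun i => c i *: << F i >>)) // => i _.
  by rewrite mulr1 /subst_tree /= tbind_id.
move=> [sz] /= /andP[wu wus] /andP[xD uD] uL fresh If.
have uxD : uniq (x :: (xs ++ D)) by rewrite /= xD.
have ulD : uniq ((xs ++ D) ++ leaves u).
  rewrite cat_uniq uD; move: uL; rewrite /= -catA cat_uniq => /and3P[uu dis _].
  rewrite uu andbT /=.
  apply/hasPn => y yu; rewrite mem_cat negb_or; apply/andP; split.
    have := fresh y; rewrite mem_cat yu => /(_ isT).
    by rewrite inE negb_or => /andP[].
  apply: contra dis => yD; apply/hasP; exists y => //.
  by rewrite mem_cat yD orbT.
have := ideal_plug wu uxD ulD If.
have -> : graft (gdeg P) x (\sum_(i <- r) c i *: << F i >>) << u >> =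
    \sum_(i <- r) (c i * (-1) ^ (tdeg ddeg u * deg_after ddeg x (F i))) *:
       << plug x (F i) u >>.
  rewrite /graft linear_sum; apply: eq_bigr => i _.
  by rewrite linearZ /= linextU1 linextU1 -scale_mono scalerA.
have xxs : x \notin xs by apply: contra xD; rewrite mem_cat => ->.
have fx y : y \in leaves u -> y \notin x :: xs.
  by move=> yu; apply: fresh; rewrite mem_cat yu.
rewrite -catA => /(IH xs (D ++ leaves u)) [] //.
- by rewrite catA.
- by rewrite catA uniq_catC catA.
- move=> y yus; have := fresh y; rewrite mem_cat yus orbT => /(_ isT).
  by rewrite inE negb_or => /andP[].
move=> e [e0 e1 Ie].
exists (fun i => (-1) ^ (tdeg ddeg u * deg_after ddeg x (F i)) * e i); split.
- by move=> i; rewrite mulf_neq0 // expN1z signr_eq0.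
- move=> /andP[/eqP u0 us0] i; rewrite u0 mul0r expr0z mul1r; exact: e1.
have -> : \sum_(i <- r) (c i * ((-1) ^ (tdeg ddeg u * deg_after ddeg x (F i)) * e i)) *:
      << tbind (subst_tree (x :: xs) (u :: us)) (F i) >> =
    \sum_(i <- r) (c i * (-1) ^ (tdeg ddeg u * deg_after ddeg x (F i)) * e i) *:
      << tbind (subst_tree xs us) (plug x (F i) u) >> :> lin.
  apply: eq_bigr => i _; rewrite mulrA; congr (_ *: << _ >>).
  rewrite /plug tbindA; apply: eq_tbind => y _ /=.
  rewrite /subst_tree inE /= [x == y]eq_sym; case: eqP => [->|_] /=; last by case: ifP.
  rewrite -[LHS]tbind_id; apply: eq_tbind => z zu.
  by have := fx z zu; rewrite inE negb_or => /andP[_ /negPf->].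
apply: ideal_perm Ie.
by rewrite catA perm_catC catA.
Qed.

(** The Koszul signs of a simultaneous substitution only rescale the terms by
    units. *)
Lemma ideal_subst (I : Type) (r : seq I) (F : I -> gtree) (c : I -> k)
    us n : size us = n -> all (fun u => wf u) us ->
  uniq (flatten [seq leaves u | u <- us]) ->
  (forall i, {subset leaves (F i) <= iota 1 n}) ->
  ideal (P := P) (iota 1 n) (\sum_(i <- r) c i *: << F i >>) ->
  exists e : I -> k, [/\ forall i, e i != 0,
    all (fun u => tdeg ddeg u == 0) us -> forall i, e i = 1 &
    ideal (P := P) (flatten [seq leaves u | u <- us])
      (\sum_(i <- r) (c i * e i) *:
        << tbind (fun y => nth (Leaf y) us y.-1) (F i) >>)].
Proof.
move=> sz wus uus lF If.
pose N := \max_(y <- flatten [seq leaves u | u <- us]) y.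
pose h y := (y + N)%N.
have injh : injective h by move=> x y; rewrite /h => /eqP; rewrite eqn_add2r => /eqP.
have uh : uniq (map h (iota 1 n)) by rewrite map_inj_uniq ?iota_uniq.
have := ideal_relabel uh If.
have -> : relabel h (\sum_(i <- r) c i *: << F i >>) =
    \sum_(i <- r) c i *: << trelabel h (F i) >> :> lin.
  by rewrite linear_sum; apply: eq_bigr => i _; rewrite linearZ /= relabelU.
rewrite -[map h _]cats0 => /(@ideal_subst_aux I r _ c us) [] //.
- by rewrite size_map size_iota.
- by rewrite cats0.
- by rewrite cats0.
- move=> y yus; apply/mapP => -[z]; rewrite mem_iota => /andP[z1 _] yz.
  have : (y <= N)%N by apply: leq_bigmax_seq.
  by rewrite yz /h; lia.
move=> e [e0 e1]; rewrite cats0 => Ie; exists e; split=> //.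
suff <- : \sum_(i <- r) (c i * e i) *:
     << tbind (subst_tree (map h (iota 1 n)) us) (trelabel h (F i)) >> =
   \sum_(i <- r) (c i * e i) *: << tbind (fun y => nth (Leaf y) us y.-1) (F i) >> :> lin by [].
apply: eq_bigr => i _; congr (_ *: << _ >>).
rewrite /trelabel tbindA; apply: eq_tbind => y /lF yn /=.
rewrite /subst_tree map_f // index_map //.
move: yn; rewrite mem_iota => /andP[y1 yn].
have -> : index y (iota 1 n) = y.-1.
  rewrite -{1}[y]prednK // -[in X in index X](add1n y.-1) -(@nth_iota 0 1 n y.-1); last by lia.
  by rewrite index_uniq ?iota_uniq // size_iota; lia.
by apply: set_nth_default; rewrite sz; lia.
Qed.

End Substitution.

Section Vanishing.
Variable k : fieldType.
Local Notation P := (Gerst_dual k).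
Local Notation lin := (lin k gerst_gen).
Local Notation wf := (wf (P := P)).
Local Notation ideal := (@ideal k P).

Lemma relZ_cons c t r : relZ k ((c, t) :: r) = c%:~R *: << t >> + relZ k r.
Proof. by rewrite /relZ big_cons. Qed.

Lemma relZ_nil : relZ k [::] = 0.
Proof. by rewrite /relZ big_nil. Qed.

Definition count_after (x : nat) (t : gtree) : nat :=
  let w := pword ddeg t in num_zeros (spell pred0 (drop (index (inl x) w) w)).

Lemma count_afterE x t : deg_after ddeg x t = (count_after x t)%:Z.
Proof.
by rewrite /deg_after /count_after; apply: (@wdeg_num_zeros _ (take (index (inl x) (pword ddeg t)) (pword ddeg t)) _ t); rewrite cat_take_drop.
Qed.

Definition num_brackets (t : gtree) : nat := num_zeros (spelling pred0 t).

Lemma tdeg_num_brackets t : tdeg ddeg t = (num_brackets t)%:Z.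
Proof. by rewrite /num_brackets num_zeros_spell. Qed.

Lemma sign_num_brackets u x t :
  (-1 : k) ^ (tdeg ddeg u * deg_after ddeg x t) = ((-1) ^+ (num_brackets u * count_after x t))%:~R.
Proof. by rewrite count_afterE tdeg_num_brackets -PoszM -exprnP rmorphXn rmorphN1. Qed.

Definition plugZ x (u : gtree) (r : seq (int * gtree)) :=
  [seq (ct.1 * (-1) ^+ (num_brackets u * count_after x ct.2), plug x ct.2 u) | ct <- r].

Definition ctxZ x (C : gtree) (r : seq (int * gtree)) :=
  [seq (ct.1 * (-1) ^+ (num_brackets ct.2 * count_after x C), plug x C ct.2) | ct <- r].

Lemma ideal_plugZ x (S : seq nat) u r : wf u -> uniq (x :: S) ->
  uniq (S ++ leaves u) -> ideal (x :: S) (relZ k r) ->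
  ideal (S ++ leaves u) (relZ k (plugZ x u r)).
Proof.
move=> wu uxS uSu /(ideal_plug wu uxS uSu); congr Defs.ideal.
rewrite /graft /relZ linear_sum big_map; apply: eq_bigr => ct _ /=.
by rewrite linearZ /= linextU1 linextU1 -scale_mono scalerA sign_num_brackets rmorphM.
Qed.

Lemma ideal_ctx (I : Type) (r : seq I) (F : I -> gtree) (c : I -> k) x C S S' :
  monomial (P := P) (x :: S) C -> uniq (x :: S) -> uniq (S ++ S') ->
  ideal S' (\sum_(i <- r) c i *: << F i >>) ->
  ideal (S ++ S') (\sum_(i <- r)
    (c i * (-1) ^ (tdeg ddeg (F i) * deg_after ddeg x C)) *: << plug x C (F i) >>).
Proof.
move=> mC uxS uSS' If.
have := ideal_graftr uxS uSS' (in_freeU mC) If; congr Defs.ideal.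
rewrite linear_sum; apply: eq_bigr => i _.
by rewrite linearZ /= graftUU scalerA.
Qed.

Lemma ideal_ctxZ x C S S' r :
  monomial (P := P) (x :: S) C -> uniq (x :: S) -> uniq (S ++ S') ->
  ideal S' (relZ k r) -> ideal (S ++ S') (relZ k (ctxZ x C r)).
Proof.
move=> mC uxS uSS' /(ideal_ctx mC uxS uSS'); congr Defs.ideal.
rewrite /relZ big_map; apply: eq_bigr => ct _ /=.
by rewrite sign_num_brackets rmorphM.
Qed.

Lemma ideal_relabelZ h S r : uniq (map h S) -> ideal S (relZ k r) ->
  ideal (map h S) (relZ k [seq (ct.1, trelabel h ct.2) | ct <- r]).
Proof.
move=> uh /(ideal_relabel uh); rewrite /relZ linear_sum big_map.
congr Defs.ideal; apply: eq_bigr => ct _.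
by rewrite linearZ /= relabelU.
Qed.

Definition unstd (s : seq nat) (i : nat) : nat := nth 0%N s i.-1.

Lemma ideal_unstd s r : uniq s -> size s = 3 -> r \in dualsZ ->
  ideal s (relZ k [seq (ct.1, trelabel (unstd s) ct.2) | ct <- r]).
Proof.
move=> us sz /(ideal_dualsZ k) H.
have e : map (unstd s) (iota 1 3) = s.
  by case: s sz {us} => [|a [|b [|c [|d s]]]].
by rewrite -{1}e; apply: ideal_relabelZ => //; rewrite e.
Qed.

Local Notation l := leafn.
Local Notation R i := (nth [::] dualsZ i).

Lemma mem_dualsZ i : (i < 5)%N -> R i \in dualsZ.
Proof. by move=> i5; apply: mem_nth. Qed.

(** Consequences of the i-th relation in arity four, on the labels s, with a tree
    u substituted for the input x; the resulting combination r is computed. *)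
Lemma rel_plug i s x S u r : (i < 5)%N -> uniq s -> size s = 3 ->
  perm_eq s (x :: S) -> wf u -> perm_eq (S ++ leaves u) (iota 1 4) ->
  plugZ x u [seq (ct.1, trelabel (unstd s) ct.2) | ct <- R i] = r ->
  ideal (iota 1 4) (relZ k r).
Proof.
move=> i5 us sz psS wu pS <-; apply: (ideal_perm pS); apply: ideal_plugZ => //.
- by rewrite -(perm_uniq psS).
- by rewrite (perm_uniq pS) iota_uniq.
- by apply: (ideal_perm psS); apply: ideal_unstd => //; apply: mem_dualsZ.
Qed.

Lemma plugZ_eq x (S S' : seq nat) u r r' : wf u -> uniq (x :: S) ->
  uniq (S ++ leaves u) -> ideal (x :: S) (relZ k r) ->
  plugZ x u r = r' -> S ++ leaves u = S' -> ideal S' (relZ k r').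
Proof. by move=> wu uxS uSu Ir <- <-; apply: ideal_plugZ. Qed.

(** The other consequences in arity four: the relation is placed at the input x of
    a tree C. *)
Lemma rel_ctx i s x S C r : (i < 5)%N -> uniq s -> size s = 3 ->
  monomial (P := P) (x :: S) C -> x \notin S -> perm_eq (S ++ s) (iota 1 4) ->
  ctxZ x C [seq (ct.1, trelabel (unstd s) ct.2) | ct <- R i] = r ->
  ideal (iota 1 4) (relZ k r).
Proof.
move=> i5 us sz mC xS pS <-.
have uSs : uniq (S ++ s) by rewrite (perm_uniq pS) iota_uniq.
apply: (ideal_perm pS); apply: ideal_ctxZ => //; last by apply: ideal_unstd => //; apply: mem_dualsZ.
by rewrite /= xS; move: uSs; rewrite cat_uniq => /andP[].
Qed.

Local Notation "a .* b" := (mu a b) (at level 40, left associativity).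
Local Notation "a <*> b" := (br a b) (at level 45, left associativity).

(** The cancellation in the next proof, one letter for each tree. *)
Lemma cancel_terms (T p q r s u v w x y : lin) :
  T + (- p + q) + (p + (- r + s)) - (q + (- u + v)) + (r - w) - (u - x)
    - (y + (- w + x)) - (T - y) = s - v.
Proof.
apply/malgP => t; rewrite !(mcoeffD, mcoeffN); ring.
Qed.

(** The product of the bracket of 1 and 2 with the product of 3 and 4 can be
    expanded at once, or one factor at a time. The comparison exchanges 1 and 2
    in a bracket of products. *)
Lemma swap_first : ideal (iota 1 4)
  (relZ k [:: (1, (l 2 .* l 3) <*> (l 1 .* l 4)); (-1, (l 1 .* l 3) <*> (l 2 .* l 4))]).
Proof.
have E1 := @rel_plug 1 [:: 1; 2; 5]%N 5 [:: 1; 2]%N (l 3 .* l 4)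
  [:: (1, (l 1 <*> l 2) .* (l 3 .* l 4)); (-1, l 1 <*> (l 2 .* (l 3 .* l 4)));
      (1, l 2 <*> (l 1 .* (l 3 .* l 4)))]
  isT isT erefl isT isT isT ltac:(by vm_compute).
have E2 := @rel_plug 0 [:: 5; 3; 4]%N 5 [:: 3; 4]%N (l 1 <*> l 2)
  [:: (1, (l 1 <*> l 2) .* l 3 .* l 4); (-1, (l 1 <*> l 2) .* (l 3 .* l 4))]
  isT isT erefl isT isT isT ltac:(by vm_compute).
have E3 := @rel_ctx 1 [:: 1; 2; 3]%N 5 [:: 4]%N (l 5 .* l 4)
  [:: (1, (l 1 <*> l 2) .* l 3 .* l 4); (-1, (l 1 <*> (l 2 .* l 3)) .* l 4);
      (1, (l 2 <*> (l 1 .* l 3)) .* l 4)]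
  isT isT erefl isT isT isT ltac:(by vm_compute).
have E4 := @rel_plug 1 [:: 1; 5; 4]%N 5 [:: 1; 4]%N (l 2 .* l 3)
  [:: (1, (l 1 <*> (l 2 .* l 3)) .* l 4); (-1, l 1 <*> (l 2 .* l 3 .* l 4));
      (1, (l 2 .* l 3) <*> (l 1 .* l 4))]
  isT isT erefl isT isT isT ltac:(by vm_compute).
have E5 := @rel_plug 1 [:: 2; 5; 4]%N 5 [:: 2; 4]%N (l 1 .* l 3)
  [:: (1, (l 2 <*> (l 1 .* l 3)) .* l 4); (-1, l 2 <*> (l 1 .* l 3 .* l 4));
      (1, (l 1 .* l 3) <*> (l 2 .* l 4))]
  isT isT erefl isT isT isT ltac:(by vm_compute).
have E6 := @rel_ctx 0 [:: 2; 3; 4]%N 5 [:: 1]%N (l 1 <*> l 5)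
  [:: (1, l 1 <*> (l 2 .* l 3 .* l 4)); (-1, l 1 <*> (l 2 .* (l 3 .* l 4)))]
  isT isT erefl isT isT isT ltac:(by vm_compute).
have E7 := @rel_ctx 0 [:: 1; 3; 4]%N 5 [:: 2]%N (l 2 <*> l 5)
  [:: (1, l 2 <*> (l 1 .* l 3 .* l 4)); (-1, l 2 <*> (l 1 .* (l 3 .* l 4)))]
  isT isT erefl isT isT isT ltac:(by vm_compute).
have := idealB (idealB (idealB (idealD (idealB (idealD E3 E4) E5) E6) E7) E1) E2.
congr Defs.ideal; rewrite !relZ_cons !relZ_nil rmorphN1 rmorph1 !scale1r !scaleN1r !addr0.
exact: cancel_terms.
Qed.

Lemma cancel_terms' (T p q r s u v w x y : lin) :
  T + (- p + q) + (p + (- r + s)) - (q + (- u + v)) + (w - u) - (x - r)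
    - (y + (- x + w)) + (y - T) = s - v.
Proof.
apply/malgP => t; rewrite !(mcoeffD, mcoeffN); ring.
Qed.

(** The mirror image, with the bracket of 1 and 2 on the right. *)
Lemma swap_second : ideal (iota 1 4)
  (relZ k [:: (1, (l 4 .* l 2) <*> (l 3 .* l 1)); (-1, (l 4 .* l 1) <*> (l 3 .* l 2))]).
Proof.
have E1 := @rel_plug 2 [:: 1; 2; 5]%N 5 [:: 1; 2]%N (l 3 .* l 4)
  [:: (1, (l 3 .* l 4) .* (l 1 <*> l 2)); (-1, l 1 <*> (l 3 .* l 4 .* l 2));
      (1, l 2 <*> (l 3 .* l 4 .* l 1))]
  isT isT erefl isT isT isT ltac:(by vm_compute).
have E2 := @rel_plug 0 [:: 3; 4; 5]%N 5 [:: 3; 4]%N (l 1 <*> l 2)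
  [:: (1, l 3 .* l 4 .* (l 1 <*> l 2)); (-1, l 3 .* (l 4 .* (l 1 <*> l 2)))]
  isT isT erefl isT isT isT ltac:(by vm_compute).
have E3 := @rel_ctx 2 [:: 1; 2; 4]%N 5 [:: 3]%N (l 3 .* l 5)
  [:: (1, l 3 .* (l 4 .* (l 1 <*> l 2))); (-1, l 3 .* (l 1 <*> (l 4 .* l 2)));
      (1, l 3 .* (l 2 <*> (l 4 .* l 1)))]
  isT isT erefl isT isT isT ltac:(by vm_compute).
have E4 := @rel_plug 2 [:: 1; 5; 3]%N 5 [:: 1; 3]%N (l 4 .* l 2)
  [:: (1, l 3 .* (l 1 <*> (l 4 .* l 2))); (-1, l 1 <*> (l 3 .* (l 4 .* l 2)));
      (1, (l 4 .* l 2) <*> (l 3 .* l 1))]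
  isT isT erefl isT isT isT ltac:(by vm_compute).
have E5 := @rel_plug 2 [:: 2; 5; 3]%N 5 [:: 2; 3]%N (l 4 .* l 1)
  [:: (1, l 3 .* (l 2 <*> (l 4 .* l 1))); (-1, l 2 <*> (l 3 .* (l 4 .* l 1)));
      (1, (l 4 .* l 1) <*> (l 3 .* l 2))]
  isT isT erefl isT isT isT ltac:(by vm_compute).
have E6 := @rel_ctx 0 [:: 3; 4; 2]%N 5 [:: 1]%N (l 1 <*> l 5)
  [:: (1, l 1 <*> (l 3 .* l 4 .* l 2)); (-1, l 1 <*> (l 3 .* (l 4 .* l 2)))]
  isT isT erefl isT isT isT ltac:(by vm_compute).
have E7 := @rel_ctx 0 [:: 3; 4; 1]%N 5 [:: 2]%N (l 2 <*> l 5)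
  [:: (1, l 2 <*> (l 3 .* l 4 .* l 1)); (-1, l 2 <*> (l 3 .* (l 4 .* l 1)))]
  isT isT erefl isT isT isT ltac:(by vm_compute).
have := idealD (idealB (idealB (idealD (idealB (idealD E3 E4) E5) E7) E6) E1) E2.
congr Defs.ideal; rewrite !relZ_cons !relZ_nil rmorphN1 rmorph1 !scale1r !scaleN1r !addr0.
exact: cancel_terms'.
Qed.

Hypothesis char0 : [pchar k] =i pred0.

Lemma two_neq0 : (2%:R : k) != 0.
Proof.
by have := char0 2; rewrite !inE /= => /negbT.
Qed.

(** The two exchanges turn the bracket of (1 2) and (3 4) into the bracket of
    (3 4) and (1 2), which is its opposite by antisymmetry. So it vanishes, as 2
    is invertible. *)
Lemma bracket_of_products : ideal (iota 1 4)
  (1 *: << (l 1 .* l 2) <*> (l 3 .* l 4) >>).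
Proof.
have rel4 (s : seq nat) r r' : ideal (iota 1 4) (relZ k r) ->
    perm_eq s (iota 1 4) ->
    [seq (ct.1, trelabel (unstd s) ct.2) | ct <- r] = r' ->
    ideal (iota 1 4) (relZ k r').
  move=> Ir ps <-.
  have e : map (unstd s) (iota 1 4) = s.
    by have := perm_size ps; case: (s) => [|a [|b [|c [|d [|e s']]]]].
  apply: (ideal_perm ps); rewrite -{1}e; apply: ideal_relabelZ => //.
  by rewrite e (perm_uniq ps) iota_uniq.
have A := @rel4 [:: 3; 1; 2; 4]%N _
  [:: (1, (l 1 .* l 2) <*> (l 3 .* l 4)); (-1, (l 3 .* l 2) <*> (l 1 .* l 4))]
  swap_first isT ltac:(by vm_compute).
have B := @rel4 [:: 4; 2; 1; 3]%N _
  [:: (1, (l 3 .* l 2) <*> (l 1 .* l 4)); (-1, (l 3 .* l 4) <*> (l 1 .* l 2))]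
  swap_second isT ltac:(by vm_compute).
have C : ideal (iota 1 4) (relZ k
    [:: (1, (l 1 .* l 2) <*> (l 3 .* l 4)); (1, (l 3 .* l 4) <*> (l 1 .* l 2))]).
  have S2 : ideal [:: 5; 6]%N (relZ k [:: (1, l 5 <*> l 6); (1, l 6 <*> l 5)]).
    have := @ideal_relabelZ (fun i => i + 4)%N (iota 1 2) _ isT
      (@ideal_syms2 k [:: (1, l 1 <*> l 2); (1, l 2 <*> l 1)] _).
    by apply; rewrite !inE eqxx ?orbT.
  have S3 : ideal [:: 6; 1; 2]%N (relZ k
      [:: (1, (l 1 .* l 2) <*> l 6); (1, l 6 <*> (l 1 .* l 2))]).
    by apply: (plugZ_eq (x := 5) (S := [:: 6]%N) (u := l 1 .* l 2) _ _ _ S2).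
  by apply: (plugZ_eq (x := 6) (S := [:: 1; 2]%N) (u := l 3 .* l 4) _ _ _ S3).
have := idealD (idealD A B) C.
move/(idealZ (2%:R^-1)); congr Defs.ideal.
rewrite !relZ_cons !relZ_nil rmorphN1 rmorph1 !scale1r !scaleN1r !addr0.
set x := << _ >>; set y := << _ >>; set z := << _ >>.
have -> : x - y + (y - z) + (x + z) = 2%:R *: x.
  by apply/malgP => t; rewrite !(mcoeffD, mcoeffN, mcoeffZ); ring.
by rewrite scalerA mulVf ?two_neq0 // scale1r.
Qed.

End Vanishing.

(** * Rewriting modulo the relations *)

Section Spanning.
Variable k : fieldType.
Hypothesis char0 : [pchar k] =i pred0.
Local Notation P := (Gerst_dual k).
Local Notation lin := (lin k gerst_gen).
Local Notation wf := (wf (P := P)).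
Local Notation eqop := (eqop P).
Local Notation ideal := (@ideal k P).

Definition good (t : gtree) := wf t && uniq (leaves t).

Lemma goodE t : good t = wf t && uniq (leaves t). Proof. by []. Qed.

(** Rewriting preserves labels and degree, so that the Koszul signs of a context
    are common factors. *)
Definition same (t u : gtree) :=
  [/\ wf u, perm_eq (leaves u) (leaves t) & tdeg ddeg u = tdeg ddeg t].

(** For spanning results the coefficients do not matter, only the trees that may
    occur. *)
Definition red (t : gtree) (Q : gtree -> Prop) :=
  exists r : seq (k * gtree),
    (forall p, p \in r -> Q p.2 /\ same t p.2) /\
    eqop (leaves t) << t >> (\sum_(p <- r) p.1 *: << p.2 >>).

Lemma same_trans t u v : same t u -> same u v -> same t v.
Proof.
move=> [_ p d] [w p' d']; split=> //; last by rewrite d'.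
exact: perm_trans p' p.
Qed.

Lemma same_good t u : good t -> same t u -> good u.
Proof. by move=> /andP[_ ut] [wu p _]; rewrite /good wu (perm_uniq p). Qed.

Lemma red_ret t (Q : gtree -> Prop) : wf t -> Q t -> red t Q.
Proof.
move=> wt Qt; exists [:: (1, t)]; split.
  by move=> p; rewrite inE => /eqP->.
by rewrite big_seq1 scale1r; apply: eqop_refl.
Qed.

Lemma red_weak t (Q R : gtree -> Prop) :
  (forall u, same t u -> Q u -> R u) -> red t Q -> red t R.
Proof.
move=> QR [r [Hr e]]; exists r; split=> // p /Hr[Qp sp]; split=> //.
exact: QR.
Qed.

Lemma red_bind t (Q R : gtree -> Prop) : red t Q ->
  (forall u, same t u -> Q u -> red u R) -> red t R.
Proof.
case=> r [Hr er] QR.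
pose r' := [seq (p, if pselect (p \in r) is left h
   then sval (cid (QR p.2 (proj2 (Hr p h)) (proj1 (Hr p h)))) else [::]) | p <- r].
exists (flatten [seq [seq (q.1.1 * x.1, x.2) | x <- q.2] | q <- r']); split.
  move=> y /flattenP[s /mapP[q /mapP[p pr ->] ->]] /mapP[x].
  case: pselect => //= h; case: cid => s' [/= Hs' _] /Hs'[Rx sx] -> /=.
  by split=> //; apply: same_trans sx; case: (Hr p pr).
apply: eqop_trans er _; rewrite big_flatten /= big_map big_map /=.
apply: eqop_sum_seq => p pr; case: pselect => // h.
case: cid => s [/= Hs es]; rewrite big_map /=.
have sp : same t p.2 by case: (Hr p pr).
have := eqop_perm (let: And3 _ p _ := sp in p) (eqopZ p.1 es).
rewrite scaler_sumr (eq_bigr (fun x => (p.1 * x.1) *: << x.2 >>)) // => x _.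
exact: scalerA.
Qed.

Lemma tdeg_tbind h (t : gtree) :
  tdeg ddeg (tbind h t) = tdeg ddeg t + \sum_(y <- leaves t) tdeg ddeg (h y).
Proof.
have tdn g ts : tdeg ddeg (Node g ts) = ddeg g + \sum_(u <- ts) tdeg ddeg u.
  rewrite /tdeg /= /wdeg big_cons; congr (_ + _).
  by elim: ts => [|u ts IH]; rewrite ?big_nil //= big_cat big_cons IH.
elim/tree_induction: t => [a|g ts IH] /=.
  by rewrite big_seq1 [X in _ = X + _]/tdeg /= /wdeg big_seq1 add0r.
rewrite !tdn -addrA; congr (_ + _); rewrite big_map big_flatten /= big_map -big_split.
by apply: eq_big_seq => t tts; apply: IH.
Qed.

Lemma leaves_subst n us (t : gtree) : size us = n ->
  perm_eq (leaves t) (iota 1 n) ->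
  perm_eq (leaves (tbind (fun y => nth (Leaf y) us y.-1) t))
    (flatten [seq leaves u | u <- us]).
Proof.
move=> sz pt; rewrite leaves_tbind.
apply: (@perm_trans _ (flatten [seq leaves (nth (Leaf a) us a.-1) | a <- iota 1 n])).
  by apply: perm_flatten; apply: perm_map.
rewrite (_ : [seq _ | a <- iota 1 n] = [seq leaves u | u <- us]) //.
apply: (@eq_from_nth _ [::]); rewrite !size_map size_iota // => i isz.
rewrite (nth_map 0%N) ?size_iota // (nth_map (Leaf 0)) ?sz // nth_iota // add1n /=.
by congr leaves; apply: set_nth_default; rewrite sz.
Qed.

Definition okrel n (r : seq (int * gtree)) : bool :=
  all (fun p => monomial (P := P) (iota 1 n) p.2 && (num_brackets p.2 == num_brackets (head (0, Leaf 0) r).2)) r.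

(** Division by the coefficient of its first tree turns a relation into a
    rewriting rule, valid with arbitrary trees at its inputs. *)
Lemma red_rel n c0 t0 r us : ideal (iota 1 n) (relZ k ((c0, t0) :: r)) ->
  c0 = 1 -> okrel n ((c0, t0) :: r) -> size us = n ->
  good (tbind (fun y => nth (Leaf y) us y.-1) t0) ->
  all (fun u => wf u) us ->
  red (tbind (fun y => nth (Leaf y) us y.-1) t0)
    (fun u => exists2 p, p \in r & u = tbind (fun y => nth (Leaf y) us y.-1) p.2).
Proof.
set sub := fun y => _ => Ir c01; move: Ir; rewrite {}c01 => Ir /allP ok sz /andP[wt ut] wus.
have mono p : p \in (1, t0) :: r -> monomial (P := P) (iota 1 n) p.2 /\ num_brackets p.2 = num_brackets t0.
  by move/ok => /andP[? /eqP].
have [m0 _] := mono (1, t0) (mem_head _ _).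
have l0 := leaves_subst sz (monomial_leaves m0).
have uus : uniq (flatten [seq leaves u | u <- us]) by rewrite -(perm_uniq l0).
have sum_us (t : gtree) : perm_eq (leaves t) (iota 1 n) ->
    \sum_(y <- leaves t) tdeg ddeg (sub y) = \sum_(y <- iota 1 n) tdeg ddeg (sub y).
  by move=> pt; apply: perm_big.
have wsub (t : gtree) : wf t -> perm_eq (leaves t) (iota 1 n) -> wf (tbind sub t).
  move=> w pt; apply: wf_tbind => // a; rewrite (perm_mem pt) mem_iota => /andP[a1 an].
  by apply: (allP wus); apply: mem_nth; rewrite sz; lia.
have := @ideal_subst k nat (iota 0 (size r).+1)
  (fun i => (nth (1, t0) ((1, t0) :: r) i).2) (fun i => (nth (1, t0) ((1, t0) :: r) i).1%:~R)
  us n sz wus uus.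
case=> [i||e [e0 _ Ie]].
- have : nth (1, t0) ((1, t0) :: r) i \in (1, t0) :: r.
    case: (ltnP i (size ((1, t0) :: r))) => isz; first exact: mem_nth.
    by rewrite nth_default ?mem_head.
  by move=> /mono[/monomial_leaves pl _] y; rewrite (perm_mem pl).
- move: Ir; rewrite /relZ; congr Defs.ideal.
  by rewrite (big_nth (1, t0)) /= /index_iota subn0.
move: Ie; rewrite /= big_cons /= mul1r => Ie.
pose r' := [seq (- ((e 0%N)^-1 * ((nth (1, t0) r i).1%:~R * e i.+1)),
    tbind sub (nth (1, t0) r i).2) | i <- iota 0 (size r)].
exists r'; split.
  move=> p /mapP[i]; rewrite mem_iota => /andP[_ isz] -> /=.
  have ir : nth (1, t0) r i \in r by apply: mem_nth.
  split; first by exists (nth (1, t0) r i).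
  have [mi vi] : monomial (P := P) (iota 1 n) (nth (1, t0) r i).2 /\ num_brackets (nth (1, t0) r i).2 = num_brackets t0.
    by apply: mono; rewrite inE ir orbT.
  split.
  - by apply: wsub; [exact: monomial_wf mi | exact: monomial_leaves mi].
  - rewrite (perm_trans (leaves_subst sz (monomial_leaves mi))) // perm_sym; exact: l0.
  - by rewrite !tdeg_tbind (sum_us _ (monomial_leaves mi)) (sum_us _ (monomial_leaves m0)) (tdeg_num_brackets (nth _ r i).2) vi -tdeg_num_brackets.
have {}Ie := ideal_perm (_ : perm_eq _ (leaves (tbind sub t0))) Ie.
have := idealZ (e 0%N)^-1 (Ie _); rewrite perm_sym => /(_ l0).
rewrite /Defs.eqop; congr Defs.ideal.
rewrite scalerDr scalerA mulVf // scale1r; congr (_ + _).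
rewrite /r' big_map scaler_sumr -sumrN (iotaDl 1 0) big_map; apply: eq_bigr => i _.
by rewrite /= scalerA -scaleNr opprK add0n add1n.
Qed.

End Spanning.

Section Normal.
Variable k : fieldType.
Hypothesis char0 : [pchar k] =i pred0.
Local Notation P := (Gerst_dual k).
Local Notation lin := (lin k gerst_gen).
Local Notation wf := (wf (P := P)).
Local Notation eqop := (eqop P).
Local Notation ideal := (@ideal k P).
Local Notation good := (good k).
Local Notation same := (same k).
Local Notation red := (@red k).

(** Rewriting inside a context. All terms have the degree of t, hence the same
    sign. *)
Lemma red_plug x (S : seq nat) C t (Q : gtree -> Prop) :
  monomial (P := P) (x :: S) C -> uniq (x :: S) -> uniq (S ++ leaves t) ->
  wf t -> red t Q ->
  red (plug x C t) (fun u => exists u', [/\ Q u', same t u' & u = plug x C u']).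
Proof.
move=> mC uxS uSt wt [r [Hr er]].
have [l1 [l2 [lC xl pl]]] := monomial_split uxS mC.
have lp (u : gtree) : perm_eq (leaves (plug x C u)) (S ++ leaves u).
  rewrite (leaves_plug _ lC xl) (perm_trans (y := (l1 ++ l2) ++ leaves u)) //.
    by rewrite -catA perm_cat2l perm_catC.
  by rewrite perm_cat2r.
have wp u : wf u -> wf (plug x C u).
  move=> wu; apply: wf_tbind; first exact: monomial_wf mC.
  by move=> a _; case: ifP.
have dp u : tdeg ddeg (plug x C u) = tdeg ddeg C + tdeg ddeg u.
  rewrite tdeg_tbind; congr (_ + _); rewrite (perm_big _ (monomial_leaves mC)) big_cons eqxx /=.
  rewrite big_seq big1 ?addr0 // => y yS; case: eqP => [yx|_].
    by move: uxS; rewrite /= -yx yS.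
  by rewrite /tdeg /= /wdeg big_seq1.
pose e := (-1 : k) ^ (tdeg ddeg t * deg_after ddeg x C).
exists [seq (p.1, plug x C p.2) | p <- r]; split.
  move=> _ /mapP[p /Hr[Qp sp] ->]; split; first by exists p.2.
  case: sp => wp2 pp dd; split; [exact: wp| |by rewrite !dp dd].
  rewrite (perm_trans (lp _)) // perm_sym (perm_trans (lp _)) //.
  by rewrite perm_cat2l perm_sym.
have I1 : ideal (leaves t) (\sum_(p <- (1, t) :: [seq (- p.1, p.2) | p <- r]) p.1 *: << p.2 >>).
  rewrite big_cons big_map scale1r; move: er; congr Defs.ideal; congr (_ + _).
  by rewrite -sumrN; apply: eq_bigr => p _; rewrite scaleNr.
have := ideal_ctx mC uxS uSt I1.
move/(idealZ e)/(ideal_perm (_ : perm_eq _ (leaves (plug x C t)))); rewrite perm_sym => /(_ (lp t)).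
rewrite /Defs.eqop; congr Defs.ideal.
rewrite scaler_sumr big_cons big_map /= -/e mul1r scalerA signz_sq scale1r; congr (_ + _).
rewrite big_map -sumrN; apply: eq_big_seq => p /Hr[_ [_ _ ->]] /=.
by rewrite -/e scalerA mulrC -mulrA signz_sq mulr1 scaleNr.
Qed.

Lemma wf2 g t1 t2 : wf (Node g [:: t1; t2]) = wf t1 && wf t2.
Proof. by rewrite /= andbT. Qed.

Lemma leaves2 g (t1 t2 : gtree) : leaves (Node g [:: t1; t2]) = leaves t1 ++ leaves t2.
Proof. by rewrite /= cats0. Qed.

Lemma good2 g t1 t2 : good (Node g [:: t1; t2]) -> good t1 /\ good t2.
Proof.
rewrite !goodE wf2 leaves2 cat_uniq => /andP[/andP[-> ->] /and3P[-> _ ->]].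
by [].
Qed.

Lemma good_wf t : good t -> wf t. Proof. by case/andP. Qed.
Hint Resolve good_wf : core.

Definition fresh (s : seq nat) : nat := (\max_(y <- s) y).+1.

Lemma fresh_notin s : fresh s \notin s.
Proof.
have le_max y : y \in s -> (y <= \max_(z <- s) z)%N.
  by move=> ys; apply: leq_bigmax_seq.
by apply/negP => /le_max; rewrite /fresh ltnn.
Qed.

Lemma red_ctxr g t1 t2 (Q : gtree -> Prop) : good (Node g [:: t1; t2]) -> red t2 Q ->
  red (Node g [:: t1; t2]) (fun u => exists u2, [/\ Q u2, same t2 u2 & u = Node g [:: t1; u2]]).
Proof.
move=> gt; have [g1 g2] := good2 gt; pose x := fresh (leaves t1).
have xt : x \notin leaves t1 by apply: fresh_notin.
have pE u : plug x (Node g [:: t1; Leaf x]) u = Node g [:: t1; u].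
  by rewrite /plug /= eqxx -/(plug x t1 u) plug_notin.
move/(red_plug (x := x) (S := leaves t1) (C := Node g [:: t1; Leaf x])); rewrite pE.
move=> H; apply: red_weak (H _ _ _ (good_wf _)) => //.
- by move=> u _ [u' [Q' s' ->]]; exists u'; rewrite pE.
- by apply/and3P; split; rewrite // ?wf2 ?leaves2 ?good_wf // perm_catC.
- by rewrite /= xt; case/andP: g1.
- by case/andP: gt => _; rewrite leaves2.
Qed.

Lemma red_ctxl g t1 t2 (Q : gtree -> Prop) : good (Node g [:: t1; t2]) -> red t1 Q ->
  red (Node g [:: t1; t2]) (fun u => exists u1, [/\ Q u1, same t1 u1 & u = Node g [:: u1; t2]]).
Proof.
move=> gt; have [g1 g2] := good2 gt; pose x := fresh (leaves t2).
have xt : x \notin leaves t2 by apply: fresh_notin.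
have pE u : plug x (Node g [:: Leaf x; t2]) u = Node g [:: u; t2].
  by rewrite /plug /= eqxx -/(plug x t2 u) plug_notin.
move/(red_plug (x := x) (S := leaves t2) (C := Node g [:: Leaf x; t2])); rewrite pE.
move=> H; apply: red_weak (H _ _ _ (good_wf _)) => //.
- by move=> u _ [u' [Q' s' ->]]; exists u'; rewrite pE.
- by apply/and3P; split; rewrite // ?wf2 ?leaves2 ?good_wf.
- by rewrite /= xt; case/andP: g2.
- by case/andP: gt => _; rewrite leaves2 uniq_catC.
Qed.

Local Notation R i := (nth [::] dualsZ i).

Lemma ok_dual i : okrel k 3 (R i).
Proof. case: i => [|[|[|[|[|i]]]]]; last (by rewrite nth_default); by vm_compute. Qed.

Lemma red_dual i c0 t0 r u v w : (i < 5)%N -> R i = (c0, t0) :: r -> c0 = 1 ->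
  okrel k 3 (R i) -> wf u -> wf v -> wf w ->
  good (tbind (fun y => nth (Leaf y) [:: u; v; w] y.-1) t0) ->
  red (tbind (fun y => nth (Leaf y) [:: u; v; w] y.-1) t0)
    (fun t => exists2 p, p \in r & t = tbind (fun y => nth (Leaf y) [:: u; v; w] y.-1) p.2).
Proof.
move=> i5 Ri c01 ok wu wv ww gt; apply: (@red_rel k 3 c0) => //.
- by rewrite -Ri; apply/ideal_dualsZ/mem_nth.
- by rewrite -Ri.
- by rewrite /= wu wv ww.
Qed.

Lemma red_assoc u v w : good (mu (mu u v) w) ->
  red (mu (mu u v) w) (eq (mu u (mu v w))).
Proof.
move=> gt; have [/good2[gu gv] gw] := good2 gt.
apply: red_weak (@red_dual 0 1 _ _ u v w isT erefl erefl (ok_dual _) (good_wf gu) (good_wf gv) (good_wf gw) gt) => //.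
by move=> t _ [p]; rewrite inE => /eqP-> ->.
Qed.

Lemma red_prodl u v w : good (mu (br u v) w) ->
  red (mu (br u v) w) (fun t => t = br u (mu v w) \/ t = br v (mu u w)).
Proof.
move=> gt; have [/good2[gu gv] gw] := good2 gt.
apply: red_weak (@red_dual 1 1 _ _ u v w isT erefl erefl (ok_dual _) (good_wf gu) (good_wf gv) (good_wf gw) gt) => //.
by move=> t _ [p]; rewrite !inE => /orP[] /eqP-> ->; [left|right].
Qed.

Lemma red_prodr u v w : good (mu w (br u v)) ->
  red (mu w (br u v)) (fun t => t = br u (mu w v) \/ t = br v (mu w u)).
Proof.
move=> gt; have [gw /good2[gu gv]] := good2 gt.
apply: red_weak (@red_dual 2 1 _ _ u v w isT erefl erefl (ok_dual _) (good_wf gu) (good_wf gv) (good_wf gw) gt) => //.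
by move=> t _ [p]; rewrite !inE => /orP[] /eqP-> ->; [left|right].
Qed.

Lemma red_exch u v w : good (br u (br v w)) ->
  red (br u (br v w)) (eq (br v (br u w))).
Proof.
move=> gt; have [gu /good2[gv gw]] := good2 gt.
apply: red_weak (@red_dual 3 1 _ _ u v w isT erefl erefl (ok_dual _) (good_wf gu) (good_wf gv) (good_wf gw) gt) => //.
by move=> t _ [p]; rewrite inE => /eqP-> ->.
Qed.

Lemma red_brA u v w : good (br (br u v) w) ->
  red (br (br u v) w) (eq (br u (br v w))).
Proof.
move=> gt; have [/good2[gu gv] gw] := good2 gt.
apply: red_weak (@red_dual 4 1 _ _ u v w isT erefl erefl (ok_dual _) (good_wf gu) (good_wf gv) (good_wf gw) gt) => //.
by move=> t _ [p]; rewrite inE => /eqP-> ->.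
Qed.

Lemma red_opp u v : good (Node g_opp [:: u; v]) ->
  red (Node g_opp [:: u; v]) (eq (mu v u)).
Proof.
move=> gt; have [gu gv] := good2 gt.
have ok : okrel k 2 ((1, Node g_opp [:: leafn 1; leafn 2]) :: [:: (1, mu (leafn 2) (leafn 1))]) by vm_compute.
have I0 : ideal (iota 1 2) (relZ k ((1, Node g_opp [:: leafn 1; leafn 2]) :: [:: (1, mu (leafn 2) (leafn 1))])).
  by apply: ideal_syms2; rewrite !inE eqxx.
have wus : all (fun u => wf u) [:: u; v] by rewrite /= !good_wf.
apply: red_weak (red_rel (us := [:: u; v]) I0 erefl ok erefl gt wus) => t _ [p].
by rewrite inE => /eqP-> ->.
Qed.

Lemma red_sym u v : good (br u v) -> red (br u v) (eq (br v u)).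
Proof.
move=> gt; have [gu gv] := good2 gt.
have ok : okrel k 2 ((1, br (leafn 1) (leafn 2)) :: [:: (1, br (leafn 2) (leafn 1))]) by vm_compute.
have I0 : ideal (iota 1 2) (relZ k ((1, br (leafn 1) (leafn 2)) :: [:: (1, br (leafn 2) (leafn 1))])).
  by apply: ideal_syms2; rewrite !inE eqxx orbT.
have wus : all (fun u => wf u) [:: u; v] by rewrite /= !good_wf.
apply: red_weak (red_rel (us := [:: u; v]) I0 erefl ok erefl gt wus) => t _ [p].
by rewrite inE => /eqP-> ->.
Qed.

Lemma red_zero a b c d : good (br (mu a b) (mu c d)) ->
  red (br (mu a b) (mu c d)) (fun=> False).
Proof.
move=> gt; have [/good2[ga gb] /good2[gc gd]] := good2 gt.
have ok : okrel k 4 ((1, br (mu (leafn 1) (leafn 2)) (mu (leafn 3) (leafn 4))) :: [::]) by vm_compute.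
have I0 : ideal (iota 1 4) (relZ k ((1, br (mu (leafn 1) (leafn 2)) (mu (leafn 3) (leafn 4))) :: [::])).
  by rewrite /relZ big_seq1; exact: bracket_of_products.
have wus : all (fun u => wf u) [:: a; b; c; d] by rewrite /= !good_wf.
apply: red_weak (red_rel (us := [:: a; b; c; d]) I0 erefl ok erefl gt wus) => t _ [p].
by rewrite in_nil.
Qed.

End Normal.

(** * Normal trees *)

Fixpoint right_comb (x : nat) (a : seq nat) : gtree :=
  if a is y :: a' then mu (Leaf x) (right_comb y a') else Leaf x.

(** The space labels s act by iterated brackets on the product of the planar
    labels x :: a. *)
Definition normal_tree (x : nat) (a s : seq nat) : gtree :=
  foldr (fun y t => br (Leaf y) t) (right_comb x a) s.

Fixpoint insert_label (y : nat) (s : seq nat) : seq nat :=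
  if s is z :: s' then if (y < z)%N then y :: s else z :: insert_label y s' else [:: y].

Definition sort_labels (s : seq nat) := foldr insert_label [::] s.

Lemma insert_label_perm y s : perm_eq (insert_label y s) (y :: s).
Proof.
elim: s => //= z s IH; case: ifP => // _.
apply: (perm_trans (y := z :: y :: s)); first by rewrite perm_cons.
by rewrite -(cat1s z) -(cat1s y) -[in X in perm_eq _ X](cat1s z) perm_catCA.
Qed.

Lemma sort_labels_perm s : perm_eq (sort_labels s) s.
Proof.
by elim: s => //= y s IH; rewrite (perm_trans (insert_label_perm _ _)) // perm_cons.
Qed.

Lemma insert_label_sorted y s : y \notin s -> sorted ltn s -> sorted ltn (insert_label y s).
Proof.
elim: s => //= z s IH; rewrite inE negb_or => /andP[yz ys] ps.
case: ifP => yltz /=; first by rewrite yltz.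
have zy : (z < y)%N by lia.
rewrite path_min_sorted ?IH // ?(path_sorted ps) //.
apply/allP => w; rewrite (perm_mem (insert_label_perm _ _)) inE => /orP[/eqP->//|].
by move=> ws; have /allP/(_ w ws) := order_path_min ltn_trans ps.
Qed.

Lemma sort_labels_sorted s : uniq s -> sorted ltn (sort_labels s).
Proof.
elim: s => //= y s IH /andP[ys us]; apply: insert_label_sorted; last exact: IH.
by rewrite (perm_mem (sort_labels_perm s)).
Qed.

(** When the product has the only factor x, this is one more space label, and it
    is required to be the largest one. *)
Definition is_normal (u : gtree) := exists x a s,
  [/\ u = normal_tree x a s, sorted ltn s & a = [::] -> all (fun y => y < x)%N s].

Lemma leaves_right_comb x a : leaves (right_comb x a) = x :: a.
Proof. by elim: a x => //= y a IH x; rewrite cats0 IH. Qed.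

Lemma leaves_normal_tree x a s : leaves (normal_tree x a s) = s ++ x :: a.
Proof. by elim: s => [|y s IH]; rewrite /= ?leaves_right_comb // cats0 -/(normal_tree x a s) IH. Qed.

Section Normal.
Variable k : fieldType.
Hypothesis char0 : [pchar k] =i pred0.
Local Notation P := (Gerst_dual k).
Local Notation wf := (wf (P := P)).
Local Notation good := (good k).
Local Notation same := (same k).
Local Notation red := (@red k).

Lemma wf_right_comb x a : wf (right_comb x a).
Proof. by elim: a x => //= y a IH x; rewrite IH. Qed.

Lemma wf_normal_tree x a s : wf (normal_tree x a s).
Proof. by elim: s => [|y s IH] /=; rewrite ?wf_right_comb // IH. Qed.

Lemma good_normal_tree x a s : good (normal_tree x a s) = uniq (s ++ x :: a).
Proof. by rewrite !goodE wf_normal_tree leaves_normal_tree. Qed.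

Lemma red_insert_label x a y s : good (br (Leaf y) (normal_tree x a s)) ->
  red (br (Leaf y) (normal_tree x a s)) (eq (normal_tree x a (insert_label y s))).
Proof.
elim: s => [|z s IH] /= gt; first by apply: red_ret => //; exact: good_wf gt.
case: ifP => _; first by apply: red_ret => //; exact: good_wf gt.
apply: red_bind (red_exch gt) _ => u su uE; subst u.
have gu := same_good gt su; have [_ gu2] := good2 gu.
apply: red_weak (red_ctxr gu (IH gu2)) => t _ [t2 [<- _ ->]].
by [].
Qed.

Lemma red_sort x a s : good (normal_tree x a s) -> red (normal_tree x a s) (eq (normal_tree x a (sort_labels s))).
Proof.
elim: s => [|y s IH] /= gt; first by apply: red_ret => //; exact: good_wf gt.
have [_ g2] := good2 gt.
apply: red_bind (red_ctxr gt (IH g2)) _ => u su [u2 [<- _ uE]]; subst u.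
exact: red_insert_label (same_good gt su).
Qed.

Lemma red_fold (s : seq nat) t (Q : gtree -> Prop) :
  good (foldr (fun y t => br (Leaf y) t) t s) -> red t Q ->
  red (foldr (fun y t => br (Leaf y) t) t s)
    (fun u => exists2 u', Q u' & u = foldr (fun y t => br (Leaf y) t) u' s).
Proof.
elim: s => [|y s IH] /= gt rt; first by apply: red_weak rt => u _ Qu; exists u.
have [_ g2] := good2 gt.
apply: red_weak (red_ctxr gt (IH g2 rt)) => u _ [u2 [[u' Qu' ->] _ ->]].
by exists u'.
Qed.

(** Sorting exchanges adjacent space labels; when x is not the largest label, it
    is exchanged with the innermost space label by antisymmetry. *)
Lemma red_normal_tree x a s : good (normal_tree x a s) -> red (normal_tree x a s) is_normal.
Proof.
move=> gt; apply: red_bind (red_sort gt) _ => u su uE; subst u.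
have gs := same_good gt su.
have ss : sorted ltn (sort_labels s).
  by apply: sort_labels_sorted; move: gt; rewrite good_normal_tree cat_uniq => /andP[].
case: a gt su gs => [|b a] gt su gs; last first.
  by apply: red_ret; [exact: wf_normal_tree | exists x, (b :: a), (sort_labels s)].
case: (boolP (all (fun y => y < x)%N (sort_labels s))) => [al|nal].
  by apply: red_ret; [exact: wf_normal_tree | exists x, [::], (sort_labels s)].
move: (sort_labels s) ss nal gs => r; case/lastP: r => [//|r m] ss nal gs {su gt}.
have [rm rs] : all (fun y => y < m)%N r /\ sorted ltn r.
  move: ss; rewrite -(rev_sorted (fun x y => ltn y x)) /= rev_rcons /= => ss.
  have := order_path_min (fun a b c (h1 : (a < b)%N) (h2 : (c < a)%N) => ltn_trans h2 h1) ss.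
  rewrite all_rev => ->; split=> //.
  by rewrite -(revK r) rev_sorted; exact: path_sorted ss.
have xr : x \notin rcons r m.
  move: gs; rewrite good_normal_tree cat_uniq /= => /and3P[_].
  by rewrite orbF.
have xm : (x < m)%N.
  rewrite ltnNge; apply: contra nal => mx.
  have {}mx : (m < x)%N.
    by rewrite ltn_neqAle mx andbT; apply: contraNneq xr => ->; rewrite mem_rcons mem_head.
  rewrite all_rcons mx; apply: sub_all rm => y ym; exact: ltn_trans ym mx.
have nfr y z : normal_tree y [::] (rcons r z) = foldr (fun y t => br (Leaf y) t) (br (Leaf z) (Leaf y)) r.
  by rewrite /normal_tree foldr_rcons.
have gmx : good (br (Leaf m) (Leaf x)).
  rewrite !goodE /=; move: gs; rewrite good_normal_tree cat_uniq => _.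
  by rewrite inE andbT; lia.
move: gs; rewrite nfr => gs.
apply: red_bind (red_fold gs (red_sym gmx)) _ => u su [_ <- uE].
have gu := same_good gs su; move: gu; rewrite uE -nfr => gu.
apply: red_weak (red_sort gu) => _ _ <-.
exists m, [::], (sort_labels (rcons r x)); split=> // [|_].
  by apply: sort_labels_sorted; move: gu; rewrite good_normal_tree cat_uniq => /andP[].
by rewrite (perm_all _ (sort_labels_perm _)) all_rcons xm.
Qed.

Lemma red_br_leaf y u : is_normal u -> good (br (Leaf y) u) -> red (br (Leaf y) u) is_normal.
Proof. by case=> x [a [s [-> _ _]]] gt; exact: (@red_normal_tree x a (y :: s)). Qed.

(** Brackets are moved to the right until both arguments are products of labels.
    Then one of them is a leaf, or the bracket vanishes. *)
Lemma red_br_normal_tree x a s v : is_normal v -> good (br (normal_tree x a s) v) ->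
  red (br (normal_tree x a s) v) is_normal.
Proof.
move=> nv; elim: s => [|y s IH] gt; last first.
  apply: red_bind (red_brA gt) _ => u su uE; subst u.
  have gu := same_good gt su; have [_ gu2] := good2 gu.
  apply: red_bind (red_ctxr gu (IH gu2)) _ => u su' [u2 [nu2 _ uE]]; subst u.
  exact: red_br_leaf (same_good gu su').
case: a gt => [|b a] gt; first exact: red_br_leaf.
case: nv gt => x2 [a2 [s2 [-> _ _]]].
elim: s2 => [|z s2 IH] gt; last first.
  apply: red_bind (red_exch gt) _ => u su uE; subst u.
  have gu := same_good gt su; have [_ gu2] := good2 gu.
  apply: red_bind (red_ctxr gu (IH gu2)) _ => u su' [u2 [nu2 _ uE]]; subst u.
  exact: red_br_leaf (same_good gu su').
case: a2 gt => [|b2 a2] gt; last first.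
  by apply: red_weak (red_zero char0 gt) => u _ [].
apply: red_bind (red_sym gt) _ => u su uE; subst u.
exact: (@red_normal_tree x (b :: a) [:: x2] (same_good gt su)).
Qed.

Lemma red_mu_leaf y u : is_normal u -> good (mu (Leaf y) u) -> red (mu (Leaf y) u) is_normal.
Proof.
case=> x [a [s [-> _ _]]]; elim: s => [|z s IH] gt.
  exact: (@red_normal_tree y (x :: a) [::] gt).
apply: red_bind (red_prodr gt) _ => u' su [] uE; subst u';
  have gu := same_good gt su; have [gu1 gu2] := good2 gu.
  apply: red_bind (red_ctxr gu (IH gu2)) _ => u' su' [u2 [nu2 _ uE]]; subst u'.
  exact: red_br_leaf (same_good gu su').
by apply: red_br_normal_tree gu; exists y, [:: z], [::].
Qed.

(** Brackets leave a product by the relations exchanging the two operations. *)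
Lemma red_mu_normal_tree x a s v : is_normal v -> good (mu (normal_tree x a s) v) ->
  red (mu (normal_tree x a s) v) is_normal.
Proof.
move=> nv; elim: s => [|z s IH] gt; last first.
  apply: red_bind (red_prodl gt) _ => u su [] uE; subst u;
    have gu := same_good gt su; have [gu1 gu2] := good2 gu.
    apply: red_bind (red_ctxr gu (IH gu2)) _ => u su' [u2 [nu2 _ uE]]; subst u.
    exact: red_br_leaf (same_good gu su').
  apply: red_bind (red_ctxr gu (red_mu_leaf nv gu2)) _ => u su' [u2 [nu2 _ uE]]; subst u.
  exact: red_br_normal_tree (same_good gu su').
elim: a x gt => [|b a IH] x gt; first exact: red_mu_leaf.
apply: red_bind (red_assoc gt) _ => u su uE; subst u.
have gu := same_good gt su; have [gu1 gu2] := good2 gu.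
apply: red_bind (red_ctxr gu (IH _ gu2)) _ => u su' [u2 [nu2 _ uE]]; subst u.
exact: red_mu_leaf (same_good gu su').
Qed.

(** Hence normal trees span the dual operad. *)
Theorem red_is_normal t : good t -> red t is_normal.
Proof.
elim/gtree_ind: t => [a _|g t1 t2 IH1 IH2 gt|g ts nts].
- by apply: red_ret => //; exists a, [::], [::].
- have [g1 g2] := good2 gt.
  apply: red_bind (red_ctxl gt (IH1 g1)) _ => u su [u1 [nu1 _ uE]]; subst u.
  have gu := same_good gt su; have [_ gu2] := good2 gu.
  apply: red_bind (red_ctxr gu (IH2 g2)) _ => u su' [u2 [nu2 _ uE]]; subst u.
  have {su' su} gu' := same_good gu su'.
  case: g gt gu gu' => [[]|[]] gt gu gu'.
  + apply: red_bind (red_opp gu') _ => u su uE; subst u.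
    have := same_good gu' su; case: nu2 => x [a [s [-> _ _]]]; exact: red_mu_normal_tree.
  + by move: gu'; case: nu1 => x [a [s [-> _ _]]]; exact: red_mu_normal_tree.
  + by move: gu'; case: nu1 => x [a [s [-> _ _]]]; exact: red_br_normal_tree.
- by rewrite !goodE /= (negPf nts).
Qed.

End Normal.

Lemma planar_word_right_comb A x a : planar_word A (right_comb x a) =
  if a is [::] then Some (if A x then [:: x] else [::])
  else if all A (x :: a) then Some (x :: a) else None.
Proof.
elim: a x => //= y a IH x; rewrite IH.
by case: (A x); case: a {IH} => [|z a] /=; case: (A y) => //=; case: ifP.
Qed.

Lemma planar_word_normal_tree_sub A x a s w : planar_word A (normal_tree x a s) = Some w ->
  (a != [::] -> w = x :: a) /\ (a = [::] -> (size w <= 1)%N).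
Proof.
elim: s w => [|y s IH] w /=.
  rewrite planar_word_right_comb; case: a => [|z a]; first by move=> [<-]; case: (A x).
  by case: ifP => // _ [<-].
case E: planar_word => [v|] //; have [I1 I2] := IH _ E.
case: (A y) => /=; last by move=> [<-].
case: v E I1 I2 => //= E I1 I2 [<-]; split=> // /I1.
by [].
Qed.

Lemma planar_word_normal_tree A x a s : planar_word A (right_comb x a) = Some [:: x & a] \/ a = [::] /\ ~~ A x ->
  all (fun y => ~~ A y) s ->
  planar_word A (normal_tree x a s) = planar_word A (right_comb x a).
Proof.
move=> H; elim: s => //= y s IH /andP[/negPf-> /IH->].
by case: H => [-> //|[-> /negPf]]; rewrite planar_word_right_comb => ->.
Qed.

(** * The basis of the dual operad *)

(** A word of one label is left out because its
    functional is proportional to the one of the empty word. *)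
Definition words (n : nat) : seq (seq nat) :=
  flatten [seq [seq [seq (val i).+1 | i <- a] | a : p.-tuple 'I_n <- enum {: p.-tuple 'I_n} & uniq a]
          | p <- [seq p <- iota 0 n.+1 | (2 <= p)%N]].

Lemma big_words (V : nmodType) n (F : seq nat -> V) :
  \sum_(p < n.+1 | (2 <= p)%N) \sum_(a : p.-tuple 'I_n | uniq a)
    F [seq (val i).+1 | i <- a] = \sum_(a <- words n) F a.
Proof.
rewrite /words big_flatten big_map big_filter -[iota 0 n.+1]/(index_iota 0 n.+1).
rewrite -(big_mkord (fun p => (2 <= p)%N) (fun p => \sum_(a : p.-tuple 'I_n | uniq a)
    F [seq (val i).+1 | i <- a])).
apply: eq_bigr => p _; rewrite big_map big_filter [RHS]big_enum_cond.
by apply: eq_bigl => a; rewrite inE.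
Qed.

Lemma mem_words n a : (a \in words n) =
  [&& (2 <= size a)%N, uniq a & all (fun x => x \in iota 1 n) a].
Proof.
have injS : injective (fun i : 'I_n => (val i).+1) by move=> i j [] /val_inj.
apply/flattenP/and3P => [[s /mapP[p]]|[sa ua alla]].
  rewrite mem_filter => /andP[p2 _] -> /mapP[b]; rewrite mem_filter => /andP[ub _] ->.
  split; rewrite ?size_map ?size_tuple ?map_inj_uniq //.
  by apply/allP => _ /mapP[i _ ->]; rewrite mem_iota /= add1n ltnS ltn_ord.
have san : (size a <= n)%N.
  by rewrite -(size_iota 1 n); apply: uniq_leq_size => // x xa; apply: (allP alla).
have [b ab] : exists b : seq 'I_n, a = [seq (val i).+1 | i <- b].
  elim: a alla {sa ua san} => [|x a IH] /=; first by exists [::].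
  rewrite mem_iota => /andP[/andP[x1 xn] /IH[b ->]].
  have xn' : (x.-1 < n)%N by lia.
  by exists (Ordinal xn' :: b) => /=; rewrite prednK.
have sb : size b == size a by rewrite ab size_map.
exists [seq [seq (val i).+1 | i <- c] | c : (size a).-tuple 'I_n <- enum {: (size a).-tuple 'I_n} & uniq c].
  apply/mapP; exists (size a) => //; by rewrite mem_filter sa mem_iota /= add0n ltnS san.

apply/mapP; exists (Tuple sb); last by rewrite -ab.
by rewrite mem_filter mem_enum andbT /= -(map_inj_uniq injS) -ab.
Qed.

Lemma uniq_words n : uniq (words n).
Proof.
have injS : injective (fun i : 'I_n => (val i).+1) by move=> i j [] /val_inj.
rewrite /words; elim: [seq p <- _ | _] (filter_uniq (fun p => 2 <= p)%N (iota_uniq 0 n.+1)).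
  by [].
move=> p ps IH /= /andP[pps ups]; rewrite cat_uniq IH // andbT; apply/andP; split.
  rewrite map_inj_uniq; first by apply: filter_uniq; apply: enum_uniq.
  by move=> a b /(inj_map injS)/val_inj.
apply/hasP => -[a /flattenP[s /mapP[q qps ->]] /mapP[b _ ab]] /mapP[c _ ac].
have : size a = p by rewrite ac size_map size_tuple.
by rewrite ab size_map size_tuple => qp; rewrite -qp qps in pps.
Qed.

Definition words0 n := [::] :: words n.

Lemma uniq_words0 n : uniq (words0 n).
Proof. by rewrite /words0 /= mem_words uniq_words. Qed.

Definition word_tree (n : nat) (a : seq nat) : gtree :=
  if a is x :: a' then normal_tree x a' [seq s <- iota 1 n | s \notin a]
  else normal_tree n [::] (iota 1 n.-1).

Lemma iota_rcons n : iota 1 n.+1 = iota 1 n ++ [:: n.+1].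
Proof. by rewrite -{1}(addn1 n) iotaD add1n. Qed.

Section Basis.
Variable k : fieldType.
Local Notation chi := (@chi k).
Local Notation P := (Gerst_dual k).
Local Notation wf := (wf (P := P)).

Lemma leaves_word_tree n a : (0 < n)%N -> a \in words0 n ->
  perm_eq (leaves (word_tree n a)) (iota 1 n).
Proof.
move=> n0; rewrite inE; case: a => [_|x a /=].
  rewrite /word_tree leaves_normal_tree; case: n n0 => // n _.
  by rewrite iota_rcons.
rewrite mem_words => /and3P[_ ua /allP al]; rewrite leaves_normal_tree.
rewrite perm_sym -(perm_filterC (fun s => s \notin x :: a)) perm_cat2l.
apply: uniq_perm; rewrite ?filter_uniq ?iota_uniq // => y.
rewrite mem_filter /= negbK; case ya: (y \in x :: a) => //=.
exact: al.
Qed.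

(** Together with the next lemmas: normal trees and functionals of words are dual
    bases, up to signs. *)
Lemma chi_word_tree n a b : a \in words0 n -> b \in words0 n ->
  chi b (word_tree n a) != 0 -> b = a.
Proof.
move=> aw bw /chi_word; case: a aw => [|x a] aw /planar_word_normal_tree_sub [H1 H2].
  move: bw (H2 erefl); rewrite inE mem_words => /orP[/eqP //|/and3P[b2 _ _]].
  by rewrite leqNgt b2.
case: a aw H1 H2 => [|y a] aw H1 _; last by rewrite H1.
by move: aw; rewrite inE mem_words.
Qed.

Lemma planar_word_word_tree n a : a \in words0 n -> planar_word (mem a) (word_tree n a) = Some a.
Proof.
rewrite inE mem_words => /orP[/eqP->|].
  by rewrite /word_tree planar_word_normal_tree ?planar_word_right_comb //; [right | apply/allP].
case: a => [//|x [//|y a]] /and3P[_ ua al]; rewrite /word_tree.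
have e : planar_word (mem [:: x, y & a]) (right_comb x (y :: a)) = Some [:: x, y & a].
  rewrite planar_word_right_comb; case: ifP => // /negbT /allPn[z zin]; by rewrite app_mem zin.
rewrite planar_word_normal_tree ?e //; first by left.
by apply/allP => z; rewrite mem_filter => /andP[].
Qed.

Lemma chi_word_tree_sq n a : a \in words0 n -> chi a (word_tree n a) * chi a (word_tree n a) = 1.
Proof. by move=> aw; rewrite /chi planar_word_word_tree // eqxx signMsign. Qed.

Lemma is_normal_word_tree n u : is_normal u -> perm_eq (leaves u) (iota 1 n) -> (0 < n)%N ->
  exists2 a, a \in words0 n & u = word_tree n a.
Proof.
move=> [x [a [s [-> ss sx]]]]; rewrite leaves_normal_tree => pl n0.
have ul : uniq (s ++ x :: a) by rewrite (perm_uniq pl) iota_uniq.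
case: a pl ul sx => [|y a] pl ul sx.
  exists [::] => //; rewrite /word_tree; have {sx} sx := sx erefl.
  have e : rcons s x = iota 1 n.
    apply: (irr_sorted_eq ltn_trans ltnn); rewrite ?iota_ltn_sorted //.
      by rewrite -(rev_sorted (fun x y => ltn y x)) /= rev_rcons /= path_min_sorted ?rev_sorted // all_rev.
    by move=> y; rewrite -(perm_mem pl) -cats1.
  case: n n0 e {pl} => // n _; rewrite iota_rcons cats1.
  by move/rcons_inj => [-> ->].
exists [:: x, y & a].
  rewrite inE mem_words; apply/orP; right; apply/and3P; split=> //.
    by move: ul; rewrite cat_uniq => /and3P[].
  by apply/allP => z za; rewrite -(perm_mem pl) mem_cat za orbT.
rewrite /word_tree; congr normal_tree; apply: (irr_sorted_eq ltn_trans ltnn) => //.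
  by apply: sorted_filter; [exact: ltn_trans | exact: iota_ltn_sorted].
move=> z; rewrite mem_filter -(perm_mem pl) mem_cat.
case zs: (z \in s); last by rewrite /= andNb.
move: ul; rewrite cat_uniq => /and3P[_ /hasPn H _].
by rewrite andbT; apply/esym; apply: contraTN zs => /H.
Qed.

Lemma chi_degree a t : chi a t != 0 -> uniq (leaves t) ->
  tdeg ddeg t = (size (leaves t))%:Z - (size a)%:Z - (a == [::])%:Z.
Proof.
move=> /chi_word wt ut; rewrite -(num_zeros_spell (mem a)).
have c := planar_word_count wt; have p := perm_size (planar_word_perm wt).
have s : size (leaves t) = (size [seq x <- leaves t | (mem a) x] + num_pos (spelling (mem a) t))%N.
  have -> : num_pos (spelling (mem a) t) = size [seq x <- leaves t | ~~ (mem a) x].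
    rewrite -(size_map succn) -(pos_spelling (mem a) t) size_filter //.
  by rewrite !size_filter count_predC.
rewrite s -p; have -> : (a == [::]) = nilp a by case: (a).
rewrite -c !PoszD; ring.
Qed.

(** A normal tree has one bracket for each space label, except that without planar
    labels the last label needs none. *)
Definition wdegree (n : nat) (a : seq nat) : int :=
  (size a)%:Z + (a == [::])%:Z - n%:Z.

Definition chin n a (t : gtree) : k :=
  if monomial (P := P) (iota 1 n) t then chi a t else 0.

Lemma chin_mono n a t : monomial (P := P) (iota 1 n) t -> chin n a t = chi a t.
Proof. by rewrite /chin => ->. Qed.

Lemma word_cogen_supp (z : k) n a (t : gtree) : z * chin n a t != 0 ->
  monomial (P := P) (iota 1 n) t /\ tdeg (gdeg P) t = - wdegree n a.
Proof.
rewrite /chin; case: ifP => [mt|_]; last by rewrite mulr0 eqxx.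
rewrite mulf_eq0 negb_or => /andP[_ nz]; split=> //.
have pl := monomial_leaves mt.
rewrite -[LHS]/(tdeg ddeg t) (chi_degree nz) ?(perm_uniq pl) ?iota_uniq //.
by rewrite (perm_size pl) size_iota /wdegree; lia.
Qed.

Lemma word_cogen_ideal (z : k) n a f : ideal (P := P) (iota 1 n) f ->
  linext (fun t => z * chin n a t : k^o) f = 0.
Proof.
move=> If; have := Chi_ideal If (iota_uniq 1 n) a.
rewrite /linext => H; transitivity (z * linext (chi a : _ -> k^o) f); last first.
  by rewrite /linext H mulr0.
rewrite /linext mulr_sumr; apply: eq_big_seq => t tf.
rewrite chin_mono; last exact: (ideal_in_free If).
by rewrite /GRing.scale /= mulrCA.
Qed.

Definition word_cogen (z : k) n a : cogen P :=
  @Cogen k P n (wdegree n a) _ (@word_cogen_supp z n a) (@word_cogen_ideal z n a).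

End Basis.

Section Expansion.
Variable k : fieldType.
Hypothesis char0 : [pchar k] =i pred0.
Local Notation chi := (@chi k).
Local Notation P := (Gerst_dual k).

(** Trees reduce to normal trees, on which the functionals of words are dual to
    the values of phi. *)
Lemma cogen_expand (phi : cogen P) t :
  phi t = \sum_(a <- words0 (carity phi))
    (phi (word_tree (carity phi) a) * chi a (word_tree (carity phi) a)) * chin k (carity phi) a t.
Proof.
set n := carity phi.
case: (boolP (monomial (P := P) (iota 1 n) t)) => mt; last first.
  rewrite big1 => [|a _]; last by rewrite /chin (negPf mt) mulr0.
  by apply/eqP; apply: contraNT mt => /cfun_supp [].
have n0 : (0 < n)%N.
  have := perm_size (monomial_leaves mt); rewrite size_iota => <-.
  exact: nleaves_gt0 (monomial_wf mt).
have gt : good k t.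
  by rewrite /good (monomial_wf mt) (perm_uniq (monomial_leaves mt)) iota_uniq.
have [r [Hr er]] := red_is_normal char0 gt.
have Ie : ideal (P := P) (iota 1 n) (<< t >> - \sum_(p <- r) p.1 *: << p.2 >>).
  exact: ideal_perm (monomial_leaves mt) er.
have ev (F : gtree -> k^o) : linext F (<< t >> - \sum_(p <- r) p.1 *: << p.2 >>) = 0 ->
    F t = \sum_(p <- r) p.1 * F p.2.
  rewrite linearB => /subr0_eq H; rewrite linear_sum in H.
  rewrite -[LHS](linextU1 F t); apply: etrans H _; apply: eq_bigr => p _.
  by rewrite linearZ /=; congr (_ * _); apply: linextU1.
have phi_r := ev _ (cfun_ideal Ie).
have chi_r a := ev _ (Chi_ideal Ie (iota_uniq 1 n) a).
have Wr p : p \in r -> exists2 a, a \in words0 n & p.2 = word_tree n a.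
  move=> /Hr[np [_ pp _]]; apply: is_normal_word_tree => //.
  exact: perm_trans pp (monomial_leaves mt).
rewrite phi_r; under [RHS]eq_bigr do rewrite chin_mono // chi_r mulr_sumr.
rewrite exchange_big; apply: eq_big_seq => p /Wr[a aw ->].
rewrite (bigD1_seq a) ?uniq_words0 //= big_seq_cond big1 => [|b /andP[bw ba]]; last first.
  case: (eqVneq (chi b (word_tree n a)) 0) => [->|]; first by rewrite !mulr0.
  by move/(chi_word_tree aw bw) => e; rewrite e eqxx in ba.
have := chi_word_tree_sq k aw; set c := chi a _ => cc.
rewrite addr0 [RHS](_ : _ = p.1 * phi (word_tree n a) * (c * c)); last by ring.
by rewrite cc mulr1.
Qed.

End Expansion.

(** * Corollas of the cobar construction *)

Lemma index_map_in (f : nat -> nat) s x : {in s &, injective f} -> x \in s ->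
  index (f x) (map f s) = index x s.
Proof.
elim: s => //= y s IH inj; rewrite inE; case: eqP => [->|/eqP xy] xs.
  by rewrite !eqxx.
rewrite /= in xs; case: eqP => [e|_].
  by rewrite -(inj _ _ (mem_head _ _) _ e) ?inE ?xs ?orbT // eqxx in xy.
rewrite eq_sym (negPf xy) IH // => a b as_ bs; apply: inj; rewrite inE ?as_ ?bs orbT //.
Qed.

Section Corollas.
Variables (k : fieldType) (P : presentation k).
Local Notation C := (cobar P).
Local Notation ctree := (tree (cogen P)).
Local Notation clin := (lin k (cogen P)).
Local Notation cor phi s := (<< Node phi (lf s) >> : clin).

Lemma monomial_cor (phi : cogen P) n s : carity phi = n -> perm_eq s (iota 1 n) ->
  monomial (P := C) (iota 1 n) (Node phi (lf s)).
Proof.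
move=> cn ps; apply/and3P; split=> //=.
  rewrite size_map (perm_size ps) size_iota -cn eqxx /=.
  by apply/allP => _ /mapP[a _ ->].
by rewrite -map_comp (_ : flatten _ = s) //; elim: s {ps} => //= a s ->.
Qed.

Lemma linext_sumF (I : Type) (r : seq I) (c : I -> k) (F : I -> tree (gen P) -> k) (f : lin k (gen P)) :
  linext (fun t => \sum_(i <- r) c i * F i t : k^o) f =
  \sum_(i <- r) c i * linext (F i : _ -> k^o) f.
Proof.
rewrite /linext; under [RHS]eq_bigr do rewrite mulr_sumr.
rewrite exchange_big; apply: eq_bigr => t _; rewrite scaler_sumr.
by apply: eq_bigr => i _; rewrite /GRing.scale /= mulrCA.
Qed.

Section Sum.
Variables (I : eqType) (n : nat) (d : int) (c : I -> k) (psi : I -> cogen P).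
Hypothesis ar : forall i, c i != 0 -> carity (psi i) = n.
Hypothesis dg : forall i, c i != 0 -> cdeg (psi i) = d.

Lemma sum_supp (r : seq I) t : \sum_(i <- r) c i * psi i t != 0 ->
  monomial (iota 1 n) t /\ tdeg (gdeg P) t = - d.
Proof.
move=> nz; suff [i ir] : exists2 i, i \in r & c i * psi i t != 0.
  by rewrite mulf_eq0 negb_or => /andP[ci /cfun_supp]; rewrite ar // dg.
elim: r nz => [|i r IH]; first by rewrite big_nil eqxx.
rewrite big_cons; case: (eqVneq (c i * psi i t) 0) => [->|nz _].
  by rewrite add0r => /IH[j jr nz]; exists j => //; rewrite inE jr orbT.
by exists i; rewrite ?mem_head.
Qed.

Lemma sum_ideal (r : seq I) f : ideal (iota 1 n) f ->
  linext (fun t => \sum_(i <- r) c i * psi i t : k^o) f = 0.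
Proof.
move=> If; rewrite (linext_sumF r c (fun i => psi i)); apply: big1 => i _.
case: (eqVneq (c i) 0) => [->|ci]; first by rewrite mul0r.
by rewrite cfun_ideal ?mulr0 // ar.
Qed.

Definition sum_cogen (r : seq I) : cogen P := @Cogen k P n d _ (@sum_supp r) (@sum_ideal r).

Lemma cor_sum_cogen (r : seq I) :
  eqop C (iota 1 n) (cor (sum_cogen r) (iota 1 n))
    (\sum_(i <- r) c i *: cor (psi i) (iota 1 n)).
Proof.
have lin_rel a (phi ps ch : cogen P) : carity phi = n -> carity ps = n -> carity ch = n ->
    cdeg phi = cdeg ch -> cdeg ps = cdeg ch -> (forall t, ch t = a * phi t + ps t) ->
    ideal (P := C) (iota 1 n) (cor ch (iota 1 n) - a *: cor phi (iota 1 n) - cor ps (iota 1 n)).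
  move=> a1 a2 a3 d1 d2 E; apply: ideal_rel; first exact: cobar_linear.
  have U x : carity x = n -> in_free (P := C) (iota 1 n) (cor x (iota 1 n)).
    by move=> ax; apply/in_freeU/monomial_cor.
  rewrite -addrA; apply: in_freeD; first exact: U.
  apply: in_freeD; rewrite -?scaleN1r; last by apply/in_freeZ/U.
  by do 2!apply: in_freeZ; apply: U.
elim: r => [|i r IH].
  rewrite big_nil; have := @lin_rel (-1) (sum_cogen [::]) (sum_cogen [::]) (sum_cogen [::]).
  rewrite scaleN1r opprK addrK /eqop subr0; apply=> // t.
  by rewrite /= big_nil mulr0 addr0.
rewrite big_cons; case: (eqVneq (c i) 0) => [ci0|ci].
  rewrite ci0 scale0r add0r; apply: eqop_trans IH.
  have := @lin_rel 0 (sum_cogen r) (sum_cogen r) (sum_cogen (i :: r)).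
  rewrite scale0r subr0; apply=> // t.
  by rewrite /= big_cons ci0 !mul0r.
apply: (@eqop_trans _ C _ (c i *: cor (psi i) (iota 1 n) + cor (sum_cogen r) (iota 1 n))); last first.
  by apply: eqopD => //; apply: eqop_refl.
have := @lin_rel (c i) (psi i) (sum_cogen r) (sum_cogen (i :: r)).
rewrite -addrA -opprD; apply=> //; rewrite ?ar ?dg // => t.
by rewrite /= big_cons.
Qed.

(** The linearity relations involve two functionals at a time. Terms with
    coefficient 0 are exempt from the conditions on arity and degree, as these
    fail for words that do not occur in phi. *)
Lemma corolla_sum (r : seq I) (phi : cogen P) : carity phi = n -> cdeg phi = d ->
  (forall t, phi t = \sum_(i <- r) c i * psi i t) ->
  eqop C (iota 1 n) (cor phi (iota 1 n)) (\sum_(i <- r) c i *: cor (psi i) (iota 1 n)).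
Proof.
move=> an dn E; apply: eqop_trans (cor_sum_cogen r).
have I0 : ideal (P := C) (iota 1 n) (cor phi (iota 1 n) - 0 *: cor phi (iota 1 n) -
    cor (sum_cogen r) (iota 1 n)).
  apply: ideal_rel.
    apply: cobar_linear; [by split | by [] | by [] |] => t.
    by rewrite mul0r add0r E.
  rewrite scale0r subr0; apply: in_freeD; first exact/in_freeU/monomial_cor.
  by rewrite -scaleN1r; apply/in_freeZ/in_freeU/monomial_cor.
by move: I0; rewrite scale0r subr0.
Qed.

End Sum.

Lemma corolla_perm n (phi psi : cogen P) (s : seq nat) :
  carity phi = n -> carity psi = n -> cdeg phi = cdeg psi -> perm_eq s (iota 1 n) ->
  (forall t, psi t = phi (trelabel (std s) t)) ->
  eqop C (iota 1 n) (cor phi s) ((-1) ^+ inversions s *: cor psi (iota 1 n)).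
Proof.
move=> an bn dd ps E; apply: ideal_rel; first exact: cobar_equivariant.
apply: in_freeD; first exact/in_freeU/monomial_cor.
rewrite -scaleN1r; do 2![apply: in_freeZ]; exact/in_freeU/monomial_cor.
Qed.

(** ** Linear independence of corollas *)

Definition is_lf (ts : seq ctree) : bool := all (fun t => if t is Leaf _ then true else false) ts.
Definition unlf (ts : seq ctree) : seq nat := [seq (if t is Leaf a then a else 0%N) | t <- ts].

Lemma unlfK s : unlf (lf s) = s.
Proof. by rewrite /unlf /lf -map_comp -[RHS]map_id; apply: eq_map. Qed.

Lemma is_lf_lf s : is_lf (lf s).
Proof. by apply/allP => _ /mapP[a _ ->]. Qed.

Lemma is_lfP ts : is_lf ts -> ts = lf (unlf ts).
Proof. by elim: ts => //= -[a|//] ts IH /= /IH {1}->. Qed.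

(** Reads off the value at t of the functional of a corolla, and ignores larger
    trees. This detects the linear independence of corollas. *)
Definition corolla_value (S0 : seq nat) (t : tree (gen P)) (w : ctree) : k :=
  if w is Node phi ts then
    if is_lf ts then
      (-1) ^+ inversions (map (index^~ S0) (unlf ts)) * phi (trelabel (std (unlf ts)) t)
    else 0
  else 0.

Lemma corolla_value_cor S0 t phi s : corolla_value S0 t (Node phi (lf s)) =
  (-1) ^+ inversions (map (index^~ S0) s) * phi (trelabel (std s) t).
Proof. by rewrite /corolla_value is_lf_lf unlfK. Qed.


Lemma leaves_cor (phi : cogen P) s : leaves (Node phi (lf s)) = s.
Proof. by rewrite /= -map_comp; elim: s => //= a s ->. Qed.

Lemma corolla_value_plug S0 t x S (f g : ctree) : uniq (x :: S) ->
  monomial (P := C) (x :: S) f -> (if g is Leaf _ then false else true) ->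
  corolla_value S0 t (plug x f g) = 0.
Proof.
move=> uxS mf ng; case: f mf => [a|phi ts] // /and3P[_ _ pl].
rewrite /plug /=; case: ifP => // lfs.
have xin : x \in leaves (Node phi ts) by rewrite (perm_mem pl) mem_head.
move: xin => /= /flattenP[_ /mapP[u uts ->] xu].
have := allP lfs (tbind (fun a => if a == x then g else Leaf a) u) (map_f _ uts).
case: u {uts} xu => //= a; rewrite inE => /eqP <-; rewrite eqxx.
by move: ng; case: (g).
Qed.

Lemma std_iota n a : a \in iota 1 n -> std (iota 1 n) a = a.
Proof.
rewrite mem_iota /std => /andP[a1 an].
have -> : index a (iota 1 n) = a.-1.
  rewrite -{1}[a](_ : nth 0%N (iota 1 n) a.-1 = a); last by rewrite nth_iota; lia.
  by rewrite index_uniq ?iota_uniq // size_iota; lia.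
by rewrite prednK.
Qed.

(** Evaluation respects linearity and equivariance, and a composite is never a
    corolla. *)
Theorem corolla_value_ideal S (f : clin) : ideal (P := C) S f -> uniq S ->
  forall S0 t, perm_eq S0 S -> {subset leaves t <= S0} ->
  linext (corolla_value S0 t : _ -> k^o) f = 0.
Proof.
elim=> {S f} [n r rn fr|S|S c f g _ IHf _ IHg|S S' f SS' _ IH|S h f uhS If IH|
     x S S' f g uxS uSS' If _ Sg|x S S' f g uxS uSS' Sf If _] uS S0 t pS tS.
- case: rn fr uS pS => [n0 a phi psi ch [an bn cn] d1 d2 E|n0 phi psi s an bn dd ps E] _ uS pS.
    rewrite !linearB linearZ /= !linextU1 !corolla_value_cor E mulrDr.
    by rewrite /GRing.scale /= mulrCA; ring.
  rewrite linearB linearZ /= !linextU1 !corolla_value_cor E trelabel_comp.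
  have -> : trelabel (std s \o std (iota 1 n0)) t = trelabel (std s) t.
    by apply: eq_trelabel => a /tS aS /=; rewrite std_iota // -(perm_mem pS).
  rewrite /GRing.scale /= mulrA -mulrBl -exprD.
  have inj : {in s &, injective (index^~ S0)}.
    move=> a b as_ bs e; have [aS bS] : a \in S0 /\ b \in S0.
      by rewrite !(perm_mem pS) -!(perm_mem ps).
    by rewrite -(nth_index 0%N aS) e nth_index.
  have := odd_inversions_map ps inj.
  rewrite (inversions_sorted (iota_ltn_sorted 1 n0)) addbF => e.
  rewrite (@sign_eq k _ (inversions s + inversions [seq index^~ S0 i | i <- iota 1 n0])) ?subrr ?mul0r //.
  by rewrite oddD -e addbCA addbb addbF.
- by rewrite linear0.
- by rewrite linearP /= IHf // IHg // scaler0 addr0.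
- apply: IH => //; first by rewrite (perm_uniq SS').
  by rewrite (perm_trans pS) // perm_sym.
- have uS' : uniq S by apply: map_uniq uhS.
  have injh := uniq_map_inj uhS.
  pose hi b := nth 0%N S (index b (map h S)).
  have hiK a : a \in S -> hi (h a) = a.
    by move=> aS; rewrite /hi index_map_in // nth_index.
  have injhi : {in S0 &, injective hi}.
    move=> a b; rewrite !(perm_mem pS) => /mapP[a' a'S ->] /mapP[b' b'S ->].
    by rewrite !hiK // => ->.
  have pS1 : perm_eq (map hi S0) S.
    rewrite (perm_trans (perm_map hi pS)) // -map_comp.
    by rewrite (_ : map _ _ = S) // -[RHS]map_id; apply/eq_in_map => a /hiK.
  rewrite /relabel (linext_comp (linext (corolla_value S0 t : _ -> k^o))).
  rewrite -(IH uS' (map hi S0) (trelabel hi t)) //; last first.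
    by rewrite leaves_trelabel => _ /mapP[b /tS bS ->]; apply: map_f.
  apply: eq_linext_supp => w /(ideal_in_free If) mw; apply: etrans (linextU1 _ _) _.
  case: w mw => // phi ts /and3P[_ _ pl]; rewrite /trelabel /=.
  have -> : is_lf [seq tbind (fun a => Leaf (h a)) u | u <- ts] = is_lf ts.
    by rewrite /is_lf all_map; apply: eq_all => -[].
  case: ifP => // /is_lfP tsE; move: pl; rewrite tsE leaves_cor unlfK => ps.
  have -> : unlf [seq tbind (fun a => Leaf (h a)) u | u <- lf (unlf ts)] = map h (unlf ts).
    by rewrite /unlf /lf -!map_comp.
  move: (unlf ts) ps => s ps {tsE}; congr (_ * _).
    congr (_ ^+ inversions _); rewrite -map_comp; apply/eq_in_map => a /=.
    rewrite (perm_mem ps) => aS; rewrite -{2}(hiK a aS) index_map_in // (perm_mem pS).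
    exact: map_f.
  congr (phi _); rewrite -!/(trelabel _ _) trelabel_comp; apply: eq_trelabel => b /tS.
  rewrite (perm_mem pS) => /mapP[a aS ->] /=; rewrite hiK // /std index_map_in //.
    by move=> x y; rewrite !(perm_mem ps); apply: injh.
  by rewrite (perm_mem ps).
- have -> := @graftE k (cogen P) (gdeg C) x f g; rewrite linear_sum big_seq big1 // => u uf; rewrite linear_sum big_seq big1 // => v vg.
  rewrite linearZ /= linextU1 (corolla_value_plug _ _ uxS) ?scaler0 //.
    exact: (ideal_in_free If).
  by have := Sg _ vg; case: v vg.
- have -> := @graftE k (cogen P) (gdeg C) x f g; rewrite linear_sum big_seq big1 // => u uf; rewrite linear_sum big_seq big1 // => v vg.
  rewrite linearZ /= linextU1 (corolla_value_plug _ _ uxS) ?scaler0 //.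
    exact: Sf.
  by have := ideal_in_free If vg; case: v vg.
Qed.

End Corollas.

(** * Components of the differential *)

Lemma map_unstd S : map (unstd S) (iota 1 (size S)) = S.
Proof.
apply: (@eq_from_nth _ 0%N); rewrite size_map size_iota // => i isz.
by rewrite (nth_map 0%N) ?size_iota // nth_iota.
Qed.

Lemma std_unstd S i : uniq S -> i \in iota 1 (size S) -> std S (unstd S i) = i.
Proof.
move=> uS; rewrite mem_iota /std /unstd => /andP[i1 isz].
by rewrite index_uniq //; lia.
Qed.

Lemma sorted_enum_ord n (I : {set 'I_n}) : sorted ltn [seq val i | i <- enum I].
Proof.
have -> : [seq val i | i <- enum I] = [seq x <- iota 0 n | x \in [seq val i | i <- enum I]].
  rewrite -val_enum_ord filter_map /preim /=; congr map.
  rewrite {1}/enum_mem -enumT; apply: eq_filter => i /=.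
  by rewrite mem_map ?mem_enum //; exact: val_inj.
apply: sorted_filter; [exact: ltn_trans | exact: iota_ltn_sorted].
Qed.

Lemma lab_sorted p n (I : {set 'I_n}) : sorted ltn (lab p I).
Proof.
have -> : lab p I = map (fun x => (p + x).+1) [seq val i | i <- enum I].
  by rewrite /lab -map_comp.
rewrite sorted_map; apply: sub_sorted (sorted_enum_ord I).
by move=> x y /=; lia.
Qed.

Lemma lab_uniq p n (I : {set 'I_n}) : uniq (lab p I).
Proof. by apply: (sorted_uniq ltn_trans ltnn); apply: lab_sorted. Qed.

Lemma size_lab p n (I : {set 'I_n}) : size (lab p I) = #|I|.
Proof. by rewrite size_map -cardE. Qed.

Lemma mem_lab p n (I : {set 'I_n}) (i : 'I_n) : ((p + i).+1 \in lab p I) = (i \in I).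
Proof.
rewrite (mem_map (f := fun i : 'I_n => (p + val i).+1)) ?mem_enum //.
by move=> x y [] /addnI /val_inj.
Qed.

Lemma lab_iota p n (I : {set 'I_n}) : {subset lab p I <= iota p.+1 n}.
Proof. by move=> x /mapP[i _ ->]; rewrite mem_iota /=; have := ltn_ord i; lia. Qed.

Lemma perm_labC p n (I : {set 'I_n}) : perm_eq (lab p (~: I) ++ lab p I) (iota p.+1 n).
Proof.
apply: uniq_perm; rewrite ?iota_uniq //.
  rewrite cat_uniq !lab_uniq /= andbT; apply/hasP => -[x /mapP[i iI ->]].
  by rewrite mem_lab in_setC -mem_enum iI.
move=> x; rewrite mem_cat; apply/orP/idP => [[] /lab_iota //|].
rewrite mem_iota => /andP[px xn].
have xn' : (x - p.+1 < n)%N by lia.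
have -> : x = (p + Ordinal xn').+1 by rewrite /=; lia.
by rewrite !mem_lab in_setC; case: (_ \in I); [right|left].
Qed.

HB.instance Definition _ (k : fieldType) (P : presentation k) :=
  gen_eqMixin (cogen P).

Section Decomposition.
Variable k : fieldType.
Hypothesis char0 : [pchar k] =i pred0.
Local Notation chi := (@chi k).
Local Notation P := (Gerst_dual k).
Local Notation C := (cobar P).
Local Notation clin := (lin k (cogen P)).
Local Notation cor phi s := (<< Node phi (lf s) >> : clin).
Local Notation word_cogen := (@word_cogen k).

Definition coeff (phi : cogen P) (a : seq nat) : k :=
  phi (word_tree (carity phi) a) * chi a (word_tree (carity phi) a).

Lemma coeff_deg phi a : coeff phi a != 0 -> cdeg phi = wdegree (carity phi) a.
Proof.
rewrite /coeff mulf_eq0 negb_or => /andP[/cfun_supp[mt dt] nz].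
have pl := monomial_leaves mt.
have ul : uniq (leaves (word_tree (carity phi) a)) by rewrite (perm_uniq pl) iota_uniq.
have := chi_degree nz ul; rewrite (perm_size pl) size_iota /wdegree => e.
have {}dt : tdeg ddeg (word_tree (carity phi) a) = - cdeg phi := dt.
by rewrite -[LHS]opprK -dt e; ring.
Qed.

Lemma cor_expand phi : eqop C (iota 1 (carity phi)) (cor phi (iota 1 (carity phi)))
  (\sum_(a <- words0 (carity phi)) coeff phi a *: cor (word_cogen 1 (carity phi) a) (iota 1 (carity phi))).
Proof.
apply: (@corolla_sum k P _ (carity phi) (cdeg phi)) => // [a /coeff_deg -> //|t].
by rewrite (cogen_expand char0 phi t); apply: eq_bigr => a _; rewrite /= mul1r.
Qed.

Lemma relabel_cor h (phi : cogen P) s : relabel h (cor phi s) = cor phi (map h s).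
Proof. by rewrite relabelU /trelabel /= /lf -!map_comp. Qed.

Lemma eqop_unstd n S (f g : clin) : uniq S -> size S = n ->
  eqop C (iota 1 n) f g -> eqop C S (relabel (unstd S) f) (relabel (unstd S) g).
Proof. by move=> uS <- e; rewrite -{1}(map_unstd S); apply: eqop_relabel; rewrite ?map_unstd. Qed.

Lemma cor_expand_on phi S : uniq S -> size S = carity phi ->
  eqop C S (cor phi S)
  (\sum_(a <- words0 (carity phi)) coeff phi a *: cor (word_cogen 1 (carity phi) a) S).
Proof.
move=> uS sz; have := eqop_unstd uS sz (cor_expand phi).
rewrite relabel_cor -sz map_unstd linear_sum /=; congr eqop.
by apply: eq_bigr => a _; rewrite linearZ /= relabel_cor map_unstd.
Qed.

Definition two (u v : cogen P) (s' s : seq nat) : clin :=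
  << Node u (Node v (lf s') :: lf s) >>.

Lemma graft_cor x (u : cogen P) s1 s2 (w : tree (cogen P)) : x \notin s1 -> x \notin s2 ->
  graft (gdeg C) x (cor u (s1 ++ x :: s2)) << w >> = << Node u (lf s1 ++ w :: lf s2) >>.
Proof.
move=> x1 x2; rewrite (@graftUU k _ (gdeg C)).
have -> : deg_after (gdeg C) x (Node u (lf (s1 ++ x :: s2))) = 0.
  have -> : deg_after (gdeg C) x (Node u (lf (s1 ++ x :: s2))) =
      wdeg (map inl (x :: s2)).
    rewrite /deg_after /=.
    have -> : flatten [seq pword (gdeg C) w0 | w0 <- lf (s1 ++ x :: s2)] = map inl (s1 ++ x :: s2).
      by rewrite -map_comp; elim: (s1 ++ x :: s2) => //= a s ->.
    rewrite map_cat index_cat mem_map; last by move=> a b [].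
    by rewrite (negPf x1) /= eqxx addn0 drop_size_cat.
  by rewrite /wdeg big_map big1.
rewrite mulr0 expr0z scale1r /plug /=; congr << Node _ _ >>.
have id_ s : x \notin s ->
    [seq tbind (fun a => if a == x then w else Leaf a) u0 | u0 <- lf s] = lf s :> seq (tree (cogen P)).
  move=> xs; rewrite -map_comp; apply/eq_in_map => a as_ /=.
  by case: eqP => // ax; rewrite -ax as_ in xs.
by rewrite /lf map_cat /= map_cat -!/(lf _) /= eqxx !id_.
Qed.

Lemma graft_two (u v : cogen P) s' s : 0%N \notin s ->
  graft (gdeg C) 0 (cor u (0%N :: s)) (cor v s') = two u v s' s.
Proof. by move=> s0; apply: (@graft_cor 0 u [::] s). Qed.

Lemma eqop_graftl x (S S' : seq nat) (f f' g : clin) : uniq (x :: S) -> uniq (S ++ S') ->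
  eqop C (x :: S) f f' -> in_free (P := C) S' g ->
  eqop C (S ++ S') (graft (gdeg C) x f g) (graft (gdeg C) x f' g).
Proof.
move=> u1 u2 e fg; rewrite /eqop.
have -> : graft (gdeg C) x f g - graft (gdeg C) x f' g = graft (gdeg C) x (f - f') g.
  have := graft_linear_l (gdeg C) x g (-1) f' f.
  by rewrite !scaleN1r => H; rewrite -[f - f']addrC H addrC.
exact: ideal_graftl.
Qed.

Lemma eqop_graftr x (S S' : seq nat) (f g g' : clin) : uniq (x :: S) -> uniq (S ++ S') ->
  in_free (P := C) (x :: S) f -> eqop C S' g g' ->
  eqop C (S ++ S') (graft (gdeg C) x f g) (graft (gdeg C) x f g').
Proof.
by move=> u1 u2 ff e; rewrite /eqop -linearB; apply: ideal_graftr.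
Qed.

Lemma in_free_cor (phi : cogen P) s S : size S = carity phi -> perm_eq s S ->
  in_free (P := C) S (cor phi s).
Proof.
move=> sz ps; apply: in_freeU; apply/and3P; split=> //=.
  by rewrite size_map (perm_size ps) sz eqxx /=; apply/allP => _ /mapP[a _ ->].
by rewrite -map_comp (_ : flatten _ = s) //; elim: s {ps} => //= a s ->.
Qed.

Lemma graft_suml (J : Type) (r : seq J) (c : J -> k) (F : J -> clin) x g :
  graft (gdeg C) x (\sum_(i <- r) c i *: F i) g =
  \sum_(i <- r) c i *: graft (gdeg C) x (F i) g.
Proof. by rewrite /graft linear_sum; apply: eq_bigr => i _; rewrite linearZ. Qed.

Lemma graft_sumr (J : Type) (r : seq J) (c : J -> k) (F : J -> clin) x f :
  graft (gdeg C) x f (\sum_(i <- r) c i *: F i) =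
  \sum_(i <- r) c i *: graft (gdeg C) x f (F i).
Proof. by rewrite linear_sum; apply: eq_bigr => i _; rewrite linearZ. Qed.

Lemma two_expand u v s' s : uniq (0%N :: s) -> uniq (s ++ s') ->
  carity u = (size s).+1 -> carity v = size s' ->
  eqop C (s ++ s') (two u v s' s)
    (\sum_(a <- words0 (size s).+1) \sum_(b <- words0 (size s'))
      (coeff u a * coeff v b) *: two (word_cogen 1 (size s).+1 a) (word_cogen 1 (size s') b) s' s).
Proof.
move=> us us' cu cv; have s0 : 0%N \notin s by case/andP: us.
have us1 : uniq s' by move: us'; rewrite cat_uniq => /and3P[].
rewrite -graft_two //.
have e1 := cor_expand_on us (esym cu); have e2 := cor_expand_on us1 (esym cv).
apply: (@eqop_trans _ C _ (graft (gdeg C) 0 (\sum_(a <- words0 (carity u))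
    coeff u a *: cor (word_cogen 1 (carity u) a) (0%N :: s)) (cor v s'))).
  by apply: eqop_graftl => //; apply: in_free_cor.
apply: (@eqop_trans _ C _ (graft (gdeg C) 0 (\sum_(a <- words0 (carity u))
    coeff u a *: cor (word_cogen 1 (carity u) a) (0%N :: s))
    (\sum_(b <- words0 (carity v)) coeff v b *: cor (word_cogen 1 (carity v) b) s'))).
  apply: eqop_graftr => //; apply: in_free_sum_seq => a _; apply: in_freeZ.
  by apply: in_free_cor => //=; rewrite cu.
rewrite cu cv graft_suml (eq_bigr (fun a => \sum_(b <- words0 (size s'))
   (coeff u a * coeff v b) *: two (word_cogen 1 (size s).+1 a) (word_cogen 1 (size s') b) s' s)).
  exact: eqop_refl.
move=> a _; rewrite graft_sumr scaler_sumr.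
by apply: eq_bigr => b _; rewrite scalerA graft_two.
Qed.

Lemma monomial_word_tree n a : (2 <= n)%N -> a \in words0 n ->
  monomial (P := P) (iota 1 n) (word_tree n a).
Proof.
move=> n2 aw; have n0 : (0 < n)%N by lia.
have pl := leaves_word_tree n0 aw; apply/and3P; split=> //.
  have := perm_size pl; rewrite size_iota; case: (word_tree n a) => //= b e.
  by rewrite -e in n2.
by rewrite /word_tree; case: (a) => [|x a']; apply: wf_normal_tree.
Qed.

Section Cut.
Variables (phi : cogen P) (I : {set 'I_(carity phi)}).
Hypothesis I2 : (2 <= #|I|)%N.
Hypothesis I1 : (1 <= #|~: I|)%N.
Local Notation LI := (lab 0 I).
Local Notation J := (lab 0 (~: I)).

Definition cut_sign (d : int) : k :=
  (-1) ^+ inversions (LI ++ J) * (-1) ^ ((#|I|)%:Z * (d + (#|~: I|)%:Z)).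

Definition cut_sum (s : seq (cogen P * cogen P)) : clin :=
  \sum_(uv <- s) cut_sign (cdeg uv.1) *: two uv.1 uv.2 LI J.

Lemma zero_notin_lab (n : nat) (A : {set 'I_n}) : 0%N \notin lab 0 A.
Proof. by apply/mapP => -[]. Qed.

Lemma uniq0J : uniq (0%N :: J).
Proof. by rewrite /= zero_notin_lab lab_uniq. Qed.

Lemma uniqJI : uniq (J ++ LI).
Proof. by rewrite (perm_uniq (perm_labC 0 I)) iota_uniq. Qed.

(** In the basis of words the coefficients are values of phi on composites of
    normal trees, which do not involve the decomposition s. *)
Lemma cut_sum_expand s : is_decomposition I s ->
  eqop C (J ++ LI) (cut_sum s)
    (\sum_(a <- words0 #|~: I|.+1) \sum_(b <- words0 #|I|)
      (cut_sign (wdegree #|~: I|.+1 a) * (-1) ^ (wdegree #|~: I|.+1 a * wdegree #|I| b) *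
       linext (phi : _ -> k^o) (graft (gdeg P) 0
         << trelabel (unstd (0%N :: J)) (word_tree #|~: I|.+1 a) >>
         << trelabel (unstd LI) (word_tree #|I| b) >>) *
       (chi a (word_tree #|~: I|.+1 a) * chi b (word_tree #|I| b))) *:
      two (word_cogen 1 #|~: I|.+1 a) (word_cogen 1 #|I| b) LI J).
Proof.
case=> ars dec.
have ar uv : uv \in s -> carity uv.1 = #|~: I|.+1 /\ carity uv.2 = #|I|.
  by move=> uvs; case/and3P: (allP ars uv uvs) => [/eqP-> /eqP->].
apply: (@eqop_trans _ C _ (\sum_(uv <- s) cut_sign (cdeg uv.1) *:
   \sum_(a <- words0 #|~: I|.+1) \sum_(b <- words0 #|I|)
      (coeff uv.1 a * coeff uv.2 b) *: two (word_cogen 1 #|~: I|.+1 a) (word_cogen 1 #|I| b) LI J)).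
  apply: eqop_sum_seq => uv /ar[a1 a2]; apply: eqopZ.
  have := two_expand uniq0J uniqJI _ _ (u := uv.1) (v := uv.2).
  by rewrite !size_lab; apply.
rewrite (_ : \sum_(uv <- s) _ = \sum_(a <- words0 #|~: I|.+1) \sum_(b <- words0 #|I|)
    (\sum_(uv <- s) cut_sign (cdeg uv.1) * (coeff uv.1 a * coeff uv.2 b)) *:
    two (word_cogen 1 #|~: I|.+1 a) (word_cogen 1 #|I| b) LI J); last first.
  under eq_bigr do rewrite scaler_sumr.
  rewrite exchange_big; apply: eq_bigr => a _.
  under eq_bigr do rewrite scaler_sumr.
  rewrite exchange_big; apply: eq_bigr => b _ /=.
  by rewrite scaler_suml; apply: eq_bigr => uv _; rewrite scalerA.
rewrite (eq_big_seq (fun a => \sum_(b <- words0 #|I|)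
      (cut_sign (wdegree #|~: I|.+1 a) * (-1) ^ (wdegree #|~: I|.+1 a * wdegree #|I| b) *
       linext (phi : _ -> k^o) (graft (gdeg P) 0
         << trelabel (unstd (0%N :: J)) (word_tree #|~: I|.+1 a) >>
         << trelabel (unstd LI) (word_tree #|I| b) >>) *
       (chi a (word_tree #|~: I|.+1 a) * chi b (word_tree #|I| b))) *:
      two (word_cogen 1 #|~: I|.+1 a) (word_cogen 1 #|I| b) LI J)); first exact: eqop_refl.
move=> a aw; apply: eq_big_seq => b bw; congr (_ *: _).
have szJ : size (0%N :: J) = #|~: I|.+1 by rewrite /= size_lab.
have ma := monomial_word_tree (I1 : 2 <= #|~: I|.+1)%N aw; have mb := monomial_word_tree I2 bw.
rewrite dec; last first.
- have := monomial_relabel (unstd LI) mb.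
  by rewrite -{1}(size_lab 0 I) map_unstd.
- have := monomial_relabel (unstd (0%N :: J)) ma.
  by rewrite -szJ map_unstd.
rewrite mulr_sumr mulr_suml; apply: eq_big_seq => uv uvs; have [a1 a2] := ar _ uvs.
have backJ : trelabel (std (0%N :: J)) (trelabel (unstd (0%N :: J)) (word_tree #|~: I|.+1 a)) =
    word_tree #|~: I|.+1 a.
  rewrite trelabel_comp; apply: trelabel_id => i; rewrite (perm_mem (monomial_leaves ma)) => il.
  by rewrite /= std_unstd ?szJ // uniq0J.
have backI : trelabel (std LI) (trelabel (unstd LI) (word_tree #|I| b)) = word_tree #|I| b.
  rewrite trelabel_comp; apply: trelabel_id => i; rewrite (perm_mem (monomial_leaves mb)) => il.
  by rewrite /= std_unstd ?size_lab ?lab_uniq.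
rewrite backJ backI.
case: (eqVneq (coeff uv.1 a) 0) => [c0|c0].
  have : uv.1 (word_tree #|~: I|.+1 a) = 0.
    move: c0; rewrite /coeff a1 => /eqP; rewrite mulf_eq0 => /orP[/eqP //|/eqP z].
    by have := chi_word_tree_sq k aw; rewrite z mul0r => /eqP; rewrite eq_sym oner_eq0.
  by move=> z; rewrite c0 z !(mulr0, mul0r).
case: (eqVneq (coeff uv.2 b) 0) => [d0|d0].
  have : uv.2 (word_tree #|I| b) = 0.
    move: d0; rewrite /coeff a2 => /eqP; rewrite mulf_eq0 => /orP[/eqP //|/eqP z].
    by have := chi_word_tree_sq k bw; rewrite z mul0r => /eqP; rewrite eq_sym oner_eq0.
  by move=> z; rewrite d0 z !(mulr0, mul0r).
rewrite -a1 -a2 -(coeff_deg c0) -(coeff_deg d0) /coeff a1 a2.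
have := signz_sq k (cdeg uv.1 * cdeg uv.2); move: (_ ^ _) (cut_sign _) => e s1 ee.
move: (uv.1 _) (uv.2 _) (chi _ _) (chi _ _) => v1 v2 x1 x2.
by rewrite -[LHS]mulr1 -ee; ring.
Qed.

(** So the decomposition chosen in the differential may be replaced by an explicit
    one. *)
Lemma cut_sum_unique s s' : is_decomposition I s -> is_decomposition I s' ->
  eqop C (J ++ LI) (cut_sum s) (cut_sum s').
Proof.
move=> /cut_sum_expand e /cut_sum_expand e'; apply: eqop_trans e _.
exact: eqop_sym.
Qed.


End Cut.
End Decomposition.

Lemma std_mono S : sorted ltn S -> {in S &, {mono std S : x y / (x < y)%N}}.
Proof.
move=> ss x y xS yS; rewrite /std ltnS.
have lt := sorted_ltn_index ltn_trans ss.
case: (ltngtP (index x S) (index y S)) => [h|h|h].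
- by rewrite (lt _ _ xS yS h).
- by have /= := lt _ _ yS xS h; case: ltngtP.
- by rewrite -(nth_index 0%N xS) h nth_index // ltnn.
Qed.

Section Cuts.
Variable k : fieldType.
Hypothesis char0 : [pchar k] =i pred0.
Local Notation chi := (@chi k).
Local Notation P := (Gerst_dual k).
Local Notation C := (cobar P).
Local Notation clin := (lin k (cogen P)).
Local Notation cor phi s := (<< Node phi (lf s) >> : clin).
Local Notation word_cogen := (@word_cogen k).
Local Notation two := (@two k).

Lemma chi_mono a h t : {in leaves t &, {mono h : x y / (x < y)%N}} ->
  {subset a <= leaves t} -> chi (map h a) (trelabel h t) = chi a t.
Proof.
move=> mh at_.
have injh : {in leaves t &, injective h}.
  move=> x y xt yt hxy; have h1 := mh x y xt yt; have h2 := mh y x yt xt.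
  by move: h1 h2; rewrite hxy ltnn; case: ltngtP.
rewrite (chi_relabel k injh at_ (perm_refl _)) inversions_mono ?signMsign; last first.
  by move=> x y; rewrite !mem_filter => /andP[_ xt] /andP[_ yt]; apply: mh.
by rewrite exprD signMsign mul1r.
Qed.

Lemma chin_std S n a t : sorted ltn S -> size S = n -> {subset a <= S} ->
  monomial (P := P) S t -> chin k n (map (std S) a) (trelabel (std S) t) = chi a t.
Proof.
move=> ss szS aS mt; have uS := sorted_uniq ltn_trans ltnn ss.
have pl := monomial_leaves mt.
rewrite chin_mono.
  apply: chi_mono => [x y|x xa]; last by rewrite (perm_mem pl) aS.
  by rewrite !(perm_mem pl); apply: std_mono.
have := monomial_relabel (std S) mt; congr monomial.
rewrite -{2}(map_unstd S) -map_comp -szS -[RHS]map_id; apply/eq_in_map => i il.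
by rewrite /= std_unstd.
Qed.

Lemma is_decomposition_choice (phi : cogen P) I s : is_decomposition (phi := phi) I s ->
  is_decomposition I (decomposition I).
Proof.
move=> ds; rewrite /decomposition; case: pselect => [h|[]]; last by exists s.
by case: cid.
Qed.

Section Cut.
Variables (z : k) (n : nat) (a : seq nat) (I : {set 'I_n}).
Local Notation LI := (lab 0 I).
Local Notation J := (lab 0 (~: I)).
Local Notation phi := (word_cogen z n a).

Hypothesis I2 : (2 <= #|I|)%N.
Hypothesis I1 : (1 <= #|~: I|)%N.

Lemma sorted0J : sorted ltn (0%N :: J).
Proof.
rewrite /= path_min_sorted ?lab_sorted //.
by apply/allP => x /mapP[i _ ->].
Qed.

Lemma linext_graft_word_cogen x y : monomial (P := P) (0%N :: J) x -> monomial (P := P) LI y ->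
  linext (phi : _ -> k^o) (graft (gdeg P) 0 << x >> << y >>) =
  (-1) ^ (tdeg ddeg y * deg_after ddeg 0 x) * (z * chi a (plug 0 x y)).
Proof.
move=> mx my; rewrite (@graftUU k _ (gdeg P)) linearZ /= linextU1 /= chin_mono //.
rewrite -(monomial_perm _ (perm_labC 0 I)); apply: monomial_plug => //.
by rewrite (uniq0J (phi := word_cogen z n a)).
Qed.

(** Cuts that leave all planar labels on the outer vertex. *)
Lemma decomposition_space : {subset a <= J} ->
  is_decomposition (phi := phi) I
    [:: (word_cogen 1 #|~: I|.+1 (map (std (0%N :: J)) a),
         word_cogen (z * (-1) ^+ space_cross a LI J *
             (-1) ^ (wdegree #|~: I|.+1 (map (std (0%N :: J)) a) * wdegree #|I| [::]))
           #|I| [::])].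
Proof.
move=> aJ; split.
  rewrite /= andbT; apply/and3P; split=> //; rewrite /wdegree size_map.
  have -> : (map (std (0%N :: J)) a == [::]) = (a == [::]) by case: (a).
  have : n = (#|I| + #|~: I|)%N by rewrite cardsC card_ord.
  move: (#|I|) (#|~: I|) => i j e; apply/eqP; rewrite {}e /=; lia.
move=> x y mx my; rewrite linext_graft_word_cogen // big_seq1 /=.
have u0 : uniq (0%N :: J) := uniq0J (phi := phi) I.
have u1 : uniq (J ++ LI) := uniqJI (phi := phi) I.
rewrite (chi_plug_space k u0 u1 (monomial_leaves mx) (monomial_leaves my) aJ).
rewrite (@chin_std (0%N :: J)) ?sorted0J //; first last.
- by move=> i /aJ; rewrite inE orbC => ->.
- by rewrite /= size_lab.
have -> : chin k #|I| [::] (trelabel (std LI) y) = chi [::] y.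
  by apply: (@chin_std LI _ [::]); rewrite ?lab_sorted ?size_lab.
have -> : count (fun s => (s < 0)%N && (s \notin a)) J = 0%N by rewrite -[RHS](count_pred0 J).
rewrite addn0; have e1 := signz_sq k (tdeg ddeg y * deg_after ddeg 0 x).
have := signz_sq k (wdegree #|~: I|.+1 [seq std (0%N :: J) i | i <- a] * wdegree #|I| [::]).
move: ((-1) ^ (tdeg _ _ * _)) ((-1) ^ (wdegree _ _ * _)) e1 => e f ee ff.
(* e and f are signs, so that their squares are 1 *)
transitivity ((e * e) * (z * (-1) ^+ space_cross a LI J * (chi a x * chi [::] y))); first by ring.
transitivity ((f * f) * (z * (-1) ^+ space_cross a LI J * (chi a x * chi [::] y))); last by ring.
by rewrite ee ff.
Qed.

(** Cuts that put a factor b of the planar word on the inner vertex, for which the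
    planar label 0 stands on the outer one. *)
Lemma decomposition_planar l b r : a = l ++ b ++ r -> b != [::] ->
  {subset l <= J} -> {subset r <= J} -> {subset b <= LI} ->
  is_decomposition (phi := phi) I
    [:: (word_cogen 1 #|~: I|.+1 (map (std (0%N :: J)) (l ++ 0%N :: r)),
         word_cogen (z * (-1) ^+ space_cross a LI J *
             (-1) ^ (wdegree #|~: I|.+1 (map (std (0%N :: J)) (l ++ 0%N :: r)) *
                     wdegree #|I| (map (std LI) b)))
           #|I| (map (std LI) b))].
Proof.
move=> aE b0 lJ rJ bI; split.
  rewrite /= andbT; apply/and3P; split=> //; rewrite /wdegree !size_map.
  have -> : (map (std (0%N :: J)) (l ++ 0%N :: r) == [::]) = false by case: (l).
  have -> : (map (std LI) b == [::]) = false by case: (b) b0.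
  have -> : (a == [::]) = false by rewrite aE; case: (l) => //; case: (b) b0.
  have : n = (#|I| + #|~: I|)%N by rewrite cardsC card_ord.
  move: (#|I|) (#|~: I|) => i j e; apply/eqP; rewrite aE {}e !size_cat /=; lia.
move=> x y mx my; rewrite linext_graft_word_cogen // big_seq1 /=.
have u0 : uniq (0%N :: J) := uniq0J (phi := phi) I.
have u1 : uniq (J ++ LI) := uniqJI (phi := phi) I.
rewrite aE (chi_plug_planar k u0 u1 (monomial_leaves mx) (monomial_leaves my)) // -aE.
rewrite (@chin_std (0%N :: J)) ?sorted0J //; first last.
- by move=> i; rewrite mem_cat !inE => /orP[/lJ ->|/orP[->|/rJ ->]]; rewrite ?orbT.
- by rewrite /= size_lab.
rewrite (@chin_std LI) ?lab_sorted ?size_lab //.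
have e1 := signz_sq k (tdeg ddeg y * deg_after ddeg 0 x).
have := signz_sq k (wdegree #|~: I|.+1 [seq std (0%N :: J) i | i <- l ++ 0%N :: r] *
   wdegree #|I| [seq std LI i | i <- b]).
move: ((-1) ^ (tdeg _ _ * _)) ((-1) ^ (wdegree _ _ * _)) e1 => e f ee ff.
transitivity ((e * e) * (z * (-1) ^+ space_cross a LI J * (chi (l ++ 0%N :: r) x * chi b y))); first by ring.
transitivity ((f * f) * (z * (-1) ^+ space_cross a LI J * (chi (l ++ 0%N :: r) x * chi b y))); last by ring.
by rewrite ee ff.
Qed.

(** All other cuts vanish, by [chi_plug_split]. *)
Lemma decomposition_nil : ~ {subset a <= J} ->
  (forall l b r, a = l ++ b ++ r -> b != [::] -> {subset l <= J} ->
     {subset r <= J} -> {subset b <= LI} -> False) ->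
  is_decomposition (phi := phi) I [::].
Proof.
move=> na no; split=> // x y mx my; rewrite linext_graft_word_cogen // big_nil.
have u0 : uniq (0%N :: J) := uniq0J (phi := phi) I.
have u1 : uniq (J ++ LI) := uniqJI (phi := phi) I.
case: (eqVneq (chi a (plug 0 x y)) 0) => [->|nz]; first by rewrite !mulr0.
have [|[l [b [r [aE b0 lJ rJ bI]]]]] :=
  chi_plug_split u0 u1 (monomial_leaves mx) (monomial_leaves my) nz.
  by move/na.
by case: (no l b r).
Qed.

End Cut.

(** The vertices are rewritten independently. The outer one may permute its
    inputs, and the inner vertex follows the input 0. *)
Lemma two_eq u v U V (al be : k) s' s s1 s2 t' : uniq (0%N :: s) -> uniq (s ++ s') ->
  carity u = (size s).+1 -> carity v = size s' -> carity U = (size s).+1 ->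
  perm_eq (s1 ++ 0%N :: s2) (0%N :: s) ->
  eqop C (0%N :: s) (cor u (0%N :: s)) (al *: cor U (s1 ++ 0%N :: s2)) ->
  eqop C s' (cor v s') (be *: cor V t') ->
  eqop C (s ++ s') (two u v s' s) ((al * be) *: << Node U (lf s1 ++ Node V (lf t') :: lf s2) >>).
Proof.
move=> us us' cu cv cU pU eu ev; have s0 : 0%N \notin s by case/andP: us.
rewrite -(graft_two _ _ _ s0).
have := eqop_graftl us us' eu (in_free_cor (esym cv) (perm_refl _)).
move=> e; apply: eqop_trans e _.
have fU : in_free (P := C) (0%N :: s) (al *: cor U (s1 ++ 0%N :: s2)).
  by apply: in_freeZ; apply: in_free_cor; rewrite //= cU.
have := eqop_graftr us us' fU ev; congr eqop.
have [z1 z2] : 0%N \notin s1 /\ 0%N \notin s2.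
  have : uniq (s1 ++ 0%N :: s2) by rewrite (perm_uniq pU).
  by rewrite cat_uniq /= negb_or => /and4P[_ /andP[-> _] -> _].
have gl f g : graft (gdeg C) 0 (al *: f) g = al *: graft (gdeg C) 0 f g :> clin.
  by rewrite /graft linearZ.
by rewrite gl linearZ /= graft_cor // scalerA.
Qed.

End Cuts.

(** * The generators *)

Section Generators.
Variable k : fieldType.
Hypothesis char0 : [pchar k] =i pred0.
Local Notation chi := (@chi k).
Local Notation P := (Gerst_dual k).
Local Notation C := (cobar P).
Local Notation clin := (lin k (cogen P)).
Local Notation cor phi s := (<< Node phi (lf s) >> : clin).
Local Notation word_cogen := (@word_cogen k).

(** The signs that bring the differential into the stated form. Along a cut the
    arities add up, and the mixed term of [binD2] cancels a Koszul sign. *)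
Definition signL (n : nat) : k := (-1) ^+ 'C(n.-1, 2).
Definition signM (p q : nat) : k := (-1) ^+ ('C(p, 2).+1 + 'C(q.+1, 2)).

Definition genL (n : nat) : cogen P := word_cogen (signL n) n [::].
Definition genM (p q : nat) : cogen P := word_cogen (signM p q) (p + q) (iota 1 p).

Lemma signLE n : signL n = (-1) ^+ 'C(n.-1, 2). Proof. by []. Qed.

Lemma signME p q : signM p q = (-1) ^+ ('C(p, 2).+1 + 'C(q.+1, 2)). Proof. by []. Qed.

Lemma signLK n : signL n * signL n = 1. Proof. exact: signMsign. Qed.
Lemma signMK p q : signM p q * signM p q = 1. Proof. exact: signMsign. Qed.

Lemma map_std s : uniq s -> map (std s) s = iota 1 (size s).
Proof.
move=> us; apply: (@eq_from_nth _ 0%N); rewrite size_map ?size_iota // => i isz.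
by rewrite (nth_map 0%N) // nth_iota // /std index_uniq // add1n.
Qed.

Lemma std_inj s : {in s &, injective (std s)}.
Proof.
move=> x y xs ys [] e; by rewrite -(nth_index 0%N xs) e nth_index.
Qed.

Lemma cor_scale z n a : eqop C (iota 1 n) (cor (word_cogen z n a) (iota 1 n))
  (z *: cor (word_cogen 1 n a) (iota 1 n)).
Proof.
have := @corolla_sum k P _ n (wdegree n a) (fun _ : unit => z) (fun=> word_cogen 1 n a)
  (fun _ _ => erefl) (fun _ _ => erefl) [:: tt] (word_cogen z n a) erefl erefl.
by rewrite big_seq1; apply => t; rewrite big_seq1 /= mul1r.
Qed.

Lemma wf_trelabel h (t : gtree) : wf (P := P) (trelabel h t) = wf (P := P) t.
Proof.
elim/tree_induction: t => //= g ts IH; rewrite size_map; congr (_ && _).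
by rewrite all_map; apply: eq_in_all => t /IH.
Qed.

(** Permuting the inputs costs the sign of the whole permutation, from the cobar
    construction, and the sign of the permutation of the space inputs, from the
    functional. *)
Lemma cor_word n w r z : perm_eq (w ++ r) (iota 1 n) ->
  eqop C (iota 1 n) (cor (word_cogen z n (iota 1 (size w))) (w ++ r))
    (((-1) ^+ (inversions (w ++ r) + inversions r) * z) *: cor (word_cogen 1 n w) (iota 1 n)).
Proof.
move=> pwr; set s := w ++ r.
have us : uniq s by rewrite (perm_uniq pwr) iota_uniq.
have szs : size s = n by rewrite (perm_size pwr) size_iota.
have mw : map (std s) w = iota 1 (size w).
  have := map_std us; rewrite map_cat size_cat iotaD => /eqP.
  by rewrite eqseq_cat ?size_map ?size_iota // => /andP[/eqP].
have mr : map (std s) r = iota (size w).+1 (size r).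
  have := map_std us; rewrite map_cat size_cat iotaD => /eqP.
  by rewrite eqseq_cat ?size_map ?size_iota // => /andP[_ /eqP].
have pr : perm_eq [seq x <- iota 1 n | x \notin w] r.
  apply: uniq_perm; rewrite ?filter_uniq ?iota_uniq //.
    by move: us; rewrite cat_uniq => /and3P[].
  move=> x; rewrite mem_filter -(perm_mem pwr) mem_cat.
  case xw: (x \in w) => //=; apply/esym/negbTE.
  by move: us; rewrite cat_uniq => /and3P[_ /hasPn H _]; apply: contraTN xw => /H.
apply: (@eqop_trans _ C _ ((-1) ^+ inversions s *: cor (word_cogen ((-1) ^+ inversions r * z) n w) (iota 1 n))).
  apply: corolla_perm => //.
    rewrite /= /wdegree size_iota; congr (_ + _ - _).
    by case: (w).
  move=> t; rewrite /= /chin.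
  have mono_eq : monomial (P := P) (iota 1 n) (trelabel (std s) t) = monomial (P := P) (iota 1 n) t.
    (* the relabelling is a bijection of the labels *)
    apply/idP/idP => [mt|mt]; last first.
      have := monomial_relabel (std s) mt; rewrite -(monomial_perm t pwr) in mt.
      rewrite -(monomial_perm _ (_ : perm_eq (map (std s) s) _)); last first.
        exact: perm_map.
      by rewrite map_std // szs.
    have pl := monomial_leaves mt; rewrite leaves_trelabel in pl.
    have ls : {subset leaves t <= s}.
      move=> x xt; have : std s x \in iota 1 n by rewrite -(perm_mem pl) map_f.
      by rewrite mem_iota => /andP[_]; rewrite /std -szs add1n ltnS index_mem.
    have ul : uniq (leaves t).
      by apply: (@map_uniq _ _ (std s)); rewrite (perm_uniq pl) iota_uniq.
    have szl : size (leaves t) = n by rewrite -(size_iota 1 n) -(perm_size pl) size_map.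
    have [_ ls'] := uniq_min_size ul ls (eq_leq (etrans szs (esym szl))).
    apply/and3P; split.
    - by case: t mt {pl ls ul szl ls'} => // a /and3P[].
    - by move: (monomial_wf mt); rewrite wf_trelabel.
    - exact: perm_trans (uniq_perm ul us ls') pwr.
  rewrite mono_eq; case: ifP => [mt|_]; last by rewrite !mulr0.
  have injs : {in iota 1 n &, injective (std s)}.
    by move=> x y; rewrite -!(perm_mem pwr); apply: std_inj.
  have wS : {subset w <= iota 1 n} by move=> x xw; rewrite -(perm_mem pwr) mem_cat xw.
  rewrite -mw (chi_relabel k injs wS (monomial_leaves mt)).
  set sp := [seq x <- iota 1 n | x \notin w].
  have -> : (-1) ^+ (inversions (map (std s) sp) + inversions sp) = (-1) ^+ inversions r :> k.
    apply: sign_eq; rewrite oddD.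
    have injsp : {in sp &, injective (std s)}.
      by move=> x y; rewrite !mem_filter => /andP[_ xs] /andP[_ ys]; apply: injs.
    rewrite (odd_inversions_map pr injsp) mr (inversions_sorted (iota_ltn_sorted _ _)).
    by rewrite addFb.
  by rewrite mulrA [z * _]mulrC.
rewrite exprD -mulrA -scalerA; apply: eqopZ; exact: cor_scale.
Qed.

Lemma cor_L n s : perm_eq s (iota 1 n) ->
  eqop C (iota 1 n) << ell genL (lf s) >> (signL n *: cor (word_cogen 1 n [::]) (iota 1 n)).
Proof.
move=> ps; have := @cor_word n [::] s (signL n) ps.
rewrite /= exprD signMsign mul1r /ell /genL size_map (perm_size ps) size_iota.
by [].
Qed.

Lemma cor_M n w r : perm_eq (w ++ r) (iota 1 n) ->
  eqop C (iota 1 n) << em genM (lf w) (lf r) >>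
    (((-1) ^+ (inversions (w ++ r) + inversions r) * signM (size w) (size r)) *:
     cor (word_cogen 1 n w) (iota 1 n)).
Proof.
move=> ps; have := @cor_word n w r (signM (size w) (size r)) ps.
rewrite /em /genM !size_map /lf map_cat.
have -> : (size w + size r)%N = n by rewrite -size_cat (perm_size ps) size_iota.
by [].
Qed.

Definition rest (n : nat) (a : seq nat) := [seq x <- iota 1 n | x \notin a].

Lemma perm_rest n a : uniq a -> all (fun x => x \in iota 1 n) a ->
  perm_eq (a ++ rest n a) (iota 1 n).
Proof.
move=> ua /allP al; rewrite perm_catC.
apply: perm_trans (permEl (perm_filterC (fun x => x \notin a) _)).
rewrite perm_cat2l; apply: uniq_perm; rewrite ?filter_uniq ?iota_uniq // => x.
by rewrite mem_filter /= negbK; case xa: (x \in a) => //=; apply/esym; exact: al.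
Qed.

Lemma rest_sorted n a : sorted ltn (rest n a).
Proof. by apply: sorted_filter; [exact: ltn_trans | exact: iota_ltn_sorted]. Qed.

Definition word_sign n (a : seq nat) : k :=
  (-1) ^+ inversions (a ++ rest n a) * signM (size a) (size (rest n a)).

Lemma word_signK n a : word_sign n a * word_sign n a = 1.
Proof.
by rewrite /word_sign mulrACA signMsign signMK mul1r.
Qed.

Lemma cor_M_rest n a : a \in words n ->
  eqop C (iota 1 n) << em genM (lf a) (lf (rest n a)) >>
    (word_sign n a *: cor (word_cogen 1 n a) (iota 1 n)).
Proof.
rewrite mem_words => /and3P[_ ua al]; have := cor_M (perm_rest ua al).
by rewrite (inversions_sorted (rest_sorted _ _)) addn0.
Qed.

Lemma corolla_combinationE n (c0 : k) c : (2 <= n)%N ->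
  eqop C (iota 1 n) (corolla_combination genL genM n c0 c)
   (\sum_(a <- words0 n) (if a is [::] then c0 * signL n else c a * word_sign n a) *:
      cor (word_cogen 1 n a) (iota 1 n)).
Proof.
move=> n2; rewrite /corolla_combination big_cons.
rewrite (big_words n (fun a => c a *: << em genM (lf a) (lf (rest n a)) >>)).
apply: eqopD; first by rewrite -scalerA; apply/eqopZ/cor_L.
apply: eqop_sum_seq => a aw; case: a aw => [|x a] aw; first by rewrite mem_words in aw.
by rewrite -scalerA; apply/eqopZ/cor_M_rest.
Qed.

Lemma generators_span n (phi : cogen P) : (2 <= n)%N -> carity phi = n ->
  exists c0 c, eqop C (iota 1 n) (cor phi (iota 1 n)) (corolla_combination genL genM n c0 c).
Proof.
move=> n2 cn; exists (coeff phi [::] * signL n), (fun a => coeff phi a * word_sign n a).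
apply: eqop_trans (eqop_sym (corolla_combinationE _ _ n2)).
have := cor_expand char0 phi; rewrite cn => e; apply: eqop_trans e _.
rewrite (eq_bigr (fun a => (if a is [::] then coeff phi [::] * signL n * signL n
   else coeff phi a * word_sign n a * word_sign n a) *: cor (word_cogen 1 n a) (iota 1 n))).
  exact: eqop_refl.
by move=> [|x a] _; congr (_ *: _); rewrite -mulrA ?signLK ?word_signK mulr1.
Qed.

(** Evaluation at the normal tree of a word isolates its coefficient. *)
Lemma generators_free n (c0 : k) c : (2 <= n)%N ->
  eqop C (iota 1 n) (corolla_combination genL genM n c0 c) 0 ->
  c0 = 0 /\ forall p (a : p.-tuple 'I_n), (2 <= p)%N -> uniq a ->
    c [seq (val i).+1 | i <- a] = 0.
Proof.
move=> n2 e0.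
pose d a := if a is [::] then c0 * signL n else c a * word_sign n a.
have I0 : ideal (P := C) (iota 1 n) (\sum_(a <- words0 n) d a *: cor (word_cogen 1 n a) (iota 1 n)).
  have := eqop_trans (eqop_sym (corolla_combinationE c0 c n2)) e0.
  by rewrite /eqop subr0.
have d0 b : b \in words0 n -> d b = 0.
  move=> bw; have mb := monomial_word_tree k n2 bw.
  have lb : {subset leaves (word_tree n b) <= iota 1 n}.
    by move=> x; rewrite (perm_mem (monomial_leaves mb)).
  have := corolla_value_ideal I0 (iota_uniq 1 n) (perm_refl _) lb.
  rewrite linear_sum /= (bigD1_seq b) ?uniq_words0 //= big_seq_cond big1 => [|a /andP[aw ab]].
    rewrite addr0 linearZ /= linextU1 corolla_value_cor /= trelabel_id; last first.
      by move=> x /lb xn; rewrite std_iota.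
    rewrite chin_mono // mul1r; move/eqP; rewrite scaler_eq0 mulf_eq0 signr_eq0 /=.
    case/orP => [/eqP //|/eqP z]; have := chi_word_tree_sq k bw.
    by rewrite z mul0r => /eqP; rewrite eq_sym oner_eq0.
  rewrite linearZ /= linextU1 corolla_value_cor /= trelabel_id; last first.
    by move=> x /lb xn; rewrite std_iota.
  rewrite chin_mono // mul1r (_ : chi a (word_tree n b) = 0) ?mulr0 ?scaler0 //.
  apply/eqP; apply: contraTT isT => nz; move: ab; rewrite (chi_word_tree bw aw nz) eqxx //.
split.
  have := d0 [::] (mem_head _ _); rewrite /d => /(congr1 (fun z => z * signL n)).
  by rewrite -mulrA signLK mulr1 mul0r.
move=> p a p2 ua; set a' := map _ _.
have aw : a' \in words n.
  rewrite mem_words size_map size_tuple p2 map_inj_uniq ?ua /=; last first.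
    by move=> i j [] /val_inj.
  by apply/allP => _ /mapP[i _ ->]; rewrite mem_iota /= add1n ltnS ltn_ord.
have := d0 a' _; rewrite inE aw orbT => /(_ isT).
case E: a' aw => [|x a''] aw; first by rewrite mem_words in aw.
rewrite /d => /(congr1 (fun z => z * word_sign n (x :: a''))).
by rewrite -mulrA word_signK mulr1 mul0r.
Qed.

Lemma gen_standard : standard_generators genL genM.
Proof.
split.
- move=> n n2; split=> //=; rewrite /wdegree /=; lia.
- move=> p q p2; split=> //=; rewrite /wdegree size_iota.
  have -> : (iota 1 p == [::]) = false by case: (p) p2.
  rewrite /=; lia.
- move=> n s n2 ps; apply: eqop_trans (cor_L ps) _.
  by apply/eqop_sym/cor_L.
- move=> p q s p2 ps.
  have p1 : perm_eq (iota 1 p ++ s) (iota 1 (p + q)).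
    by rewrite iotaD add1n perm_cat2l.
  have p0 : perm_eq (iota 1 p ++ iota p.+1 q) (iota 1 (p + q)) by rewrite iotaD add1n.
  apply: eqop_trans (cor_M p1) _; apply: eqop_trans (eqop_sym (cor_M p0)).
  have inv_s r : perm_eq r (iota p.+1 q) -> inversions (iota 1 p ++ r) = inversions r.
    move=> pr; rewrite inversions_cat (inversions_sorted (iota_ltn_sorted _ _)) add0n.
    rewrite big_seq big1 ?addn0 // => x; rewrite mem_iota => /andP[_ xp].
    apply/eqP; rewrite -leqn0 leqNgt -has_count; apply/hasP => -[y].
    by rewrite (perm_mem pr) mem_iota => /andP[py _] /=; lia.
  rewrite !inv_s // !exprD !signMsign (perm_size ps); exact: eqop_refl.
- split.
  + by move=> n phi n2 cn; apply: generators_span.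
  + by move=> n c0 c n2 e; apply: generators_free.
  + rewrite /= chin_mono //; first by rewrite chi_chiZ /signL (_ : chiZ _ _ = 1) ?mulr1 //; vm_compute.
  + rewrite /= chin_mono //; rewrite chi_chiZ /signM (_ : chiZ _ _ = 1) ?mulr1; last by vm_compute.
    by rewrite sqrrN expr1n.
  + by rewrite /= chin_mono // chi_chiZ (_ : chiZ _ _ = 0) ?mulr0 //; vm_compute.
Qed.

End Generators.

(** * The differential *)

Section Differential.
Variables (k : fieldType) (P : presentation k).
Local Notation C := (cobar P).
Local Notation clin := (lin k (cogen P)).
Local Notation cor phi s := (<< Node phi (lf s) >> : clin).

Lemma decomposition_arity (phi : cogen P) I uv : uv \in decomposition (phi := phi) I ->
  carity uv.1 = #|~: I|.+1 /\ carity uv.2 = #|I|.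
Proof.
rewrite /decomposition; case: pselect => // h; case: cid => s [/= ar _] uvs.
by case/and3P: (allP ar _ uvs) => [/eqP-> /eqP->].
Qed.

Lemma leaves_two (u v : cogen P) s' s :
  leaves (Node u (Node v (lf s') :: lf s)) = s' ++ s.
Proof.
have fl t : flatten [seq leaves w | w <- lf t] = t :> seq nat.
  by rewrite -map_comp; elim: t => //= a t ->.
by rewrite /= !fl.
Qed.

Lemma monomial_two (u v : cogen P) s' s S : carity u = (size s).+1 -> carity v = size s' ->
  perm_eq (s' ++ s) S -> monomial (P := C) S (Node u (Node v (lf s') :: lf s)).
Proof.
move=> cu cv ps; apply/and3P; split=> //; last by rewrite leaves_two.
have wl t : all (wf (P := C)) (lf t) by apply/allP => _ /mapP[a _ ->].
by rewrite /= !size_map cu cv !eqxx !wl.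
Qed.

Lemma d_gen_in_free (phi : cogen P) : in_free (P := C) (iota 1 (carity phi)) (d_gen phi).
Proof.
apply: in_free_sum => I _; apply: in_free_sum_seq => uv /decomposition_arity[cu cv].
apply/in_freeZ/in_freeU/monomial_two; rewrite ?size_lab //.
by rewrite perm_catC perm_labC.
Qed.

(** On a corolla whose inputs are leaves there is nothing to substitute. *)
Lemma cobar_d_corolla (phi : cogen P) n : carity phi = n ->
  cobar_d (cor phi (iota 1 n)) = d_gen phi.
Proof.
move=> <-; set n' := carity phi; rewrite /cobar_d linextU1 /=.
rewrite [X in _ + X]big1 ?addr0 => [|i _]; last first.
  rewrite (_ : nth 0 _ i = 0) ?linear0 ?scaler0 //.
  move: (nat_of_ord i) => {i} i; elim: (iota 1 n') i => [|a s IH] [|i] //=.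
rewrite /subst -[RHS]linext_mono; apply: eq_linext_supp => w /d_gen_in_free mw.
have lw := monomial_leaves mw.
have td i : tdeg (gdeg C) (nth (Leaf 0) (lf (iota 1 n')) i : tree (cogen P)) = 0.
  case: (ltnP i (size (iota 1 n'))) => isz.
    by rewrite (nth_map 0%N) // /tdeg /wdeg /= big_seq1.
  by rewrite nth_default ?size_map // /tdeg /wdeg /= big_seq1.
have -> : subst_exponent (lf (iota 1 n')) w = 0.
  rewrite /subst_exponent /=; rewrite big1 ?add0r => [|i _]; last by rewrite td mul0r.
  by apply: big1 => i _; apply: big1 => j _; rewrite td mul0r.
rewrite expr0z; congr << _ >>; rewrite -[RHS]tbind_id; apply: eq_tbind => a.
rewrite (perm_mem lw) mem_iota => /andP[a1 an].
rewrite (nth_map 0%N) ?size_iota; last by lia.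
by rewrite nth_iota; [congr Leaf; lia | lia].
Qed.

End Differential.

Lemma binD2 a b : 'C(a + b, 2) = ('C(a, 2) + 'C(b, 2) + a * b)%N.
Proof.
elim: a => [|a IH]; first by rewrite add0n bin0n mul0n addn0.
by rewrite addSn !binS !bin1 IH; lia.
Qed.

Definition cross (w w' : seq nat) : nat := \sum_(x <- w) count (fun y => (y < x)%N) w'.

Lemma cross_catl w1 w2 w : cross (w1 ++ w2) w = (cross w1 w + cross w2 w)%N.
Proof. exact: big_cat. Qed.

Lemma cross_catr w w1 w2 : cross w (w1 ++ w2) = (cross w w1 + cross w w2)%N.
Proof. by rewrite /cross -big_split; apply: eq_bigr => x _; rewrite count_cat. Qed.

Lemma cross0 w w' : {in w & w', forall x y, (x <= y)%N} -> cross w w' = 0%N.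
Proof.
move=> H; rewrite /cross big_seq big1 // => x xw; apply/eqP.
rewrite -leqn0 leqNgt -has_count; apply/hasP => -[y yw].
by rewrite /= ltnNge (H x y).
Qed.

Lemma cross_all w w' : {in w & w', forall x y, (y < x)%N} ->
  cross w w' = (size w * size w')%N.
Proof.
move=> H; rewrite /cross (eq_big_seq (fun=> size w')) ?big_const_seq ?count_predT ?iter_addn_0 1?mulnC //.
move=> x xw; apply/eqP; rewrite -all_count; apply/allP => y yw.
exact: H.
Qed.

Lemma inversions_cross w w' : sorted ltn w -> sorted ltn w' ->
  inversions (w ++ w') = cross w w'.
Proof. by move=> spelling_ sw'; rewrite inversions_cat !inversions_sorted. Qed.

Lemma count_pred0_lt (w : seq nat) : count (fun b => (b < 0)%N) w = 0%N.
Proof. by rewrite (eq_count (a2 := pred0)) ?count_pred0. Qed.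

Section CutValue.
Variable k : fieldType.
Hypothesis char0 : [pchar k] =i pred0.
Local Notation P := (Gerst_dual k).
Local Notation C := (cobar P).
Local Notation clin := (lin k (cogen P)).
Local Notation cor phi s := (<< Node phi (lf s) >> : clin).
Local Notation word_cogen := (@word_cogen k).
Local Notation signL := (signL k).
Local Notation signM := (signM k).
Local Notation genL := (genL k).
Local Notation genM := (genM k).

Lemma d_gen_cuts (phi : cogen P) : d_gen phi =
  \sum_(I : {set 'I_(carity phi)} | (2 <= #|I|)%N && (1 <= #|~: I|)%N)
    cut_sum I (decomposition I).
Proof. by []. Qed.

(** The contribution of a cut with a single term, when its two vertices are
    multiples of known corollas. *)
Lemma cut_value (phi : cogen P) (I : {set 'I_(carity phi)}) u v (al be : k) U V s1 s2 t' :
  (2 <= #|I|)%N -> (1 <= #|~: I|)%N -> is_decomposition I [:: (u, v)] ->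
  carity U = #|~: I|.+1 -> perm_eq (s1 ++ 0%N :: s2) (0%N :: lab 0 (~: I)) ->
  eqop C (0%N :: lab 0 (~: I)) (cor u (0%N :: lab 0 (~: I))) (al *: cor U (s1 ++ 0%N :: s2)) ->
  eqop C (lab 0 I) (cor v (lab 0 I)) (be *: cor V t') ->
  eqop C (iota 1 (carity phi)) (cut_sum I (decomposition I))
    ((cut_sign I (cdeg u) * (al * be)) *: << Node U (lf s1 ++ Node V (lf t') :: lf s2) >>).
Proof.
move=> I2 I1 dI cU pU eu ev.
have := cut_sum_unique char0 I2 I1 (is_decomposition_choice dI) dI.
move/(eqop_perm (perm_labC 0 I)) => e; apply: eqop_trans e _.
rewrite /cut_sum big_seq1 -scalerA; apply: eqopZ.
apply: (eqop_perm (perm_labC 0 I)).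
case: dI => /= /andP[/and3P[/eqP cu /eqP cv _] _] _.
by apply: (two_eq (uniq0J I) (uniqJI I)); rewrite ?size_lab.
Qed.

Lemma cut_none (phi : cogen P) (I : {set 'I_(carity phi)}) :
  (2 <= #|I|)%N -> (1 <= #|~: I|)%N -> is_decomposition I [::] ->
  eqop C (iota 1 (carity phi)) (cut_sum I (decomposition I)) 0.
Proof.
move=> I2 I1 dI; have := cut_sum_unique char0 I2 I1 (is_decomposition_choice dI) dI.
by rewrite {2}/cut_sum big_nil => /(eqop_perm (perm_labC 0 I)).
Qed.

(** The number of products in the normal tree of w; its other vertices are
    brackets. *)
Definition plen (w : seq nat) : nat := (size w + (w == [::])).-1.

Lemma wdegree_plen n w : wdegree n w = (plen w).+1%:Z - n%:Z.
Proof. by rewrite /wdegree /plen; case: w => [|x w] /=; lia. Qed.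

Lemma cut_signE (phi : cogen P) (I : {set 'I_(carity phi)}) w :
  cut_sign I (wdegree #|~: I|.+1 w) =
  (-1) ^+ (inversions (lab 0 I ++ lab 0 (~: I)) + #|I| * plen w).
Proof.
rewrite /cut_sign exprD; congr (_ * _).
rewrite wdegree_plen [X in _ * X](_ : _ = (plen w)%:Z); last by lia.
by rewrite -PoszM -exprnP.
Qed.

Lemma sign_wdegree n m w b : (plen w <= n)%N -> (plen b <= m)%N ->
  (-1 : k) ^ (wdegree n.+1 w * wdegree m.+1 b) = (-1) ^+ ((n - plen w) * (m - plen b)).
Proof.
move=> wn bm; rewrite !wdegree_plen.
rewrite [X in _ ^ X](_ : _ = ((n - plen w) * (m - plen b))%N%:Z); last first.
  rewrite PoszM -!subzn //; ring.
by rewrite -exprnP.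
Qed.

Lemma cor_L_on S n z : uniq S -> size S = n ->
  eqop C S (cor (word_cogen z n [::]) S) ((z * signL n) *: cor (genL n) S).
Proof.
move=> uS sz.
have e : eqop C (iota 1 n) (cor (word_cogen z n [::]) (iota 1 n)) ((z * signL n) *: cor (genL n) (iota 1 n)).
  apply: eqop_trans (cor_scale z n [::]) _; rewrite -scalerA; apply: eqopZ.
  have := eqopZ (signL n) (cor_L k (perm_refl (iota 1 n))).
  by rewrite scalerA signLK scale1r /ell size_map size_iota => /eqop_sym.
have := eqop_unstd uS sz e.
have mS : map (unstd S) (iota 1 n) = S by rewrite -sz map_unstd.
by rewrite linearZ /= !relabel_cor mS.
Qed.

(** In a tree of brackets any one label may be regarded as planar. This is why
    cuts that isolate a single planar input produce space corollas. *)
Lemma chin_one n t : (0 < n)%N ->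
  chin k n [:: 1%N] t = (-1) ^+ n.-1 * chin k n [::] t.
Proof.
move=> n0; have := cogen_expand char0 (word_cogen 1 n [:: 1%N]) t; rewrite /= mul1r => ->.
rewrite big_cons big1_seq ?addr0 => [|a /andP[_ aw]]; last first.
  rewrite mul1r; case: (eqVneq (chin k n [:: 1%N] (word_tree n a)) 0) => [->|]; first by rewrite !mul0r.
  rewrite /chin; case: ifP => [_|]; last by rewrite eqxx.
  move/chi_word; case: a aw => [|x a] aw; first by rewrite mem_words in aw.
  case/planar_word_normal_tree_sub => H _; case: a aw H => [|y a] aw H; first by rewrite mem_words in aw.
  by have := H isT.
rewrite mul1r; case: (boolP (monomial (P := P) (iota 1 n) t)) => mt; last first.
  by rewrite {2 3}/chin (negPf mt) !mulr0.
have n2 : (2 <= n)%N.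
  case/and3P: (mt); case: (t) => // g ts _ /wf_node[t1 [t2 [-> w1 w2]]] /perm_size.
  rewrite size_iota => <-; have := nleaves_gt0 w1; have := nleaves_gt0 w2.
  by rewrite -/(nleaves _) nleaves2; lia.
rewrite chin_mono ?(monomial_word_tree k n2 (mem_head _ _)) //; congr (_ * _).
case: n n0 n2 mt => [//|[//|n]] _ _ mt.
set N := normal_tree n.+2 [::] (iota 2 n).
have -> : word_tree n.+2 [::] = br (Leaf 1) N by [].
have lN : leaves N = iota 2 n.+1.
  by rewrite leaves_normal_tree -{2}(addn1 n) iotaD add2n.
have eN : {in leaves N, mem [:: 1%N] =1 mem [::]}.
  by move=> y; rewrite lN mem_iota => /andP[y2 _]; rewrite !app_mem inE in_nil; apply/negbTE; case: eqP y2 => // ->.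
have pN : planar_word (mem [::]) N = Some [::].
  by rewrite planar_word_normal_tree ?planar_word_right_comb //; [right | apply/allP].
rewrite !chiE !spelling_node2 /= (eq_planar_word eN) (eq_local_signs eN) (eq_spelling eN) pN /=.
set w := spelling _ N; rewrite !count_pred0_lt add0n.
have cw : count (fun b => (b < 2)%N) w = n.
  have pc := planar_word_count pN.
  have -> : count (fun b => (b < 2)%N) w = num_zeros w.
    apply: eq_in_count => -[|[|y]] yw //=.
    by have := mem_spell (isT : (0 < 1)%N) yw; rewrite lbls_pword lN mem_iota.
  have : num_pos w = n.+1.
    rewrite /num_pos -size_filter -/(pos w) pos_spelling size_map.
    by rewrite (eq_filter (a2 := predT)) // filter_predT lN size_iota.
  by rewrite -pc addn1 => -[].
rewrite cw -exprD; apply: sign_eq.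
apply: (@odd_eq_double _ _ 0 (inversions w + local_signs (mem [::]) N)).
move: (inversions w) (local_signs _ N) => x y; lia.
Qed.

End CutValue.

Section Formulas.
Variable k : fieldType.
Hypothesis char0 : [pchar k] =i pred0.
Local Notation P := (Gerst_dual k).
Local Notation C := (cobar P).
Local Notation clin := (lin k (cogen P)).
Local Notation cor phi s := (<< Node phi (lf s) >> : clin).
Local Notation word_cogen := (@word_cogen k).
Local Notation signL := (signL k).
Local Notation signM := (signM k).
Local Notation genL := (genL k).
Local Notation genM := (genM k).

Lemma cor_one_on S n z : uniq S -> size S = n -> (0 < n)%N ->
  eqop C S (cor (word_cogen z n [:: 1%N]) S) ((z * (-1) ^+ n.-1 * signL n) *: cor (genL n) S).
Proof.
move=> uS sz n0.
have e : eqop C (iota 1 n) (cor (word_cogen z n [:: 1%N]) (iota 1 n))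
    ((z * (-1) ^+ n.-1) *: cor (word_cogen 1 n [::]) (iota 1 n)).
  have := @corolla_sum k P _ n (wdegree n [::]) (fun _ : unit => z * (-1) ^+ n.-1)
    (fun=> word_cogen 1 n [::]) (fun _ _ => erefl) (fun _ _ => erefl) [:: tt]
    (word_cogen z n [:: 1%N]) erefl erefl.
  rewrite big_seq1; apply => t.
  by rewrite big_seq1 /= mul1r chin_one // mulrA.
have mS : map (unstd S) (iota 1 n) = S by rewrite -sz map_unstd.
have := eqop_unstd uS sz e; rewrite linearZ /= !relabel_cor mS => {}e.
apply: eqop_trans e _; rewrite -scalerA; apply: eqopZ.
by have := @cor_L_on k S n 1 uS sz; rewrite mul1r.
Qed.

Lemma cor_M_on S n w r z : sorted ltn S -> size S = n -> perm_eq (w ++ r) S ->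
  eqop C S (cor (word_cogen z n (map (std S) w)) S)
   ((z * ((-1) ^+ (inversions (w ++ r) + inversions r) * signM (size w) (size r))) *:
     cor (genM (size w) (size r)) (w ++ r)).
Proof.
move=> ss sz pwr; have uS := sorted_uniq ltn_trans ltnn ss.
have pS : perm_eq (map (std S) w ++ map (std S) r) (iota 1 n).
  by rewrite -map_cat -sz -(map_std uS) perm_map.
have sub x : x \in w ++ r -> x \in S by rewrite (perm_mem pwr).
have mono_inv l : {subset l <= w ++ r} -> inversions (map (std S) l) = inversions l.
  move=> lS; apply: inversions_mono => x y /lS/sub xS /lS/sub yS.
  exact: std_mono.
have e : eqop C (iota 1 n) (cor (word_cogen z n (map (std S) w)) (iota 1 n))
    ((z * ((-1) ^+ (inversions (w ++ r) + inversions r) * signM (size w) (size r))) *: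
     cor (genM (size w) (size r)) (map (std S) w ++ map (std S) r)).
  apply: eqop_trans (cor_scale z n _) _; rewrite -scalerA; apply: eqopZ.
  have := cor_M k pS; rewrite -map_cat !mono_inv //; last first.
    by move=> x xr; rewrite mem_cat xr orbT.
  rewrite /em !size_map; set c := _ * signM _ _ => h.
  have := eqop_sym (eqopZ c h); rewrite scalerA.
  have -> : c * c = 1 by rewrite /c mulrACA signMsign signMK mul1r.
  by rewrite scale1r map_cat /lf [in X in _ -> X]map_cat.
have mS : map (unstd S) (iota 1 n) = S by rewrite -sz map_unstd.
have mwr : map (unstd S) (map (std S) w ++ map (std S) r) = w ++ r.
  rewrite -map_cat -map_comp -[RHS]map_id; apply/eq_in_map => x /sub xS.
  by rewrite /= /unstd /std /= nth_index.
by have := eqop_unstd uS sz e; rewrite linearZ /= !relabel_cor mS mwr.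
Qed.

(** ** The differential of the space corollas *)

Lemma space_cross_nil s' s : space_cross [::] s' s = cross s' s.
Proof.
rewrite /space_cross /cross; apply: eq_big => [x|x _]; first by rewrite in_nil.
by apply: eq_count => y; rewrite in_nil andbT.
Qed.

(** Without planar labels each cut contributes one term, whose signs cancel. *)
Theorem d_genL n : (2 <= n)%N ->
  eqop C (iota 1 n) (cobar_d << ell genL (lf (iota 1 n)) >>)
    (\sum_(I : {set 'I_n} | (2 <= #|I|)%N && (1 <= #|~: I|)%N)
       << ell genL (ell genL (lf (lab 0 I)) :: lf (lab 0 (~: I))) >>).
Proof.
move=> n2; rewrite {1}/ell size_map size_iota cobar_d_corolla // d_gen_cuts.
apply: eqop_sum => I /andP[I2 I1].
have sub0 : {subset [::] <= lab 0 (~: I)} by [].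
have u0 := uniq0J (phi := genL n) I.
have := cut_value char0 I2 I1 (decomposition_space (signL n) I2 I1 sub0) (U := genL #|~: I|.+1)
  (s1 := [::]) erefl (perm_refl _) (@cor_L_on k _ _ 1 u0 (congr1 succn (size_lab 0 (~: I))))
  (@cor_L_on k _ _ _ (lab_uniq 0 I) (size_lab 0 I)).
rewrite /=.
have szC : n = (#|I| + #|~: I|)%N by rewrite cardsC card_ord.
set c := _ * _; have -> : c = 1; last first.
  by rewrite scale1r /ell /= !size_map -!cardE.
rewrite /c (cut_signE I [::]) {1}/plen /= muln0 addn0.
rewrite space_cross_nil (inversions_cross (lab_sorted _ _) (lab_sorted _ _)).
move: (cross _ _) (#|I|) (#|~: I|) I2 szC => x [//|i] j _ szC.
rewrite (@sign_wdegree k _ i [::] [::]) // /plen /= !subn0 mul1r.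
rewrite !signLE szC addSn /= binD2 -!exprD; apply: (@sign_eq k _ 0).
apply: (@odd_eq_double _ _ 0 (x + 'C(j, 2) + 'C(i, 2) + j * i)); lia.
Qed.

End Formulas.

(** ** Sets of inputs of a planar corolla *)

Section Inputs.
Variables p q : nat.

Lemma split_lshift (i : 'I_p) : split (lshift q i) = inl i.
Proof. exact: (unsplitK (inl i : 'I_p + 'I_q)). Qed.

Lemma split_rshift (j : 'I_q) : split (rshift p j) = inr j.
Proof. exact: (unsplitK (inr j : 'I_p + 'I_q)). Qed.

Definition inputs (A : {set 'I_p}) (B : {set 'I_q}) : {set 'I_(p + q)} :=
  [set x | match split x with inl i => i \in A | inr j => j \in B end].

Lemma inputs_bij : bijective (fun AB : {set 'I_p} * {set 'I_q} => inputs AB.1 AB.2).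
Proof.
pose inv (I : {set 'I_(p + q)}) : {set 'I_p} * {set 'I_q} :=
  ([set i : 'I_p | lshift q i \in I], [set j : 'I_q | rshift p j \in I]).
exists inv => [[A B]|I]; rewrite /inv /=.
  by congr (_, _); apply/setP => i; rewrite !inE ?split_lshift ?split_rshift.
apply/setP => x; rewrite !inE; case: splitP => i xi; rewrite inE; congr (_ \in I); exact/val_inj.
Qed.

Lemma setC_inputs A B : ~: inputs A B = inputs (~: A) (~: B).
Proof. by apply/setP => x; rewrite !inE; case: split => i; rewrite inE. Qed.

Lemma lab_inputs A B : lab 0 (inputs A B) = lab 0 A ++ lab p B.
Proof.
apply: (irr_sorted_eq ltn_trans ltnn); rewrite ?lab_sorted //.
  rewrite sorted_pairwise; last exact: ltn_trans.
  rewrite pairwise_cat -!(sorted_pairwise ltn_trans) !lab_sorted !andbT.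
  apply/allrelP => x y /lab_iota; rewrite mem_iota => /andP[_ xp] /lab_iota.
  by rewrite mem_iota /= => /andP[py _]; lia.
move=> x; rewrite mem_cat; apply/idP/orP.
  move/mapP => [i]; rewrite mem_enum inE => iI ->.
  case: (splitP i) iI => j ij jI; [left|right].
    by rewrite -[val i]/(nat_of_ord i) ij mem_lab.
  by rewrite -[val i]/(nat_of_ord i) ij add0n mem_lab.
case=> /mapP[i iI ->].
  rewrite -[(0 + _).+1]/((0 + lshift q i).+1) mem_lab inE split_lshift.
  by rewrite mem_enum in iI.
rewrite -[(p + _).+1]/((0 + rshift p i).+1) mem_lab inE split_rshift.
by rewrite mem_enum in iI.
Qed.

Lemma card_inputs A B : #|inputs A B| = (#|A| + #|B|)%N.
Proof. by rewrite -(size_lab 0) lab_inputs size_cat !size_lab. Qed.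

Lemma big_inputs (V : nmodType) (F : {set 'I_(p + q)} -> V) (Q : pred {set 'I_(p + q)}) :
  \sum_(I | Q I) F I =
  \sum_(B : {set 'I_q}) \sum_(A : {set 'I_p} | Q (inputs A B)) F (inputs A B).
Proof.
rewrite pair_big_dep /=; apply: (reindex (fun BA => inputs BA.2 BA.1)).
apply: onW_bij; case: inputs_bij => inv invK Kinv.
exists (fun I => ((inv I).2, (inv I).1)) => [[B A]|I] /=.
  by rewrite (invK (A, B)).
exact: Kinv.
Qed.

Definition interval (s l : nat) : {set 'I_p} := [set i : 'I_p | (s <= i < s + l)%N].

Lemma lab_interval s l : (s + l <= p)%N -> lab 0 (interval s l) = iota s.+1 l.
Proof.
move=> slp; apply: (irr_sorted_eq ltn_trans ltnn); rewrite ?lab_sorted ?iota_ltn_sorted //.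
move=> x; apply/mapP/idP => [[i]|].
  by rewrite mem_enum inE mem_iota => /andP[si isl] ->; rewrite -[val i]/(nat_of_ord i); lia.
rewrite mem_iota => /andP[sx xsl]; have xp : (x.-1 < p)%N by lia.
exists (Ordinal xp); last by rewrite /=; lia.
by rewrite mem_enum inE /=; lia.
Qed.

Lemma card_interval s l : (s + l <= p)%N -> #|interval s l| = l.
Proof. by move=> slp; rewrite -(size_lab 0) lab_interval // size_iota. Qed.

Lemma lab_intervalC s l : (s + l <= p)%N ->
  lab 0 (~: interval s l) = iota 1 s ++ iota (s + l).+1 (p - (s + l)).
Proof.
move=> slp; apply: (irr_sorted_eq ltn_trans ltnn); rewrite ?lab_sorted //.
  rewrite sorted_pairwise; last exact: ltn_trans.
  rewrite pairwise_cat -!(sorted_pairwise ltn_trans) !iota_ltn_sorted !andbT.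
  by apply/allrelP => x y; rewrite !mem_iota => ? ?; lia.
move=> x; rewrite mem_cat !mem_iota; apply/mapP/idP => [[i]|H].
  rewrite mem_enum !inE negb_and -ltnNge -leqNgt => H ->.
  have := ltn_ord i => /= ip.
  by case/orP: H => H; apply/orP; [left|right]; lia.
have xp : (x.-1 < p)%N by lia.
exists (Ordinal xp); last by rewrite /=; lia.
rewrite mem_enum !inE negb_and -ltnNge -leqNgt /=.
by case/orP: H => H; apply/orP; [left|right]; lia.
Qed.

Definition intervals : seq (nat * nat) :=
  flatten [seq [seq (s, l) | s <- iota 0 (p - l).+1] | l <- iota 1 p].

Lemma mem_intervals s l : ((s, l) \in intervals) = (0 < l)%N && (s + l <= p)%N.
Proof.
apply/flattenP/idP => [[r /mapP[l']]|/andP[l0 slp]].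
  by rewrite mem_iota => lp -> /mapP[s']; rewrite mem_iota => sp [-> ->]; lia.
exists [seq (s, l) | s <- iota 0 (p - l).+1].
  by apply: (map_f (fun l => [seq (s, l) | s <- iota 0 (p - l).+1])); rewrite mem_iota; lia.
by apply: (map_f (fun s => (s, l))); rewrite mem_iota; lia.
Qed.

Lemma uniq_intervals : uniq intervals.
Proof.
pose r l := iota 0 (p - l).+1; have ur l : uniq (r l) by apply: iota_uniq.
change (uniq (flatten [seq [seq (s, l) | s <- r l] | l <- iota 1 p])); clearbody r.
elim: (iota 1 p) (iota_uniq 1 p) => //= l ls IH /andP[lls uls].
rewrite cat_uniq IH // andbT map_inj_uniq ?ur /=; last by move=> x y [].
apply/hasP => -[x /flattenP[w /mapP[l' l'ls ->]] /mapP[s _ ->]] /mapP[s' _ [_ ll']].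
by rewrite -ll' l'ls in lls.
Qed.

(** Cuts contribute only if their planar part is contiguous. *)
Lemma big_intervals (V : nmodType) (F : {set 'I_p} -> V) :
  (forall A, A != set0 -> (forall s l, (0 < l)%N -> (s + l <= p)%N -> A <> interval s l) -> F A = 0) ->
  \sum_A F A = F set0 +
    \sum_(l <- iota 1 p) \sum_(s <- iota 0 (p - l).+1) F (interval s l).
Proof.
move=> F0; pose r := set0 :: [seq interval x.1 x.2 | x <- intervals].
have card_x x : x \in intervals -> #|interval x.1 x.2| = x.2.
  by case: x => s l; rewrite mem_intervals => /andP[_ slp]; apply: card_interval.
have ur : uniq r.
  rewrite /= map_inj_in_uniq.
    apply/andP; split.
      apply/mapP => -[[s l] xin /(congr1 (fun A : {set _} => #|A|))].
      rewrite cards0 (card_x _ xin) /= => l0; move: xin.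
      by rewrite mem_intervals -l0.
    exact: uniq_intervals.
  move=> [s l] [s' l'] xin yin /= e.
  have ll : l = l' by have := card_x _ yin; rewrite /= -e => <-; apply: esym; exact: (card_x _ xin).
  subst l'; move: xin yin; rewrite !mem_intervals => /andP[l0 sl] /andP[_ sl'].
  have := congr1 (fun A : {set 'I_p} => lab 0 A) e; rewrite !lab_interval //.
  by case: (l) l0 => // l' _ [->].
rewrite (bigID (mem r)) /= [X in _ + X]big1 ?addr0 => [|A Ar]; last first.
  apply: F0 => [|s l l0 slp Asl].
    by apply: contraNneq Ar => ->; rewrite mem_head.
  move/negP: Ar; apply; rewrite inE Asl; apply/orP; right.
  by apply/mapP; exists (s, l); rewrite // mem_intervals l0.
rewrite -(big_uniq _ ur) big_cons big_map /intervals big_flatten big_map.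
by congr (_ + _); apply: eq_bigr => l _; rewrite big_map.
Qed.

End Inputs.

(** ** The differential of the planar corollas *)

(** Equality of parities of sums and products, by cases on the atoms. *)
Ltac parity := rewrite !(oddD, oddM, oddS) /=;
  repeat match goal with |- context [odd ?n] => case: (odd n) end.

Section PlanarCuts.
Variable k : fieldType.
Hypothesis char0 : [pchar k] =i pred0.
Local Notation P := (Gerst_dual k).
Local Notation C := (cobar P).
Local Notation clin := (lin k (cogen P)).
Local Notation cor phi s := (<< Node phi (lf s) >> : clin).
Local Notation word_cogen := (@word_cogen k).
Local Notation signL := (signL k).
Local Notation signM := (signM k).
Local Notation genL := (genL k).
Local Notation genM := (genM k).

Lemma sign_wdegree_pos n m w b : (plen w <= n)%N -> (0 < m)%N -> (plen b <= m.-1)%N ->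
  (-1 : k) ^ (wdegree n.+1 w * wdegree m b) = (-1) ^+ ((n - plen w) * (m.-1 - plen b)).
Proof. by move=> wn m0 bm; rewrite -{1}(prednK m0) sign_wdegree. Qed.

Lemma plen_size w : w != [::] -> plen w = (size w).-1.
Proof. by rewrite /plen; case: w => //= x w _; rewrite addn0. Qed.

Lemma plen_map h w : plen (map h w) = plen w.
Proof. by rewrite /plen size_map; case: w. Qed.

Variables p q : nat.
Hypothesis p2 : (2 <= p)%N.
Local Notation ps := (iota 1 p).

(** The shuffle sign of the space inputs. It enters both through the cut and
    through the functional, and cancels. *)
Definition space_inversions (B : {set 'I_q}) : nat := cross (lab p B) (lab p (~: B)).

Lemma inversions_inputs (A : {set 'I_p}) (B : {set 'I_q}) :
  inversions (lab 0 (inputs A B) ++ lab 0 (~: inputs A B)) =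
  (cross (lab 0 A) (lab 0 (~: A)) + #|B| * #|~: A| + space_inversions B)%N.
Proof.
rewrite inversions_cross ?lab_sorted // setC_inputs !lab_inputs.
rewrite !cross_catl !cross_catr (cross0 (w := lab 0 A) (w' := lab p (~: B))) ?addn0; last first.
  by move=> x y /lab_iota + /lab_iota; rewrite !mem_iota; lia.
rewrite (cross_all (w := lab p B) (w' := lab 0 (~: A))) ?size_lab ?addnA // => x y /lab_iota + /lab_iota.
by rewrite !mem_iota; lia.
Qed.

Lemma space_cross_inputs (A : {set 'I_p}) (B : {set 'I_q}) :
  space_cross ps (lab 0 (inputs A B)) (lab 0 (~: inputs A B)) = space_inversions B.
Proof.
have inA (A' : {set 'I_p}) x : x \in lab 0 A' -> x \in ps by move/lab_iota.
have outB (B' : {set 'I_q}) x : x \in lab p B' -> x \notin ps.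
  move=> /lab_iota; rewrite mem_iota => /andP[px _].
  by rewrite mem_iota add1n ltnS negb_and orbC -ltnNge px.
rewrite setC_inputs !lab_inputs /space_cross big_cat /= big_seq_cond big1 ?add0n.
  rewrite big_seq_cond [RHS]big_seq; apply: eq_big => [x|x /andP[xB _]].
    by case xB: (x \in lab p B) => //=; rewrite (outB _ _ xB).
  rewrite count_cat -[RHS]add0n; congr (_ + _)%N.
    apply/eqP; rewrite -leqn0 leqNgt -has_count; apply/hasP => -[y /inA yp] /=.
    by rewrite yp andbF.
  by apply: eq_in_count => y /outB ->; rewrite andbT.
by move=> x /andP[/inA ->].
Qed.

Lemma set0_interval : set0 = interval p 0 0.
Proof. by apply/setP => i; rewrite !inE. Qed.

Lemma lab_set0C : lab 0 (~: (set0 : {set 'I_p})) = ps.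
Proof. by rewrite set0_interval lab_intervalC // subn0. Qed.

(** The four kinds of terms of the differential, for one subset of the space
    inputs. *)
Definition formula_m_l (B : {set 'I_q}) : clin :=
  << em genM (lf ps) (ell genL (lf (lab p B)) :: lf (lab p (~: B))) >>.

Definition formula_l_m (B : {set 'I_q}) : clin :=
  << ell genL (em genM (lf ps) (lf (lab p B)) :: lf (lab p (~: B))) >>.

Definition formula_m_lp (s : nat) (B : {set 'I_q}) : clin :=
  << em genM (lf (iota 1 s.-1) ++ ell genL (Leaf s :: lf (lab p B))
                :: lf (iota s.+1 (p - s)))
             (lf (lab p (~: B))) >>.

Definition formula_m_m (a s : nat) (B : {set 'I_q}) : clin :=
  << em genM (lf (iota 1 s) ++ em genM (lf (iota s.+1 a)) (lf (lab p B))
                :: lf (iota (s + a).+1 (p - (s + a))))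
             (lf (lab p (~: B))) >>.

Definition cut (I : {set 'I_(carity (genM p q))}) : clin := cut_sum I (decomposition I).
Local Notation D A B := (cut (inputs A B)).

Lemma plen_ps : plen ps = p.-1.
Proof. by rewrite /plen size_iota; case: (p) p2 => //= n _; rewrite addn0. Qed.

Lemma cards_C (n : nat) (B : {set 'I_n}) : n = (#|B| + #|~: B|)%N.
Proof. by rewrite cardsC card_ord. Qed.

(** No planar input is put on the inner vertex. *)
Lemma cut_m_l (B : {set 'I_q}) : (2 <= #|B|)%N ->
  eqop C (iota 1 (p + q)) (D set0 B) ((-1) ^+ p.+1 *: formula_m_l B).
Proof.
move=> B2; pose I : {set 'I_(carity (genM p q))} := inputs set0 B.
have cI : #|I| = #|B| by rewrite /I card_inputs cards0.
have cC : #|~: I| = (p + #|~: B|)%N.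
  by rewrite /I setC_inputs card_inputs setC0 cardsT card_ord.
have I2 : (2 <= #|I|)%N by rewrite cI.
have I1 : (1 <= #|~: I|)%N by rewrite cC; lia.
have LE : lab 0 I = lab p B.
  by rewrite /I lab_inputs set0_interval lab_interval.
have JE : lab 0 (~: I) = ps ++ lab p (~: B) by rewrite /I setC_inputs lab_inputs lab_set0C.
have sub : {subset ps <= lab 0 (~: I)} by move=> x xp; rewrite JE mem_cat xp.
have s0 := sorted0J I.
have sz0 : size (0%N :: lab 0 (~: I)) = #|~: I|.+1 by rewrite /= size_lab.
have pu : perm_eq (ps ++ 0%N :: lab p (~: B)) (0%N :: lab 0 (~: I)).
  by rewrite JE -cat1s perm_catCA.
have eu := @cor_M_on k _ _ ps (0%N :: lab p (~: B)) 1 s0 sz0 pu.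
have ev := @cor_L_on k (lab 0 I) #|I| (signM p q * (-1) ^+ space_cross ps (lab 0 I) (lab 0 (~: I)) *
    (-1) ^ (wdegree #|~: I|.+1 (map (std (0%N :: lab 0 (~: I))) ps) * wdegree #|I| [::]))
    (lab_uniq 0 I) (size_lab 0 I).
have cU : carity (genM (size ps) (size (0%N :: lab p (~: B)))) = #|~: I|.+1.
  by rewrite /= size_iota size_lab cC; lia.
have := cut_value char0 (phi := genM p q) I2 I1 (decomposition_space (signM p q) I2 I1 sub) cU pu eu ev.
move=> e; apply: eqop_trans e _.
rewrite [cdeg _]/= (cut_signE (phi := genM p q)) inversions_inputs space_cross_inputs.
rewrite LE plen_map sign_wdegree_pos ?plen_map ?plen_ps //; [|rewrite cC; lia|rewrite cI; lia].
rewrite (cross0 (w := lab 0 set0)); last by move=> x y; rewrite set0_interval lab_interval.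
have inv0 : inversions (ps ++ 0%N :: lab p (~: B)) = p.
  rewrite inversions_cross ?iota_ltn_sorted //; last first.
    by rewrite /= path_min_sorted ?lab_sorted //; apply/allP => x /mapP[i _ ->].
  rewrite -cat1s cross_catr (cross_all (w' := [:: 0%N])) ?size_iota ?muln1; last first.
    by move=> x y; rewrite mem_iota inE => /andP[x1 _] /eqP->.
  by rewrite cross0 ?addn0 // => x y + /lab_iota; rewrite !mem_iota; lia.
rewrite inv0 (inversions_sorted (_ : sorted ltn (0%N :: lab p (~: B)))); last first.
  by rewrite /= path_min_sorted ?lab_sorted //; apply/allP => x /mapP[i _ ->].
have -> : (<< Node (genM (size ps) (size (0%N :: lab p (~: B))))
      (lf ps ++ Node (genL #|I|) (lf (lab p B)) :: lf (lab p (~: B))) >> : clin) = formula_m_l B.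
  by rewrite /formula_m_l /em /ell /= !size_map -!cardE cI.
set c := _ * _; have -> : c = (-1) ^+ p.+1; last exact: eqop_refl.
rewrite {}/c !signLE !signME size_iota /= size_lab cI cC setC0 cardsT card_ord.
rewrite !mul1r; move: (#|B|) (#|~: B|) (space_inversions B) B2 (cards_C B) => [//|x] y z _ ->.
case: (p) p2 => // r _; rewrite /plen /= !subn0 -!exprD; apply: (@sign_eq k).
rewrite (_ : (r.+1 + y - r)%N = y.+1); last by lia.
rewrite !(binS, bin1, addSn, addnS, bin0, binD2).
by parity.
Qed.

Section Interval.
Variables (s l : nat) (B : {set 'I_q}).
Hypothesis l0 : (0 < l)%N.
Hypothesis slp : (s + l <= p)%N.
Local Notation I := (inputs (interval p s l) B : {set 'I_(carity (genM p q))}).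
Local Notation LI := (lab 0 I).
Local Notation J := (lab 0 (~: I)).
Local Notation l1 := (iota 1 s).
Local Notation l2 := (iota s.+1 l).
Local Notation l3 := (iota (s + l).+1 (p - (s + l))).

Lemma iota_cut : ps = l1 ++ l2 ++ l3.
Proof.
rewrite -(iotaD s.+1 l) -[s.+1]add1n -iotaD; congr iota; lia.
Qed.

Lemma lab_cut : LI = l2 ++ lab p B.
Proof. by rewrite lab_inputs lab_interval. Qed.

Lemma lab_cutC : J = l1 ++ l3 ++ lab p (~: B).
Proof. by rewrite setC_inputs lab_inputs lab_intervalC // catA. Qed.

Lemma card_cut : #|I| = (l + #|B|)%N.
Proof. by rewrite card_inputs card_interval. Qed.

Lemma card_cutC : #|~: I| = (p - l + #|~: B|)%N.
Proof.
rewrite -(size_lab 0) lab_cutC !size_cat !size_iota size_lab; clear -slp; lia.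
Qed.

Lemma cross_cut : cross (lab 0 (interval p s l)) (lab 0 (~: interval p s l)) = (l * s)%N.
Proof.
rewrite lab_interval // lab_intervalC // cross_catr (cross_all (w' := l1)).
  rewrite !size_iota cross0 ?addn0 // => x y; rewrite !mem_iota => /andP[_ xl] /andP[yl _]; lia.
move=> x y; rewrite !mem_iota => /andP[xs _] /andP[_ ys]; lia.
Qed.

Lemma perm_cut : perm_eq (l1 ++ 0%N :: l3 ++ lab p (~: B)) (0%N :: J).
Proof. by rewrite lab_cutC -cat1s -[0%N :: (l1 ++ _)]cat1s perm_catCA. Qed.

Lemma inversions_cut : inversions (l1 ++ 0%N :: l3 ++ lab p (~: B)) = s.
Proof.
have s3 : sorted ltn (l3 ++ lab p (~: B)).
  have : sorted ltn J := lab_sorted _ _; rewrite lab_cutC.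
  by apply: subseq_sorted; [exact: ltn_trans | exact: suffix_subseq].
have s03 : sorted ltn (0%N :: l3 ++ lab p (~: B)).
  rewrite /= path_min_sorted ?s3 //; apply/allP => x; rewrite mem_cat => /orP[|/lab_iota].
    by rewrite mem_iota => /andP[xs _]; exact: leq_ltn_trans xs.
  by rewrite mem_iota => /andP[xs _]; exact: leq_ltn_trans xs.
rewrite inversions_cross ?iota_ltn_sorted // -cat1s cross_catr (cross_all (w' := [:: 0%N])).
  rewrite size_iota muln1 cross0 ?addn0 // => x y; rewrite mem_iota => /andP[_ xs].
  by rewrite mem_cat => /orP[|/lab_iota]; rewrite mem_iota => /andP[ys _]; clear -slp xs ys; lia.
by move=> x y; rewrite mem_iota inE => /andP[x1 _] /eqP->.
Qed.

(** The cuts that put the planar inputs s + 1, ..., s + l on the inner vertex. The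
    sign left over by shuffle and Koszul signs is compared below with the
    normalisations of the corollas U and V. *)
Lemma cut_interval U V (al be : k) s1 s2 t' : (2 <= #|I|)%N -> (1 <= #|~: I|)%N ->
  carity U = #|~: I|.+1 -> perm_eq (s1 ++ 0%N :: s2) (0%N :: J) ->
  eqop C (0%N :: J) (cor (word_cogen 1 #|~: I|.+1 (map (std (0%N :: J)) (l1 ++ 0%N :: l3))) (0%N :: J))
    (al *: cor U (s1 ++ 0%N :: s2)) ->
  (forall z, eqop C LI (cor (word_cogen z #|I| (map (std LI) l2)) LI) ((z * be) *: cor V t')) ->
  eqop C (iota 1 (p + q)) (D (interval p s l) B)
    (((-1) ^+ (l * s + l * (p - l) + #|B| * #|~: B|) * signM p q * (al * be)) *:
     << Node U (lf s1 ++ Node V (lf t') :: lf s2) >>).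
Proof.
move=> I2 I1 cU pU eu ev.
have bn : l2 != [::] by case: (l) l0.
have sub1 : {subset l1 <= J} by move=> x; rewrite lab_cutC mem_cat => ->.
have sub3 : {subset l3 <= J} by move=> x; rewrite lab_cutC !mem_cat => ->; rewrite orbT.
have sub2 : {subset l2 <= LI} by move=> x; rewrite lab_cut mem_cat => ->.
have := cut_value char0 I2 I1 (decomposition_planar (signM p q) I2 I1 iota_cut bn sub1 sub3 sub2)
  cU pU eu (ev _).
move=> e; apply: eqop_trans e _; set c := _ * _.
suff -> : c = (-1) ^+ (l * s + l * (p - l) + #|B| * #|~: B|) * signM p q * (al * be) by exact: eqop_refl.
have planar_word : plen (l1 ++ 0%N :: l3) = (p - l)%N.
  rewrite plen_size; last by case: (l1).
  rewrite size_cat /= !size_iota; lia.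
have pl2 : plen l2 = l.-1 by rewrite plen_size // size_iota.
rewrite {}/c [cdeg _]/= (cut_signE (phi := genM p q)) inversions_inputs space_cross_inputs cross_cut.
have cI : #|~: interval p s l| = (p - l)%N.
  rewrite -(size_lab 0) lab_intervalC // size_cat !size_iota; lia.
rewrite plen_map sign_wdegree_pos ?plen_map ?planar_word ?pl2; first last.
- by rewrite card_cut; lia.
- by rewrite card_cut; lia.
- by rewrite card_cutC; lia.
rewrite cI card_cut card_cutC; case: (l) l0 => // l' _ /=; rewrite addKn addKn.
move: (p - l'.+1)%N (#|B|) (#|~: B|) (space_inversions B) => t x y z; clear.
set e := signM p q.
transitivity ((-1) ^+ (l'.+1 * s + x * t + z + (l'.+1 + x) * t + (z + y * x)) * e * (al * be)).
  by rewrite [in RHS]exprD [in RHS](exprD _ z); ring.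
congr (_ * _ * _); apply: (@sign_eq k).
by parity.
Qed.

Lemma std_head a r : std (a :: r) a = 1%N.
Proof. by rewrite /std /= eqxx. Qed.

(** The label 0 of the outer vertex moves past the s planar inputs before it. *)
Lemma outer_M : eqop C (0%N :: J)
  (cor (word_cogen 1 #|~: I|.+1 (map (std (0%N :: J)) (l1 ++ 0%N :: l3))) (0%N :: J))
  (((-1) ^+ s * signM (p - l).+1 #|~: B|) *:
     cor (genM (p - l).+1 #|~: B|) (l1 ++ 0%N :: l3 ++ lab p (~: B))).
Proof.
have pu : perm_eq ((l1 ++ 0%N :: l3) ++ lab p (~: B)) (0%N :: J) by rewrite -catA; exact: perm_cut.
have sz0 : size (0%N :: J) = #|~: I|.+1 by rewrite /= size_lab.
have := @cor_M_on k _ _ _ _ 1 (sorted0J I) sz0 pu.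
rewrite (inversions_sorted (lab_sorted _ _)) -catA inversions_cut addn0 mul1r size_lab.
have -> : size (l1 ++ 0%N :: l3) = (p - l).+1 by rewrite size_cat /= !size_iota; clear -slp; lia.
exact.
Qed.

Lemma inner_M z : eqop C LI (cor (word_cogen z #|I| (map (std LI) l2)) LI)
  ((z * signM l #|B|) *: cor (genM l #|B|) (l2 ++ lab p B)).
Proof.
have pv : perm_eq (l2 ++ lab p B) LI by rewrite lab_cut.
have := @cor_M_on k _ _ _ _ z (lab_sorted _ _) (size_lab _ _) pv.
by rewrite -lab_cut !(inversions_sorted (lab_sorted _ _)) size_iota size_lab mul1r.
Qed.

(** An isolated planar input counts as a space input of the inner vertex. *)
Lemma inner_L z : l = 1%N -> eqop C LI (cor (word_cogen z #|I| (map (std LI) l2)) LI)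
  ((z * ((-1) ^+ #|B| * signL #|B|.+1)) *: cor (genL #|B|.+1) LI).
Proof.
move=> le; have -> : map (std LI) l2 = [:: 1%N].
  by rewrite lab_cut le /= std_head.
have cI : #|I| = #|B|.+1 by rewrite card_cut le.
have := @cor_one_on k char0 LI #|B|.+1 z (lab_uniq _ _); rewrite size_lab cI mulrA => /(_ erefl isT).
exact.
Qed.

(** When all planar inputs are on the inner vertex, the outer one has the only
    planar label 0, which counts as a space input. *)
Lemma outer_L : s = 0%N -> l = p -> eqop C (0%N :: J)
  (cor (word_cogen 1 #|~: I|.+1 (map (std (0%N :: J)) (l1 ++ 0%N :: l3))) (0%N :: J))
  (((-1) ^+ #|~: B| * signL #|~: B|.+1) *: cor (genL #|~: B|.+1) (0%N :: lab p (~: B))).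
Proof.
move=> s0 lp; have JE : J = lab p (~: B) by rewrite lab_cutC s0 lp add0n subnn.
have -> : map (std (0%N :: J)) (l1 ++ 0%N :: l3) = [:: 1%N].
  by rewrite s0 lp add0n subnn /= std_head.
have cI : #|~: I| = #|~: B| by rewrite card_cutC lp subnn.
have := @cor_one_on k char0 (0%N :: J) #|~: B|.+1 1 (uniq0J (phi := genM p q) I).
by rewrite /= size_lab cI mul1r JE => /(_ erefl isT).
Qed.

End Interval.

End PlanarCuts.

Section PlanarFormula.
Variable k : fieldType.
Hypothesis char0 : [pchar k] =i pred0.
Local Notation P := (Gerst_dual k).
Local Notation C := (cobar P).
Local Notation clin := (lin k (cogen P)).
Local Notation cor phi s := (<< Node phi (lf s) >> : clin).
Local Notation signL := (signL k).
Local Notation signM := (signM k).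
Local Notation genL := (genL k).
Local Notation genM := (genM k).

Variables p q : nat.
Hypothesis p2 : (2 <= p)%N.
Local Notation ps := (iota 1 p).
Local Notation D A B := (cut (k := k) (inputs A B)).

Lemma cut_m_lp s (B : {set 'I_q}) : (1 <= #|B|)%N -> (s < p)%N ->
  eqop C (iota 1 (p + q)) (D (interval p s 1) B) ((-1) ^+ p.+1 *: formula_m_lp k p s.+1 B).
Proof.
move=> B1 sp; have slp : (s + 1 <= p)%N by rewrite addn1.
pose I : {set 'I_(carity (genM p q))} := inputs (interval p s 1) B.
have cI : #|I| = #|B|.+1 by rewrite (card_cut k B slp).
have cC := card_cutC k B slp.
have I2 : (2 <= #|I|)%N by rewrite cI.
have I1 : (1 <= #|~: I|)%N by rewrite cC; lia.
have cU : carity (genM (p - 1).+1 #|~: B|) = #|~: I|.+1 by rewrite cC.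
have e := cut_interval char0 p2 (isT : (0 < 1)%N) slp I2 I1 cU (perm_cut k B slp)
  (outer_M k B slp) (fun z => inner_L char0 B slp z erefl).
refine (eqop_trans e _); set c := _ * _.
set t := << _ >>; have -> : t = formula_m_lp k p s.+1 B.
  rewrite /t (lab_cut k B slp) /formula_m_lp /em /ell /= addn1 /lf !map_cat /= !size_cat /= !size_map !size_iota -!cardE.
  by rewrite -catA /= (_ : (s + (p - s.+1).+1)%N = (p - 1).+1) //; lia.
suff -> : c = (-1) ^+ p.+1 by exact: eqop_refl.
rewrite {}/c !signLE !signME; move: (#|B|) (#|~: B|) (cards_C B) => x y ->.
case: (p) p2 => // r _; rewrite subn1 /= !mulrA -!exprD; apply: (@sign_eq k).
by rewrite !(binS, bin1, addSn, addnS, bin0, binD2); parity.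
Qed.

Lemma cut_l_m (B : {set 'I_q}) : (1 <= #|~: B|)%N ->
  eqop C (iota 1 (p + q)) (D (interval p 0 p) B) (formula_l_m k p B).
Proof.
move=> B1; have slp : (0 + p <= p)%N by [].
pose I : {set 'I_(carity (genM p q))} := inputs (interval p 0 p) B.
have cI := card_cut k B slp.
have cC : #|~: I| = #|~: B| by rewrite (card_cutC k B slp) subnn.
have I2 : (2 <= #|I|)%N by rewrite cI; lia.
have I1 : (1 <= #|~: I|)%N by rewrite cC.
have cU : carity (genL #|~: B|.+1) = #|~: I|.+1 by rewrite cC.
have p0 : (0 < p)%N by lia.
have JE : lab 0 (~: I) = lab p (~: B) by rewrite (lab_cutC k B slp) add0n subnn.
have pU : perm_eq ([::] ++ 0%N :: lab p (~: B)) (0%N :: lab 0 (~: I)) by rewrite JE.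
have e := cut_interval char0 p2 p0 slp I2 I1 cU pU
  (outer_L char0 B slp erefl erefl) (fun z => inner_M B slp z).
refine (eqop_trans e _); set c := _ * _.
set t := << _ >>; have -> : t = formula_l_m k p B.
  by rewrite /t /formula_l_m /em /ell /= /lf !map_cat /= !size_map !size_iota -!cardE.
suff -> : c = 1 by rewrite scale1r; exact: eqop_refl.
rewrite {}/c !signLE !signME; move: (#|B|) (#|~: B|) (cards_C B) => x y ->.
rewrite subnn !mulrA -!exprD; apply: (@sign_eq k _ 0).
by rewrite -addSn !(binS, bin1, addSn, addnS, bin0, binD2); parity.
Qed.

Lemma cut_m_m s l (B : {set 'I_q}) : (2 <= l < p)%N -> (s + l <= p)%N ->
  eqop C (iota 1 (p + q)) (D (interval p s l) B)
   ((-1) ^+ p.+1 *: ((-1) ^+ (l + s * (l + 1)) *: formula_m_m k p l s B)).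
Proof.
move=> /andP[l2 lp] slp; have l0 : (0 < l)%N by lia.
pose I : {set 'I_(carity (genM p q))} := inputs (interval p s l) B.
have cI := card_cut k B slp.
have cC := card_cutC k B slp.
have I2 : (2 <= #|I|)%N by rewrite cI; lia.
have I1 : (1 <= #|~: I|)%N by rewrite cC; lia.
have cU : carity (genM (p - l).+1 #|~: B|) = #|~: I|.+1 by rewrite cC.
have e := cut_interval char0 p2 l0 slp I2 I1 cU (perm_cut k B slp)
  (outer_M k B slp) (fun z => inner_M B slp z).
refine (eqop_trans e _); set c := _ * _.
set t := << _ >>; have -> : t = formula_m_m k p l s B.
  rewrite /t /formula_m_m /em /ell /= /lf !map_cat /= !size_cat /= !size_map !size_iota -!cardE.
  by rewrite -catA /= (_ : (s + (p - (s + l)).+1)%N = (p - l).+1) //; lia.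
rewrite scalerA; suff -> : c = (-1) ^+ p.+1 * (-1) ^+ (l + s * (l + 1)) by exact: eqop_refl.
rewrite {}/c !signME; move: (#|B|) (#|~: B|) (cards_C B) => x y ->.
move: (p - l)%N (subnKC (ltnW lp)) => r <-; rewrite !mulrA -!exprD; apply: (@sign_eq k).
by rewrite !(binS, bin1, addSn, addnS, bin0, binD2); parity.
Qed.

(** A contiguous factor of the word of all planar inputs is an interval. *)
Lemma cut_other (A : {set 'I_p}) (B : {set 'I_q}) :
  (2 <= #|inputs A B|)%N -> (1 <= #|~: inputs A B|)%N -> A != set0 ->
  (forall s l, (0 < l)%N -> (s + l <= p)%N -> A <> interval p s l) ->
  eqop C (iota 1 (p + q)) (D A B) 0.
Proof.
move=> I2 I1 A0 notint.
pose I : {set 'I_(carity (genM p q))} := inputs A B.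
have inA i : ((val i).+1 \in lab 0 I) = (i \in A).
  rewrite -[RHS](mem_lab 0) /I lab_inputs mem_cat orbC.
  case ip: (_ \in lab p B) => //; have := lab_iota ip.
  by rewrite mem_iota => /andP[+ _]; have := ltn_ord i; rewrite /=; lia.
have inC i : ((val i).+1 \in lab 0 (~: I)) = (i \notin A).
  rewrite -in_setC -[RHS](mem_lab 0) /I setC_inputs lab_inputs mem_cat orbC.
  case ip: (_ \in lab p (~: B)) => //; have := lab_iota ip.
  by rewrite mem_iota => /andP[+ _]; have := ltn_ord i; rewrite /=; lia.
have inp (i : 'I_p) : (val i).+1 \in ps by rewrite mem_iota /= add1n ltnS ltn_ord.
apply: (cut_none char0 (phi := genM p q) I2 I1); apply: decomposition_nil => //.
  by move=> sub; have /set0Pn[i iA] := A0; have := sub _ (inp i); rewrite inC iA.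
move=> l b r psE b0 lJ rJ bI.
have szb : (0 < size b)%N by case: (b) b0.
have szp : (size l + size b <= p)%N.
  by rewrite -(size_iota 1 p) psE !size_cat addnA leq_addr.
have bE : b = iota (size l).+1 (size b).
  have : take (size b) (drop (size l) ps) = b by rewrite psE drop_size_cat // take_size_cat.
  by rewrite drop_iota take_iota add1n => <-; congr iota; rewrite size_iota; lia.
apply: (notint _ _ szb szp); apply/setP => i; rewrite inE.
apply/idP/idP => [iA|H].
  have : (val i).+1 \in l ++ b ++ r by rewrite -psE.
  rewrite !mem_cat => /orP[/lJ|/orP[|/rJ]]; rewrite ?inC ?iA //.
  by rewrite {1}bE mem_iota.
by rewrite -inA; apply: bI; rewrite {1}bE mem_iota.
Qed.

End PlanarFormula.

Section PlanarDifferential.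
Variable k : fieldType.
Hypothesis char0 : [pchar k] =i pred0.
Local Notation P := (Gerst_dual k).
Local Notation C := (cobar P).
Local Notation clin := (lin k (cogen P)).
Local Notation genL := (genL k).
Local Notation genM := (genM k).

Lemma big_compositions p (V : nmodType) (F : nat -> nat -> V) : (2 <= p)%N ->
  \sum_(a < p.+2) \sum_(b < p.+2 | [&& (a + b == p.+1)%N, (2 <= a)%N & (2 <= b)%N])
    \sum_(s < b) F a s =
  \sum_(a <- iota 2 (p - 2)) \sum_(s <- iota 0 (p - a).+1) F a s.
Proof.
move=> p2; pose G a := if (2 <= a < p)%N then \sum_(s <- iota 0 (p - a).+1) F a s else 0.
rewrite (eq_bigr (fun a : 'I_p.+2 => G a)) => [|a _].
  rewrite -(big_mkord xpredT G) /index_iota.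
  have -> : iota 0 (p.+2 - 0) = [:: 0; 1]%N ++ iota 2 (p - 2) ++ [:: p; p.+1].
    case: (p) p2 => [|[|r]] // _; rewrite subn0 !subSS subn0.
    have -> : r.+4 = (2 + (r + 2))%N by rewrite addn2.
    by rewrite 2!iotaD !add0n.
  have G0 a : ~~ (2 <= a < p)%N -> G a = 0 by rewrite /G => /negPf->.
  rewrite !big_cat /= !big_cons !big_nil !G0 ?ltnn ?andbF //; last first.
    by rewrite negb_and orbC -leqNgt leqnSn.
  rewrite !addr0 !add0r /G.
  by apply: eq_big_seq => a; rewrite mem_iota => H; rewrite ifT //; lia.
rewrite /G; case: ifP => [/andP[a2 ap]|na].
  have bp : (p.+1 - a < p.+2)%N by lia.
  rewrite (big_pred1 (Ordinal bp)) => [|b].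
    rewrite -(big_mkord xpredT (F a)) /index_iota /= subn0 subSn //; exact: ltnW.
  rewrite a2 -[RHS]/(b == Ordinal bp) -val_eqE /=; apply/idP/idP => [/andP[/eqP e _]|/eqP->]; first by apply/eqP; lia.
  by apply/andP; split; first apply/eqP; lia.
rewrite big_pred0 // => b; apply/negP => /and3P[/eqP e a2 b2].
by move/negP: na; apply; lia.
Qed.

Variables p q : nat.
Hypothesis p2 : (2 <= p)%N.

(** The contributing cuts have on the inner vertex no planar input, a single one,
    all of them, or a proper interval of length at least 2. *)
Lemma d_cuts (B : {set 'I_q}) :
  eqop C (iota 1 (p + q))
    (\sum_(A : {set 'I_p} | (2 <= #|inputs A B|)%N && (1 <= #|~: inputs A B|)%N)
       cut (k := k) (inputs A B))
    ((-1) ^+ p.+1 *: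
      ((if (2 <= #|B|)%N then formula_m_l k p B else 0)
       - (-1) ^+ p *: (if (1 <= #|~: B|)%N then formula_l_m k p B else 0)
       + (if (1 <= #|B|)%N then \sum_(1 <= s < p.+1) formula_m_lp k p s B else 0)
       + \sum_(l <- iota 2 (p - 2)) \sum_(s <- iota 0 (p - l).+1)
           (-1) ^+ (l + s * (l + 1)) *: formula_m_m k p l s B)).
Proof.
pose r := set0 :: [seq interval p x.1 x.2 | x <- intervals p].
pose F (A : {set 'I_p}) : clin := if (2 <= #|inputs A B|)%N && (1 <= #|~: inputs A B|)%N
  then cut (k := k) (inputs A B) else 0.
pose G A := if A \in r then F A else 0.
have r_int s l : (0 < l)%N -> (s + l <= p)%N -> interval p s l \in r.
  move=> l0 slp; rewrite inE; apply/orP; right; apply/mapP; exists (s, l) => //.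
  by rewrite mem_intervals l0.
rewrite big_mkcond -[X in eqop _ _ X _]/(\sum_A F A).
apply: (@eqop_trans _ C _ (\sum_A G A)).
  apply: eqop_sum => A _; rewrite /G; case: (boolP (A \in r)) => [_|nr]; first exact: eqop_refl.
  rewrite /F; case: ifP => [/andP[I2 I1]|_]; last exact: eqop_refl.
  apply: (cut_other char0 p2 I2 I1).
    by apply: contraNneq nr => ->; rewrite mem_head.
  by move=> s l l0 slp e; move/negP: nr; apply; rewrite e; exact: r_int.
rewrite (@big_intervals p _ G) => [|A A0 nint]; last first.
  rewrite /G inE (negPf A0) /=; case: ifP => // /mapP[[s l]].
  by rewrite mem_intervals => /andP[l0 slp] /(nint _ _ l0 slp).
have Gint s l : (0 < l)%N -> (s + l <= p)%N -> G (interval p s l) = F (interval p s l).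
  by move=> l0 slp; rewrite /G r_int.
have cI s l : (s + l <= p)%N -> #|inputs (interval p s l) B| = (l + #|B|)%N.
  exact: card_cut.
have cC s l : (s + l <= p)%N -> #|~: inputs (interval p s l) B| = (p - l + #|~: B|)%N.
  exact: card_cutC.
have -> : iota 1 p = [:: 1%N] ++ iota 2 (p - 2) ++ [:: p].
  case: (p) p2 => [|[|n]] // _; rewrite !subSS subn0.
  by rewrite -[[:: n.+2]]/(iota n.+2 1) -{2}add2n -(iotaD 2 n 1) addn1.
rewrite !big_cat /= !big_seq1.
have e0 : eqop C (iota 1 (p + q)) (G set0)
    ((-1) ^+ p.+1 *: (if (2 <= #|B|)%N then formula_m_l k p B else 0)).
  rewrite /G mem_head /F card_inputs setC_inputs card_inputs cards0 setC0 cardsT card_ord.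
  rewrite (_ : (0 < p + _)%N) ?andbT ?add0n; last by lia.
  case: ifP => B2; last by rewrite scaler0; exact: eqop_refl.
  exact: cut_m_l.
have e1 : eqop C (iota 1 (p + q)) (\sum_(s <- iota 0 (p - 1).+1) G (interval p s 1))
    ((-1) ^+ p.+1 *:
      (if (1 <= #|B|)%N then \sum_(1 <= s < p.+1) formula_m_lp k p s B else 0)).
  have -> : (if (1 <= #|B|)%N then \sum_(1 <= s < p.+1) formula_m_lp k p s B else 0) =
      \sum_(s <- iota 0 (p - 1).+1) (if (1 <= #|B|)%N then formula_m_lp k p s.+1 B else 0).
    rewrite subn1 prednK; last by lia.
    case: ifP => _; last by rewrite big1.
    by rewrite big_add1 /= /index_iota subn0.
  rewrite scaler_sumr; apply: eqop_sum_seq => s; rewrite mem_iota => /andP[_ sp].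
  have slp : (s + 1 <= p)%N by lia.
  have c1 : (1 <= p - 1 + #|~: B|)%N by lia.
  rewrite (Gint s 1 isT slp) /F (cI s 1 slp) (cC s 1 slp) c1 andbT add1n ltnS.
  case: ifP => B1; last by rewrite scaler0; exact: eqop_refl.
  have sp' : (s < p)%N by lia.
  exact: cut_m_lp.
have e2 : eqop C (iota 1 (p + q)) (\sum_(s <- iota 0 (p - p).+1) G (interval p s p))
    ((-1) ^+ p.+1 *: - ((-1) ^+ p *: (if (1 <= #|~: B|)%N then formula_l_m k p B else 0))).
  rewrite subnn /= big_seq1 scalerN scalerA -exprD -scaleNr.
  have -> : - (-1) ^+ (p.+1 + p) = 1 :> k.
    by rewrite -[RHS]opprK; congr (- _); apply: (@sign_eq k _ 1); rewrite oddD /= addNb addbb.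
  rewrite scale1r Gint //; last by lia.
  rewrite /F cI // cC // subnn (_ : (1 < p + _)%N) ?add0n ?andTb; last by lia.
  case: ifP => B1; last exact: eqop_refl.
  exact: cut_l_m.
have e3 : eqop C (iota 1 (p + q))
    (\sum_(l <- iota 2 (p - 2)) \sum_(s <- iota 0 (p - l).+1) G (interval p s l))
    ((-1) ^+ p.+1 *: \sum_(l <- iota 2 (p - 2)) \sum_(s <- iota 0 (p - l).+1)
      (-1) ^+ (l + s * (l + 1)) *: formula_m_m k p l s B).
  rewrite scaler_sumr; apply: eqop_sum_seq => l; rewrite mem_iota => /andP[l2 lp].
  rewrite scaler_sumr; apply: eqop_sum_seq => s; rewrite mem_iota => /andP[_ sp].
  have slp : (s + l <= p)%N by lia.
  have l0 : (0 < l)%N by lia.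
  have c2 : (2 <= l + #|B|)%N && (1 <= p - l + #|~: B|)%N by apply/andP; split; lia.
  rewrite (Gint s l l0 slp) /F (cI s l slp) (cC s l slp) c2.
  have lp' : (2 <= l < p)%N by lia.
  exact: cut_m_m.
have := eqopD (eqopD (eqopD e0 e2) e1) e3; rewrite -!scalerDr; congr eqop.
by rewrite -!addrA; congr (_ + _); rewrite [RHS]addrA [RHS]addrC.
Qed.

Theorem d_genM : eqop C (iota 1 (p + q))
  (cobar_d << em genM (lf (iota 1 p)) (lf (iota p.+1 q)) >>)
  ((-1) ^+ p.+1 *:
     (\sum_(I : {set 'I_q} | (2 <= #|I|)%N) formula_m_l k p I
      - (-1) ^+ p *: \sum_(I : {set 'I_q} | (1 <= #|~: I|)%N) formula_l_m k p I
      + \sum_(I : {set 'I_q} | (1 <= #|I|)%N) \sum_(1 <= s < p.+1) formula_m_lp k p s I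
      + \sum_(I : {set 'I_q}) \sum_(a < p.+2)
          \sum_(b < p.+2 | [&& (a + b == p.+1)%N, (2 <= a)%N & (2 <= b)%N])
          \sum_(s < b) (-1) ^+ (a + s * (a + 1)) *: formula_m_m k p a s I)).
Proof.
have -> : em genM (lf (iota 1 p)) (lf (iota p.+1 q)) = Node (genM p q) (lf (iota 1 (p + q))).
  by rewrite /em !size_map !size_iota iotaD add1n /lf map_cat.
rewrite cobar_d_corolla // d_gen_cuts big_inputs.
apply: (@eqop_trans _ C _ (\sum_(B : {set 'I_q}) _)).
  by apply: eqop_sum => B _; exact: d_cuts.
rewrite -scaler_sumr; apply: eqopZ.
rewrite !big_split /= sumrN -scaler_sumr -!big_mkcond.
under [X in eqop _ _ _ (_ + X)]eq_bigr => B _ do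
  rewrite (big_compositions (fun a s => (-1) ^+ (a + s * (a + 1)) *: formula_m_m k p a s B) p2).
exact: eqop_refl.
Qed.

End PlanarDifferential.

Theorem proposition3p6p1 (k : fieldType) (char0 : [pchar k] =i pred0) :
  exists (L : nat -> cogen (Gerst_dual k))
         (M : nat -> nat -> cogen (Gerst_dual k)),
    let l := ell L in
    let m := em M in
    [/\ standard_generators L M,
        forall n, (2 <= n)%N ->
          eqop (Gerst_infty k) (iota 1 n)
            (cobar_d << l (lf (iota 1 n)) >>)
            (\sum_(I : {set 'I_n} | (2 <= #|I|)%N && (1 <= #|~: I|)%N)
               << l (l (lf (lab 0 I)) :: lf (lab 0 (~: I))) >>) &
        forall p q, (2 <= p)%N ->
          eqop (Gerst_infty k) (iota 1 (p + q))
            (cobar_d << m (lf (iota 1 p)) (lf (iota p.+1 q)) >>)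
            ((-1) ^+ p.+1 *:
             (\sum_(I : {set 'I_q} | (2 <= #|I|)%N)
                << m (lf (iota 1 p)) (l (lf (lab p I)) :: lf (lab p (~: I))) >>
              - (-1) ^+ p *: \sum_(I : {set 'I_q} | (1 <= #|~: I|)%N)
                << l (m (lf (iota 1 p)) (lf (lab p I)) :: lf (lab p (~: I))) >>
              + \sum_(I : {set 'I_q} | (1 <= #|I|)%N) \sum_(1 <= s < p.+1)
                << m (lf (iota 1 s.-1) ++ l (Leaf s :: lf (lab p I))
                        :: lf (iota s.+1 (p - s)))
                     (lf (lab p (~: I))) >>
              + \sum_(I : {set 'I_q}) \sum_(a < p.+2)
                \sum_(b < p.+2 | [&& (a + b == p.+1)%N, (2 <= a)%N & (2 <= b)%N])
                \sum_(s < b) (-1) ^+ (a + s * (a + 1)) *: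
                << m (lf (iota 1 s)
                        ++ m (lf (iota s.+1 a)) (lf (lab p I))
                        :: lf (iota (s + a).+1 (p - (s + a))))
                     (lf (lab p (~: I))) >>))].
Proof.
exists (genL k), (genM k); split.
- exact: gen_standard.
- exact: d_genL.
- by move=> p q p2; exact: d_genM.
Qed.
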